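(* Let $\kappa^2>0$, $I=[-1,1]$, $\mathcal{C}=I\times\mathbb{S}^1$ and \[ \mathcal{E}(\mathbf{m})=\int_{-1}^{1}\int_{-\pi}^{\pi}\Big(|\partial_t\mathbf{m}|^2+|\partial_z\mathbf{m}|^2+\kappa^2|\mathbf{m}\times\mathbf{n}|^2\Big)\,dt\,dz,\qquad\mathbf{m}\in H^1(\mathcal{C},\mathbb{S}^2). \] Then $\pm\mathbf{n}$ and $\pm\mathbf{e}_3$ are critical points of $\mathcal{E}$ for every $\kappa^2>0$, and: (i) if $\kappa^2\ge3$, then $\pm\mathbf{n}$ are the only global minimizers of $\mathcal{E}$ in $H^1(\mathcal{C},\mathbb{S}^2)$; $\pm\mathbf{n}$ are stable for every $\kappa^2\ge1$ and unstable for $0<\kappa^2<1$; moreover, for $\kappa^2>1$, $\pm\mathbf{n}$ are local minimizers of $\mathcal{E}$ in $H^1(\mathcal{C},\mathbb{S}^2)$. (ii) $\pm\mathbf{e}_3$ are unstable for every $\kappa^2>0$.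
   Context: $\mathcal{C}$ is the circular cylinder parameterized by $(z,t)\mapsto(\cos t,\sin t,z)$, $z\in[-1,1]$, $t\in[-\pi,\pi]$, with maps $2\pi$-periodic in $t$; $H^1(\mathcal{C},\mathbb{S}^2)$ denotes $H^1$ maps into $\mathbb{R}^3$ with values a.e. in the unit sphere. $\mathbf{n}(t)=(\cos t,\sin t,0)$, $\mathbf{e}_3=(0,0,1)$, $\nabla=(\partial_z,\partial_t)$. A critical point is a weak solution of $-\Delta\mathbf{m}-\kappa^2(\mathbf{m}\cdot\mathbf{n})\mathbf{n}=\lambda\mathbf{m}$ with $\lambda=|\nabla\mathbf{m}|^2-\kappa^2(\mathbf{m}\cdot\mathbf{n})^2$. The second variation at a critical point $\mathbf{m}$ is \[ \mathcal{E}''(\mathbf{m})(\boldsymbol{\varphi})=\int_{-1}^1\int_{-\pi}^{\pi}|\nabla\boldsymbol{\varphi}|^2-\kappa^2(\boldsymbol{\varphi}\cdot\mathbf{n})^2-\big(|\nabla\mathbf{m}|^2-\kappa^2(\mathbf{m}\cdot\mathbf{n})^2\big)|\boldsymbol{\varphi}|^2\,dt\,dz \] for $\boldsymbol{\varphi}\in H^1\cap L^\infty(\mathcal{C},\mathbb{R}^3)$ with $\boldsymbol{\varphi}\cdot\mathbf{m}=0$ a.e. A critical point is stable if $\mathcal{E}''(\mathbf{m})(\boldsymbol{\varphi})\ge0$ for all such $\boldsymbol{\varphi}$, and unstable if $\mathcal{E}''(\mathbf{m})(\boldsymbol{\varphi})<0$ for some such $\boldsymbol{\varphi}$. A local minimizer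 is an $\mathbf{m}$ such that $\mathcal{E}(\mathbf{m})\le\mathcal{E}(\mathbf{m}')$ for all $\mathbf{m}'\in H^1(\mathcal{C},\mathbb{S}^2)$ with $\|\mathbf{m}'-\mathbf{m}\|_{H^1(\mathcal{C})}$ sufficiently small. *)

(* Defs.v *)
From HB Require Import structures.
From mathcomp Require Import all_boot all_order all_algebra.
From mathcomp Require Import all_classical all_reals all_analysis.
Set Implicit Arguments. Unset Strict Implicit. Unset Printing Implicit Defensive.
Import Order.TTheory GRing.Theory Num.Theory.
Import numFieldNormedType.Exports.
Local Open Scope classical_set_scope.
Local Open Scope ring_scope.

Section Cylinder.
Variable R : realType.

Definition vec := 'I_3 -> R.
Definition i0 : 'I_3 := @Ordinal 3 0 isT.
Definition i1 : 'I_3 := @Ordinal 3 1 isT.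
Definition i2 : 'I_3 := @Ordinal 3 2 isT.
Definition vec3 (a b c : R) : vec :=
  fun i => if val i == 0%N then a else if val i == 1%N then b else c.
Definition dot (u v : vec) : R := \sum_(i < 3) u i * v i.
Definition cross (u v : vec) : vec :=
  vec3 (u i1 * v i2 - u i2 * v i1) (u i2 * v i0 - u i0 * v i2)
       (u i0 * v i1 - u i1 * v i0).

(* maps on the cylinder: (z,t) |-> m z t, 2pi-periodic in t *)
Definition field := R -> R -> vec.
Definition sfield := R -> R -> R.

Definition cyl_nfield : field := fun z t => vec3 (cos t) (sin t) 0.
Definition cyl_e3field : field := fun z t => vec3 0 0 1.
Definition cyl_oppf (m : field) : field := fun z t i => - m z t i.
Definition cyl_subf (m m' : field) : field := fun z t i => m z t i - m' z t i.

Definition periodic {T} (f : R -> R -> T) := forall z t, f z (t + 2 * pi) = f z t.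

Definition Dom : set (R * R) := `[-1, 1]%classic `*` `[- pi, pi]%classic.
Definition mu2 := (@lebesgue_measure R \x @lebesgue_measure R)%E.

Definition I2 (f : sfield) : R := (\int[mu2]_(p in Dom) f p.1 p.2)%R.

Definition L2 (f : sfield) :=
  measurable_fun setT (fun p : R * R => f p.1 p.2) /\
  mu2.-integrable Dom (fun p => ((f p.1 p.2) ^+ 2)%:E).

Definition Linf (f : sfield) :=
  exists C : R, mu2.-negligible (Dom `&` [set p | C < `|f p.1 p.2|]).

Definition dz_ (phi : sfield) : sfield := fun z t => derive1 (fun z' => phi z' t) z.
Definition dt_ (phi : sfield) : sfield := fun z t => derive1 (phi z) t.

Definition testfun (phi : sfield) :=
  periodic phi /\
  (exists delta : R, 0 < delta /\ forall z t, 1 - delta <= `|z| -> phi z t = 0) /\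
  (forall z t, derivable (fun z' => phi z' t) z 1 /\ derivable (phi z) t 1) /\
  continuous (fun p : R * R => phi p.1 p.2) /\
  continuous (fun p : R * R => dz_ phi p.1 p.2) /\
  continuous (fun p : R * R => dt_ phi p.1 p.2).

Definition weak_grad (m : field) (G : field * field) :=
  periodic m /\ periodic G.1 /\ periodic G.2 /\
  forall i : 'I_3,
    L2 (fun z t => m z t i) /\ L2 (fun z t => G.1 z t i) /\ L2 (fun z t => G.2 z t i) /\
    forall phi, testfun phi ->
      I2 (fun z t => m z t i * dz_ phi z t) = - I2 (fun z t => G.1 z t i * phi z t) /\
      I2 (fun z t => m z t i * dt_ phi z t) = - I2 (fun z t => G.2 z t i * phi z t).

Definition H1 (m : field) := exists G, weak_grad m G.

Definition H1S2 (m : field) :=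
  H1 m /\ mu2.-negligible (Dom `&` [set p | dot (m p.1 p.2) (m p.1 p.2) != 1]).

Definition H1Linf (phi : field) (Gphi : field * field) :=
  weak_grad phi Gphi /\ forall i, Linf (fun z t => phi z t i).

Variable k2 : R.

Definition energy (m : field) (G : field * field) : R :=
  I2 (fun z t => dot (G.2 z t) (G.2 z t) + dot (G.1 z t) (G.1 z t)
                 + k2 * dot (cross (m z t) (cyl_nfield z t)) (cross (m z t) (cyl_nfield z t))).

Definition gradsq (G : field * field) : sfield :=
  fun z t => dot (G.1 z t) (G.1 z t) + dot (G.2 z t) (G.2 z t).
Definition gradprod (G H : field * field) : sfield :=
  fun z t => dot (G.1 z t) (H.1 z t) + dot (G.2 z t) (H.2 z t).

Definition lam (m : field) (G : field * field) : sfield :=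
  fun z t => gradsq G z t - k2 * (dot (m z t) (cyl_nfield z t)) ^+ 2.

(* weak solution of -Lap m - k2 (m.n) n = lam m *)
Definition cyl_critical (m : field) :=
  H1S2 m /\ forall G, weak_grad m G -> forall phi Gphi, H1Linf phi Gphi ->
    I2 (fun z t => gradprod G Gphi z t
          - k2 * dot (m z t) (cyl_nfield z t) * dot (phi z t) (cyl_nfield z t)
          - lam m G z t * dot (m z t) (phi z t)) = 0.

Definition second_var (m : field) (G : field * field) (phi : field) (Gphi : field * field) : R :=
  I2 (fun z t => gradsq Gphi z t - k2 * (dot (phi z t) (cyl_nfield z t)) ^+ 2
                 - lam m G z t * dot (phi z t) (phi z t)).

Definition tangent (m phi : field) :=
  mu2.-negligible (Dom `&` [set p | dot (phi p.1 p.2) (m p.1 p.2) != 0]).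

Definition cyl_stable (m : field) :=
  cyl_critical m /\ forall G, weak_grad m G -> forall phi Gphi,
    H1Linf phi Gphi -> tangent m phi -> 0 <= second_var m G phi Gphi.

Definition cyl_unstable (m : field) :=
  cyl_critical m /\ exists phi Gphi, H1Linf phi Gphi /\ tangent m phi /\
    forall G, weak_grad m G -> second_var m G phi Gphi < 0.

Definition cyl_global_minimizer (m : field) :=
  H1S2 m /\ forall G, weak_grad m G -> forall m' G', H1S2 m' -> weak_grad m' G' ->
    energy m G <= energy m' G'.

Definition H1dist2 (m : field) (G : field * field) (m' : field) (G' : field * field) : R :=
  I2 (fun z t => dot (cyl_subf m' m z t) (cyl_subf m' m z t)
      + dot (cyl_subf G'.1 G.1 z t) (cyl_subf G'.1 G.1 z t)
      + dot (cyl_subf G'.2 G.2 z t) (cyl_subf G'.2 G.2 z t)).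

Definition cyl_local_minimizer (m : field) :=
  H1S2 m /\ forall G, weak_grad m G -> exists delta : R, 0 < delta /\
    forall m' G', H1S2 m' -> weak_grad m' G' -> H1dist2 m G m' G' < delta ->
      energy m G <= energy m' G'.

Definition cyl_ae_eq (m m' : field) :=
  mu2.-negligible (Dom `&` [set p | m p.1 p.2 != m' p.1 p.2]).

End Cylinder.

(* Main.v *)
(* Write m = u n + v n' + w e3 with n' = dn/dt, and let D = (u_t, v_t, w_t). On the sphere,
   E(m) - 4 pi is the integral of
     |m_z|^2 + |D|^2 + 2 (u v_t - v u_t) + k2 v^2 + (k2 - 1) w^2.
   On almost every circle z = const the components of m are absolutely continuous and periodic
   in t, so the t-derivative of any polynomial in (u, v, w) may be added to the density without
   changing the energy. For k2 >= 3 there is such a polynomial that makes the density at least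
   (|D|^2 + v^2 + w^2) / 100 pointwise. Hence E(m) >= 4 pi, and in case of equality v = w = 0 and
   u = +-1 is constant on each circle; since m_z = 0, the integral of u over the circles does not
   depend on z, so m = n or m = - n. For k2 > 1 a simpler polynomial works on the circles on which
   v^2 + w^2 <= 1/4. Maps that are H^1-close to n satisfy this on every circle without large
   Dirichlet energy, because the integral of 1 - u over the circles is small uniformly in z.
   For the second variation, tangency to n gives phi.n = 0, so the sign is that of k2 - 1; the
   directions e3 at n and e1 at e3 exhibit the instabilities. *)

Require Import Defs.
From HB Require Import structures.
From mathcomp Require Import all_boot all_order all_algebra.
From mathcomp Require Import all_classical all_reals all_analysis.
From mathcomp Require Import measurable_realfun ring lra.
Import Order.TTheory GRing.Theory Num.Theory.
Import numFieldNormedType.Exports.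
Local Open Scope classical_set_scope.
Local Open Scope ring_scope.
Set Implicit Arguments. Unset Strict Implicit. Unset Printing Implicit Defensive.

(** * Integrals, null sets and iterated integrals *)

(** The weak derivatives are given only through test functions supported away from z = -1 and z = 1.
    Absolute continuity on circles has to be extracted from this, and the null set of bad circles
    depends a priori on the test function. A countable family, indexed by rational endpoints and
    integers and approximating indicator functions of intervals, is rich enough for the fundamental
    lemma and lets one null set serve all its members. Calibrations are polynomial so that the
    product rule for primitives is the only calculus needed on a circle. The threshold 3 leaves room
    for this: on the circle w = 0, the form 2 d th must be changed by an exact form into one bounded
    by 2 sqrt k2 |v| d th; integration over a full turn requires 4 pi <= 8 sqrt k2, that is k2 >=
    pi^2 / 4, which is less than 3. In two dimensions H^1 closeness gives no uniform closeness;
    hence the separate treatment of circles of large Dirichlet energy in the local statement. A weak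
    gradient is determined only almost everywhere while the definitions quantify over all of them,
    so explicit values of a gradient enter through uniqueness. *)

Section ae_Rintegral.
Context d (T : measurableType d) (R : realType).
Variable mu : {measure set T -> \bar R}.
Variable D : set T.
Hypothesis mD : measurable D.
Implicit Types f g : T -> R.

Lemma ae_eq_Rintegral f g : measurable_fun D f -> measurable_fun D g ->
  {ae mu, forall x, D x -> f x = g x} ->
  \int[mu]_(x in D) f x = \int[mu]_(x in D) g x.
Proof.
move=> mf mg fg; congr fine; apply: ae_eq_integral => //.
- exact/measurable_EFinP.
- exact/measurable_EFinP.
- by apply: filterS fg => x fg Dx; rewrite fg.
Qed.

Lemma ae_eq_integrable f g : measurable_fun D g ->
  {ae mu, forall x, D x -> f x = g x} ->
  mu.-integrable D (EFin \o f) -> mu.-integrable D (EFin \o g).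
Proof.
move=> mg fg intf; have mf := measurable_int _ intf.
have /integrableP[_ foo] := intf.
apply/integrableP; split; first exact/measurable_EFinP.
rewrite -(@ae_eq_integral _ _ _ mu D _ (fun x => `|(EFin \o f) x|%E)) //.
- exact: measurableT_comp.
- by apply: measurableT_comp => //; exact/measurable_EFinP.
- by apply: filterS fg => x fg Dx; rewrite /= fg.
Qed.

Lemma ae_Rintegral_ge0 f : measurable_fun D f ->
  {ae mu, forall x, D x -> 0 <= f x} -> 0 <= \int[mu]_(x in D) f x.
Proof.
move=> mf f0.
rewrite (@ae_eq_Rintegral _ (fun x => `|f x|)) //.
- by apply: Rintegral_ge0.
- exact: measurableT_comp.
- by apply: filterS f0 => x f0 Dx; rewrite ger0_norm// f0.
Qed.

Lemma ae_le_Rintegral f g :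
  mu.-integrable D (EFin \o f) -> mu.-integrable D (EFin \o g) ->
  {ae mu, forall x, D x -> f x <= g x} ->
  \int[mu]_(x in D) f x <= \int[mu]_(x in D) g x.
Proof.
move=> intf intg fg; rewrite -subr_ge0 -RintegralB//.
apply: ae_Rintegral_ge0; last by apply: filterS fg => x fg Dx; rewrite subr_ge0 fg.
have /integrableP[/measurable_EFinP mf _] := intf.
have /integrableP[/measurable_EFinP mg _] := intg.
exact: measurable_funB.
Qed.

Lemma ae_Rintegral_eq0 f : mu.-integrable D (EFin \o f) ->
  {ae mu, forall x, D x -> 0 <= f x} -> \int[mu]_(x in D) f x <= 0 ->
  {ae mu, forall x, D x -> f x = 0}.
Proof.
move=> intf f0 if0.
have /integrableP[mf _] := intf; have /measurable_EFinP mf' := mf.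
have : ae_eq mu D (EFin \o f) (cst 0%E).
  apply: (proj1 (ae_eq_integral_abs mu mD mf)).
  rewrite (@ae_eq_integral _ _ _ mu D (EFin \o f))//; last 2 first.
  - exact: measurableT_comp.
  - by apply: filterS f0 => x f0 Dx; rewrite /= ger0_norm// f0.
  rewrite -[LHS]fineK; last exact: integrable_fin_num.
  congr EFin; apply/eqP; rewrite eq_le; apply/andP; split; first exact: if0.
  exact: ae_Rintegral_ge0.
by apply: filterS => x + Dx => /(_ Dx)/= [].
Qed.

Lemma integrable_boundedM f g (C : R) : mu.-integrable D (EFin \o f) ->
  measurable_fun D g -> (forall x, D x -> `|g x| <= C) ->
  mu.-integrable D (EFin \o (fun x => f x * g x)).
Proof.
move=> intf mg gC.
rewrite (_ : EFin \o _ = (EFin \o f) \* (EFin \o g))%E; last first.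
  by apply/funext => x /=; rewrite EFinM.
apply: integrableMl => //.
exists C; split; first exact: num_real.
move=> M CM x Dx /=; exact: le_trans (gC _ Dx) (ltW CM).
Qed.

Lemma eq_integrableR f g : (forall x, D x -> f x = g x) ->
  mu.-integrable D (EFin \o f) -> mu.-integrable D (EFin \o g).
Proof.
move=> fg; apply: eq_integrable => // x /set_mem Dx; by rewrite /= fg.
Qed.

Lemma integrableRD f g : mu.-integrable D (EFin \o f) ->
  mu.-integrable D (EFin \o g) -> mu.-integrable D (EFin \o (fun x => f x + g x)).
Proof. by move=> intf intg; exact: (integrableD mD intf intg). Qed.

Lemma integrableRB f g : mu.-integrable D (EFin \o f) ->
  mu.-integrable D (EFin \o g) -> mu.-integrable D (EFin \o (fun x => f x - g x)).
Proof. by move=> intf intg; exact: (integrableB mD intf intg). Qed.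

Lemma integrableRZ (k : R) f : mu.-integrable D (EFin \o f) ->
  mu.-integrable D (EFin \o (fun x => k * f x)).
Proof. by move=> intf; exact: (integrableZl mD k intf). Qed.

Lemma integrableRmeas f : mu.-integrable D (EFin \o f) -> measurable_fun D f.
Proof. by move=> /integrableP[/measurable_EFinP]. Qed.

Lemma ge0_subset_Rintegral (E : set T) f : measurable E -> E `<=` D ->
  mu.-integrable D (EFin \o f) -> (forall x, D x -> 0 <= f x) ->
  \int[mu]_(x in E) f x <= \int[mu]_(x in D) f x.
Proof.
move=> mE ED intf f0; apply: fine_le.
- by apply: integrable_fin_num => //; exact: integrableS intf.
- exact: integrable_fin_num.
- apply: ge0_subset_integral => //; first exact: measurable_int intf.
Qed.

Lemma Rintegral_dominated (f : nat -> T -> R) (g h : T -> R) :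
  (forall n, measurable_fun D (f n)) -> measurable_fun D g ->
  (forall x, D x -> f n x @[n --> \oo] --> g x) ->
  mu.-integrable D (EFin \o h) ->
  (forall n x, D x -> `|f n x| <= h x) ->
  \int[mu]_(x in D) f n x @[n --> \oo] --> \int[mu]_(x in D) g x.
Proof.
move=> mf mg fg inth fh.
have [] := @dominated_convergence _ _ _ mu D mD (fun n => EFin \o f n) (EFin \o g) (EFin \o h).
- by move=> n; exact/measurable_EFinP.
- exact/measurable_EFinP.
- by apply: aeW => x Dx; apply/fine_cvgP; split => //; [near=> n|exact: fg].
- exact: inth.
- by apply: aeW => x n Dx; rewrite lee_fin fh.
move=> intg _.
rewrite -(@fineK _ (\int[mu]_(x in D) (EFin \o g) x)%E); last exact: integrable_fin_num.
by move/fine_cvg.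
Unshelve. all: by end_near. Qed.

End ae_Rintegral.

(** * Null sets and Fubini's theorem on rectangles *)

Section Fubini_rectangle.
Context d1 d2 (T1 : measurableType d1) (T2 : measurableType d2) (R : realType).
Variable m1 : {sigma_finite_measure set T1 -> \bar R}.
Variable m2 : {sigma_finite_measure set T2 -> \bar R}.

Lemma product_measure_eq0 (M : set (T1 * T2)) : measurable M ->
  (m1 \x m2)%E M = 0%E <-> {ae m1, forall x, m2 (xsection M x) = 0%E}.
Proof.
move=> mM.
have mx := measurable_fun_xsection m2 mM.
have -> : (m1 \x m2)%E M = (\int[m1]_x `|m2 (xsection M x)|)%E.
  by apply: eq_integral => x _ /=; rewrite gee0_abs.
rewrite (ae_eq_integral_abs m1 measurableT mx); split.
  by apply: filterS => x /(_ I).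
by apply: filterS => x + _.
Qed.

Lemma ae_xsection (P : T1 * T2 -> Prop) : {ae (m1 \x m2)%E, forall p, P p} ->
  {ae m1, forall x, {ae m2, forall y, P (x, y)}}.
Proof.
move=> [M [mM /(product_measure_eq0 mM) M0 PM]].
apply: filterS M0 => x M0; exists (xsection M x); split => //.
  exact: measurable_xsection.
by move=> y /= nP; apply/xsectionP; exact: PM.
Qed.

(** Measurability of the exceptional set allows its measure to be computed by integrating the
    measures of its sections. *)
Lemma xsection_ae (P : T1 * T2 -> Prop) : measurable [set p | ~ P p] ->
  {ae m1, forall x, {ae m2, forall y, P (x, y)}} ->
  {ae (m1 \x m2)%E, forall p, P p}.
Proof.
move=> mP aP; exists [set p | ~ P p]; split => //.
apply/(product_measure_eq0 mP).
apply: filterS aP => x [N [mN N0 PN]].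
apply: (@subset_measure0 _ _ _ m2 _ N) => //.
  exact: measurable_xsection.
by move=> y /xsectionP /PN.
Qed.

Variables (A : set T1) (B : set T2).
Hypotheses (mA : measurable A) (mB : measurable B).
Let mD : measurable (A `*` B) := measurableX mA mB.
Variable f : T1 * T2 -> R.
Hypothesis intf : (m1 \x m2)%E.-integrable (A `*` B) (EFin \o f).

(** Extension by zero reduces the rectangle to the full product space, where Fubini's theorem is
    applied. *)
Let fD := ((EFin \o f) \_ (A `*` B)).

Let intfD : (m1 \x m2)%E.-integrable setT fD.
Proof. exact/(integrable_mkcond _ mD). Qed.

Let fDE x : A x -> (fun y => fD (x, y)) = (EFin \o (fun y => f (x, y))) \_ B.
Proof.
move=> Ax; apply/funext => y; rewrite /fD !patchE.
case: ifPn => [/set_mem[_ By]|nD]; case: ifPn => //.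
  by rewrite notin_setE.
by move=> /set_mem By; move: nD; rewrite notin_setE => -[].
Qed.

Let fDN x : ~ A x -> (fun y => fD (x, y)) = cst 0%E.
Proof.
move=> Ax; apply/funext => y; rewrite /fD patchE ifN// notin_setE => -[Ax' _].
exact: Ax.
Qed.

Lemma ae_integrable_section :
  {ae m1, forall x, A x -> m2.-integrable B (EFin \o (fun y => f (x, y)))}.
Proof.
have := ae_integrable1 intfD; apply: filterS => x + Ax.
by rewrite fDE// => /(integrable_mkcond _ mB).
Qed.

Let FE x : fubini_F m2 fD x =
  ((fun x => \int[m2]_(y in B) (f (x, y))%:E)%E \_ A) x.
Proof.
rewrite /fubini_F patchE; case: ifPn => [/set_mem Ax|].
  by rewrite fDE// -integral_mkcond.
by rewrite notin_setE => Ax; rewrite fDN// integral0.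
Qed.

Lemma integrable_section_Rintegral :
  m1.-integrable A (EFin \o (fun x => \int[m2]_(y in B) f (x, y))).
Proof.
have intF := integrable_fubini_F intfD.
have {}intF : m1.-integrable A (fubini_F m2 fD).
  exact: integrableS intF.
apply: le_integrable (intF) => //.
  apply: (@eq_measurable_fun _ _ _ _ _ (EFin \o (fine \o fubini_F m2 fD))).
    by move=> x Ax; rewrite /= FE patchE Ax.
  apply/measurable_EFinP; apply: measurableT_comp => //.
  exact: measurable_int intF.
(* Where the inner integral is infinite, [fine] returns 0, so the real-valued section integral is
   still dominated by the extended one. *)
move=> x Ax /=; rewrite FE patchE mem_set// /Rintegral.
by case: (integral _ _ _) => [r| |] /=; rewrite ?lexx ?leey.
Qed.

Lemma Rintegral_rectangle :
  \int[(m1 \x m2)%E]_(p in A `*` B) f p =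
  \int[m1]_(x in A) \int[m2]_(y in B) f (x, y).
Proof.
rewrite [LHS]/Rintegral integral_mkcond -(integral12_prod_meas1 intfD).
rewrite /Rintegral; congr fine.
rewrite (eq_integral _ _ (fun x _ => FE x)) -integral_mkcond.
apply: ae_eq_integral => //.
- have := integrable_fubini_F intfD.
  move=> /(integrableS measurableT mA (@subsetT _ A)) intF.
  apply: (@eq_measurable_fun _ _ _ _ _ (fubini_F m2 fD)).
    by move=> x Ax; rewrite FE patchE Ax.
  exact: measurable_int intF.
- exact: (measurable_int m1 integrable_section_Rintegral).
- have := ae_integrable_section; apply: filterS => x /[apply] intx.
  by rewrite fineK//; exact: integrable_fin_num intx.
Qed.

Let GE y : fubini_G m1 fD y =
  ((fun y => \int[m1]_(x in A) (f (x, y))%:E)%E \_ B) y.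
Proof.
rewrite /fubini_G patchE; case: ifPn => [/set_mem By|].
  rewrite [RHS]integral_mkcond; apply: eq_integral => x _; rewrite /fD !patchE.
  case: ifPn => [/set_mem[Ax _]|nD]; case: ifPn => //.
    by rewrite notin_setE.
  by move=> /set_mem Ax; move: nD; rewrite notin_setE => -[].
rewrite notin_setE => By; rewrite integral0_eq// => x _.
by rewrite /fD patchE ifN// notin_setE => -[_ By']; exact: By.
Qed.

Lemma Rintegral_rectangle_swap :
  \int[(m1 \x m2)%E]_(p in A `*` B) f p =
  \int[m2]_(y in B) \int[m1]_(x in A) f (x, y).
Proof.
rewrite [LHS]/Rintegral integral_mkcond -(integral21_prod_meas1 intfD).
have intG : m2.-integrable B (fubini_G m1 fD).
  have : m2.-integrable setT (fubini_G m1 fD).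
    apply/integrableP; split; first exact: measurable_fubini_G intfD.
    have /integrableP[mfD _] := intfD.
    apply: le_lt_trans (proj1 (integrable21ltyP m1 m2 mfD) intfD).
    apply: ge0_le_integral => //.
    - by apply: measurableT_comp => //; exact: measurable_fubini_G intfD.
    - by apply: (measurable_fun_fubini_tonelli_G (abse \o fD)) => //=;
        exact: measurableT_comp.
    - by move=> y _; apply: le_abse_integral => //; exact: measurableT_comp.
  exact: integrableS.
have finG : {ae m2, forall y, B y -> \int[m1]_(x in A) (f (x, y))%:E \is a fin_num}%E.
  have := integrable_ae mB intG; apply: filterS => y /[swap] By /(_ By).
  by rewrite GE patchE mem_set.
rewrite (eq_integral _ _ (fun x _ => GE x)) -integral_mkcond.
rewrite /Rintegral; congr fine.
have mG : measurable_fun B (fun y => \int[m1]_(x in A) (f (x, y))%:E)%E.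
  apply: (@eq_measurable_fun _ _ _ _ _ (fubini_G m1 fD)).
    by move=> y By; rewrite GE patchE By.
  exact: measurable_int intG.
apply: ae_eq_integral => //.
- by apply/measurable_EFinP; apply: measurableT_comp.
- by apply: filterS finG => y /[apply] fG; rewrite fineK.
Qed.

End Fubini_rectangle.

Lemma integrable_prodM d1 d2 (T1 : measurableType d1) (T2 : measurableType d2)
    (R : realType) (m1 : {sigma_finite_measure set T1 -> \bar R})
    (m2 : {sigma_finite_measure set T2 -> \bar R}) (A : set T1) (B : set T2)
    (h : T1 -> R) (k : T2 -> R) : measurable A -> measurable B ->
  m1.-integrable A (EFin \o h) -> m2.-integrable B (EFin \o k) ->
  (m1 \x m2)%E.-integrable (A `*` B) (EFin \o (fun p => h p.1 * k p.2)).
Proof.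
move=> mA mB inth intk.
have mhA : measurable_fun setT (h \_ A).
  by apply/(measurable_restrictT _ mA); exact: integrableRmeas inth.
have mkB : measurable_fun setT (k \_ B).
  by apply/(measurable_restrictT _ mB); exact: integrableRmeas intk.
pose g p := (h \_ A) p.1 * (k \_ B) p.2.
have mg : measurable_fun setT g.
  by apply: measurable_funM; apply: measurableT_comp.
have intg : (m1 \x m2)%E.-integrable setT (EFin \o g).
  apply/integrable12ltyP; first exact/measurable_EFinP.
  rewrite (_ : integral _ _ _ =
     (\int[m1]_x ((`|(h \_ A) x|)%:E * \int[m2]_y (`|(k \_ B) y|)%:E))%E); last first.
    apply: eq_integral => x _; rewrite -ge0_integralZl//.
    - by apply: eq_integral => y _; rewrite /g /= normrM EFinM.
    - by apply/measurable_EFinP; apply: measurableT_comp.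
  rewrite ge0_integralZr//; last 2 first.
  - by apply/measurable_EFinP; apply: measurableT_comp.
  - exact: integral_ge0.
  apply: lte_mul_pinfty; first exact: integral_ge0.
  - rewrite ge0_fin_numE; last exact: integral_ge0.
    move/(integrable_mkcond _ mA)/integrableP : inth => [_].
    by rewrite restrict_EFin.
  - move/(integrable_mkcond _ mB)/integrableP : intk => [_].
    by rewrite restrict_EFin.
apply: (@eq_integrableR _ _ _ _ _ (measurableX mA mB) g) => [[x y] [/= Ax By]|].
  by rewrite /g !patchE !mem_set.
by apply: integrableS intg => //; exact: measurableX.
Qed.

(** * Primitives of integrable functions *)

Section primitive.
Variable R : realType.
Local Notation mu := (@lebesgue_measure R).
Implicit Types (F G f g : R -> R).

(** Absolute continuity on [a, b] in integrated form: F is prescribed at every point of the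
    interval, and no pointwise derivative is asserted. *)
Definition primitive (a b : R) F f :=
  mu.-integrable `[a, b] (EFin \o f) /\
  forall t, a <= t <= b -> F t = F a + \int[mu]_(s in `[a, t]) f s.

Variables a b : R.
Hypothesis ab : a < b.

Lemma integrable_sub_itv f (c d : R) : a <= c -> d <= b ->
  mu.-integrable `[a, b] (EFin \o f) -> mu.-integrable `[c, d] (EFin \o f).
Proof.
move=> ac db; apply: integrableS => //.
by apply: subset_itvScc; rewrite bnd_simp.
Qed.

Lemma primitive_integrable F f : primitive a b F f ->
  mu.-integrable `[a, b] (EFin \o f).
Proof. by case. Qed.

Lemma primitive_total F f : primitive a b F f ->
  \int[mu]_(s in `[a, b]) f s = F b - F a.
Proof. by case=> _ ->; rewrite ?lexx ?ltW//; ring. Qed.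

Lemma primitive_sub F f : primitive a b F f -> forall s t, a <= s -> s <= t -> t <= b ->
  F t - F s = \int[mu]_(x in `[s, t]) f x.
Proof.
move=> [intf Ff] s t as_ st tb.
rewrite Ff ?(le_trans as_ st)// (Ff s) ?as_ ?(le_trans st tb)//.
rewrite opprD addrACA subrr add0r.
rewrite Rintegral_itvB ?bnd_simp//; last first.
  exact: integrable_sub_itv intf.
rewrite Rintegral_itv_obnd_cbnd//.
apply: integrableS intf => //; apply: subset_itvScc; rewrite bnd_simp//.
Qed.

Lemma primitive_continuous F f : primitive a b F f ->
  {within `[a, b], continuous F}.
Proof.
move=> [intf Ff].
have := parameterized_integral_continuous (ltW ab) intf.
move=> ctf; apply: (@subspace_eq_continuous _ _ _
  (fun t => F a + parameterized_integral mu a t f)).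
  by move=> t /set_mem /=; rewrite in_itv /= => /Ff/esym.
by move=> t; apply: cvgD; [exact: cvg_cst|exact: ctf].
Qed.

Lemma primitive_measurable F f : primitive a b F f -> measurable_fun `[a, b] F.
Proof.
move=> /primitive_continuous Fc.
exact: subspace_continuous_measurable_fun.
Qed.

Lemma primitive_bounded F f : primitive a b F f ->
  exists C, forall t, `[a, b]%classic t -> `|F t| <= C.
Proof.
move=> [intf Ff]; exists (`|F a| + \int[mu]_(s in `[a, b]) `|f s|) => t /=.
rewrite in_itv/= => /andP[at_ tb]; rewrite Ff ?at_//.
apply: le_trans (ler_normD _ _) _; rewrite lerD2l.
apply: le_trans (le_normr_Rintegral _ _) _ => //.
  exact: integrable_sub_itv intf.
apply: ge0_subset_Rintegral => //.
  by apply: subset_itvScc; rewrite bnd_simp.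
exact: integrable_norm intf.
Qed.

Lemma eq_primitive F G f g : (forall t, a <= t <= b -> F t = G t) ->
  (forall t, a <= t <= b -> f t = g t) ->
  primitive a b F f -> primitive a b G g.
Proof.
move=> FG fg [intf Ff]; split.
  by apply: eq_integrableR intf => // t /=; rewrite in_itv; exact: fg.
move=> t atb; rewrite -(FG _ atb) -FG; last by rewrite lexx ltW.
rewrite Ff//; congr (_ + _).
apply: eq_Rintegral => s /set_mem /=; rewrite in_itv/= => /andP[as_ st].
by rewrite fg// as_ (le_trans st)//; case/andP: atb.
Qed.

Lemma primitiveD F G f g : primitive a b F f -> primitive a b G g ->
  primitive a b (fun t => F t + G t) (fun t => f t + g t).
Proof.
move=> [intf Ff] [intg Gg]; split; first exact: integrableRD.
move=> t /andP[at_ tb]; rewrite RintegralD//; last 2 first.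
- exact: integrable_sub_itv intf.
- exact: integrable_sub_itv intg.
by rewrite (Ff t) ?at_// (Gg t) ?at_//; ring.
Qed.

Lemma primitiveZ (k : R) F f : primitive a b F f ->
  primitive a b (fun t => k * F t) (fun t => k * f t).
Proof.
move=> [intf Ff]; split; first exact: integrableRZ.
move=> t /andP[at_ tb]; rewrite RintegralZl//; last exact: integrable_sub_itv intf.
by rewrite (Ff t) ?at_//; ring.
Qed.

Lemma primitive_cst (k : R) : primitive a b (fun=> k) (fun=> 0).
Proof.
split.
  rewrite (_ : _ \o _ = cst 0%E)//; exact: integrable0.
by move=> t _; rewrite Rintegral_cst// mul0r addr0.
Qed.

Lemma primitive_integral f : mu.-integrable `[a, b] (EFin \o f) ->
  primitive a b (fun t => \int[mu]_(s in `[a, t]) f s) f.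
Proof. by move=> intf; split => // t _; rewrite set_itv1 Rintegral_set1 add0r. Qed.

Lemma primitive_derive F f : (forall t : R, is_derive t 1 F (f t)) -> continuous f ->
  primitive a b F f.
Proof.
move=> Ff cf; split.
  apply: continuous_compact_integrable; first exact: segment_compact.
  by apply: continuous_subspaceT.
have cF : continuous F.
  move=> t; apply: differentiable_continuous; apply/derivable1_diffP.
  exact: ex_derive.
move=> t /andP[]; rewrite le_eqVlt => /predU1P[<- _|at_ tb].
  by rewrite set_itv1 Rintegral_set1 addr0.
rewrite /Rintegral (@continuous_FTC2 _ f F a t at_).
- by rewrite /=; ring.
- exact: continuous_subspaceT.
- split; [by move=> x _; exact: ex_derive|apply: cvg_at_right_filter|
          apply: cvg_at_left_filter]; exact: cF.
- by move=> x _; rewrite derive1E; exact: derive_val.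
Qed.

(** Integration by parts through Fubini: the square [a, t]^2 is split along its diagonal, and f(x)
    g(y) is integrated over each triangle in the order that makes the inner integral a primitive. *)
Let Rintegral_triangle f g t : a <= t <= b ->
  mu.-integrable `[a, b] (EFin \o f) -> mu.-integrable `[a, b] (EFin \o g) ->
  let I h s := \int[mu]_(x in `[a, s]) h x in
  \int[mu]_(s in `[a, t]) (f s * I g s) + \int[mu]_(s in `[a, t]) (I f s * g s) =
  I f t * I g t.
Proof.
move=> /andP[at_ tb] + + I.
move=> /(integrable_sub_itv (lexx a) tb) intf /(integrable_sub_itv (lexx a) tb) intg.
have mA : measurable (`[a, t]%classic : set (measurableTypeR R)) by [].
have intfg := integrable_prodM mA mA intf intg.
pose up := [set p : measurableTypeR R * measurableTypeR R | p.1 < p.2].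
have mup : measurable up.
  rewrite -[up]setTI; apply: (@measurable_lte _ _ R _ measurableT (fun p => p.1%:E) (fun p => p.2%:E)).
  by apply/measurable_EFinP; exact: measurable_fst.
  by apply/measurable_EFinP; exact: measurable_snd.
pose k1 (p : R * R) : R := \1_(~` up) p.
pose k2 (p : R * R) : R := \1_up p.
have mk1 : measurable_fun [set: measurableTypeR R * measurableTypeR R] k1.
  by apply: measurable_indic; exact: measurableC.
have mk2 : measurable_fun [set: measurableTypeR R * measurableTypeR R] k2.
  exact: measurable_indic.
have upE x y : ((x, y) \in up) = (x < y).
  by apply/idP/idP => [/set_mem|xy]; last exact/mem_set.
have ind1 (S : set (R * R)) p : `|\1_S p : R| <= 1.
  by rewrite indicE; case: (_ \in _); rewrite ?normr1 ?normr0.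
have int1 := integrable_boundedM (measurableX mA mA) intfg
  (measurable_funTS mk1) (fun x _ => ind1 _ x).
have int2 := integrable_boundedM (measurableX mA mA) intfg
  (measurable_funTS mk2) (fun x _ => ind1 _ x).
transitivity (\int[(mu \x mu)%E]_(p in `[a, t] `*` `[a, t]) (f p.1 * g p.2)); last first.
  rewrite (Rintegral_rectangle mA mA intfg)/=.
  rewrite -(RintegralZr (I g t) mA intf); apply: eq_Rintegral => x _.
  by rewrite (RintegralZl (f x) mA intg).
transitivity (\int[(mu \x mu)%E]_(p in `[a, t] `*` `[a, t]) (f p.1 * g p.2 * k1 p + f p.1 * g p.2 * k2 p)); last first.
  apply: eq_Rintegral => p _; rewrite -mulrDr /k1 /k2 !indicE in_setC.
  by case: (_ \in _); rewrite ?addr0 ?add0r mulr1.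
rewrite (RintegralD (measurableX mA mA) int1 int2).
congr (_ + _).
  rewrite (Rintegral_rectangle mA mA int1)/=.
  apply: eq_Rintegral => s /set_mem/=; rewrite in_itv/= => /andP[as_ st].
  rewrite -RintegralZl//; last by apply: integrableS intg => //; apply: subset_itvl; rewrite bnd_simp.
  rewrite Rintegral_mkcond [RHS]Rintegral_mkcond; apply: eq_Rintegral => x _.
  rewrite !patchE /k1 indicE in_setC upE !mem_setE !in_itv/=.
  case: (leP a x) => //= ax; case: (leP x s) => xs /=.
    by rewrite (le_trans xs st) mulr1.
  by case: ifP => //; rewrite mulr0.
rewrite (Rintegral_rectangle_swap mA mA int2)/=.
apply: eq_Rintegral => s /set_mem/=; rewrite in_itv/= => /andP[as_ st].
have intfs : mu.-integrable `[a, s] (EFin \o f).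
  by apply: integrableS intf => //; apply: subset_itvl; rewrite bnd_simp.
rewrite -RintegralZr//.
(* The strict triangle has the half-open sections [a, s[; the missing endpoint does not change the
   integral. *)
have intfgs : mu.-integrable `[a, s[ (EFin \o (fun x => f x * g s)).
  rewrite (_ : (fun x => _) = (fun x => g s * f x)); last by apply/funext => x; rewrite mulrC.
  apply: integrableRZ => //; apply: integrableS intfs => //.
  by apply: subset_itvl; rewrite bnd_simp.
rewrite -Rintegral_itv_bndo_bndc//.
rewrite Rintegral_mkcond [RHS]Rintegral_mkcond; apply: eq_Rintegral => x _.
rewrite !patchE /k2 indicE upE !mem_setE !in_itv/=.
case: (leP a x) => //= ax; case: (ltP x s) => xs.
  by rewrite (le_trans (ltW xs) st) mulr1.
by case: ifP => //; rewrite mulr0.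
Qed.

(** Expanding F and G around their values at a leaves only the product of the two vanishing
    primitives, which is the triangle identity. Iterated, this gives an explicit density to every
    polynomial in primitives, as the null Lagrangians require. *)
Lemma primitiveM F G f g : primitive a b F f -> primitive a b G g ->
  primitive a b (fun t => F t * G t) (fun t => f t * G t + F t * g t).
Proof.
move=> pF pG; have [intf Ff] := pF; have [intg Gg] := pG.
have [CF bF] := primitive_bounded pF; have [CG bG] := primitive_bounded pG.
have intfG : mu.-integrable `[a, b] (EFin \o (fun t => f t * G t)).
  exact: (integrable_boundedM _ intf (primitive_measurable pG) bG).
have intFg : mu.-integrable `[a, b] (EFin \o (fun t => F t * g t)).
  rewrite (_ : (fun t => _) = (fun t => g t * F t)); last by apply/funext => x; rewrite mulrC.
  exact: (integrable_boundedM _ intg (primitive_measurable pF) bF).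
split; first exact: integrableRD.
move=> t atb; have /andP[at_ tb] := atb.
have [intf' intg'] : mu.-integrable `[a, t] (EFin \o f) /\ mu.-integrable `[a, t] (EFin \o g).
  by split; [exact: integrable_sub_itv intf|exact: integrable_sub_itv intg].
have tr := Rintegral_triangle atb intf intg.
have pI := primitive_integral intf; have pJ := primitive_integral intg.
have [CI bI] := primitive_bounded pI; have [CJ bJ] := primitive_bounded pJ.
have intfJ := integrable_boundedM _ intf (primitive_measurable pJ) bJ.
have intgI := integrable_boundedM _ intg (primitive_measurable pI) bI.
move: intfJ intgI => /(_ (measurable_itv _)) intfJ /(_ (measurable_itv _)) intgI.
have {}intfJ := integrable_sub_itv (lexx a) tb intfJ.
have {}intgI := integrable_sub_itv (lexx a) tb intgI.
rewrite RintegralD//; last 2 first.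
- exact: integrable_sub_itv intfG.
- exact: integrable_sub_itv intFg.
have -> : \int[mu]_(s in `[a, t]) (f s * G s) =
  \int[mu]_(s in `[a, t]) (f s * \int[mu]_(x in `[a, s]) g x) + G a * \int[mu]_(s in `[a, t]) f s.
  rewrite -RintegralZl// -RintegralD//; last exact: integrableRZ.
  apply: eq_Rintegral => s /set_mem/=; rewrite in_itv/= => /andP[as_ st].
  by rewrite (Gg s) ?as_ ?(le_trans st)//; ring.
have -> : \int[mu]_(s in `[a, t]) (F s * g s) =
  \int[mu]_(s in `[a, t]) ((\int[mu]_(x in `[a, s]) f x) * g s) + F a * \int[mu]_(s in `[a, t]) g s.
  rewrite -RintegralZl// -RintegralD//; last 2 first.
  - by apply: eq_integrableR intgI => // x _; rewrite mulrC.
  - exact: integrableRZ.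
  apply: eq_Rintegral => s /set_mem/=; rewrite in_itv/= => /andP[as_ st].
  by rewrite (Ff s) ?as_ ?(le_trans st)//; ring.
rewrite (Ff t atb) (Gg t atb).
move: tr => /= tr.
rewrite mulrDl !mulrDr -tr; ring.
Qed.

(** For every s, F t is at most F s plus the total variation bound; averaging over s gives a
    one-dimensional embedding of W^{1,1} into bounded functions. *)
Lemma primitive_le_mean F f t : primitive a b F f -> a <= t <= b ->
  (b - a) * F t <= \int[mu]_(s in `[a, b]) F s + (b - a) * \int[mu]_(s in `[a, b]) `|f s|.
Proof.
move=> pF atb; have [intf Ff] := pF.
have [CF bF] := primitive_bounded pF.
have intn := integrable_norm intf.
have intF : mu.-integrable `[a, b] (EFin \o F).
  apply: measurable_bounded_integrable => //.
  - by rewrite /= lebesgue_measure_itv/= lte_fin ab -EFinB ltry.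
  - exact: primitive_measurable pF.
  - exists CF; split; first exact: num_real.
    by move=> M CM x Dx /=; exact: le_trans (bF _ Dx) (ltW CM).
have intc (c : R) : mu.-integrable `[a, b] (EFin \o (fun=> c)).
  apply: continuous_compact_integrable; first exact: segment_compact.
  by apply: continuous_subspaceT => x; exact: cst_continuous.
have cstE (c : R) : \int[mu]_(s in `[a, b]) c = (b - a) * c.
  rewrite Rintegral_cst// [X in fine X]lebesgue_measure_itv/= lte_fin ab -EFinB/=.
  by rewrite mulrC.
rewrite -!cstE -RintegralD//; apply: le_Rintegral => //; first exact: integrableRD.
move=> s /=; rewrite in_itv/= => /andP[as_ sb]; have /andP[at_ tb] := atb.
have key x y : a <= x -> x <= y -> y <= b ->
    `|F y - F x| <= \int[mu]_(r in `[a, b]) `|f r|.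
  move=> ax xy yb; rewrite (primitive_sub pF ax xy yb).
  apply: le_trans (le_normr_Rintegral _ _) _ => //.
    exact: integrable_sub_itv intf.
  apply: ge0_subset_Rintegral => //.
  by apply: subset_itvScc; rewrite bnd_simp.
rewrite -lerBlDl; apply: le_trans (ler_norm _) _.
have [st|/ltW ts] := leP s t; first exact: key.
by rewrite distrC; exact: key.
Qed.

End primitive.

(** * The fundamental lemma of the calculus of variations *)

Section real_calculus.
Variable R : realType.
Local Notation mu := (@lebesgue_measure R).
Implicit Types f : R -> R.

Lemma is_derive_continuous f (df : R -> R) :
  (forall x : R, is_derive x 1 f (df x)) -> continuous f.
Proof.
move=> fdf x; apply: differentiable_continuous; apply/derivable1_diffP.
exact: ex_derive.
Qed.

Lemma continuous_integrable_itv f (a b : R) : continuous f ->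
  mu.-integrable `[a, b] (EFin \o f).
Proof.
move=> cf; apply: continuous_compact_integrable; first exact: segment_compact.
exact: continuous_subspaceT.
Qed.

Lemma continuous_cst1 : continuous (fun _ : R => 1 : R).
Proof. by move=> x; exact: cvg_cst. Qed.

Lemma continuous_bounded_itv (f : R -> R) (a b : R) : continuous f ->
  exists C : R, forall x, `[a, b]%classic x -> `|f x| <= C.
Proof.
move=> cf; have cK : compact (f @` `[a, b]).
  apply: continuous_compact; last exact: segment_compact.
  exact: continuous_subspaceT.
have [M [_ HM]] := compact_bounded cK.
by exists (M + 1) => x abx; apply: (HM (M + 1)); [rewrite ltrDl|exists x].
Qed.

Lemma integrable_mul_continuous (a b : R) (f k : R -> R) : mu.-integrable `[a, b] (EFin \o f) ->
  continuous k -> mu.-integrable `[a, b] (EFin \o (fun x => f x * k x)).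
Proof.
move=> intf ck; have [C kC] := @continuous_bounded_itv k a b ck.
apply: (integrable_boundedM _ intf) kC => //.
by apply: measurable_funTS; exact: continuous_measurable_fun.
Qed.

Lemma continuous_antiderivative f : continuous f ->
  exists F : R -> R, forall x : R, is_derive x 1 F (f x).
Proof.
move=> cf.
pose I (a b : R) := \int[mu]_(x in `[a, b]) f x.
have IB (a b c : R) : a <= b -> b <= c -> I a c - I a b = I b c.
  move=> ab bc; rewrite /I Rintegral_itvB ?bnd_simp//; last exact: continuous_integrable_itv.
  rewrite Rintegral_itv_obnd_cbnd//.
  apply: integrableS (@continuous_integrable_itv f b c cf) => //.
  by apply: subset_itvr; rewrite bnd_simp.
(* For x < 0 the interval [0, x] is empty, so the orientation sign has to be supplied by hand. *)
exists (fun x => if 0 <= x then I 0 x else - I x 0) => x.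
(* A base point below both 0 and x: near x the candidate is [I N] minus the constant [I N 0], so the
   two cases need no separate differentiation. *)
pose N : R := - (`|x| + 1).
have N0 : N < 0 by rewrite oppr_lt0; apply: ltr_wpDl.
have Nx : N < x.
  by rewrite /N; have := ler_norm (- x); rewrite normrN; lra.
have [dI IE] := @continuous_FTC1_closed R f N x (x + 1)
  (ltac:(by rewrite ltrDl)) (continuous_integrable_itv _ _ cf) Nx (cf x).
have : is_derive x 1 (fun y => I N y - I N 0) (f x).
  have : is_derive x 1 (I N) (f x).
    by split; [exact: dI|rewrite -IE derive1E].
  move=> dIN; apply: is_derive_eq; rewrite /= subr0//.
move=> H; apply: near_eq_is_derive H.
near=> y.
have Ny : N < y by near: y; exact: lt_nbhsr.
case: (leP 0 y) => y0; first by rewrite IB// ltW.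
by rewrite -(IB N y 0) ?ltW// opprB.
Unshelve. all: by end_near. Qed.

Lemma continuous_pos_part : continuous (fun x : R => Num.max x 0).
Proof.
rewrite (_ : (fun x => _) = (fun x : R => (x + `|x|) / 2)); last first.
  by apply/funext => x; rewrite maxr_absE subr0 addr0.
move=> x; apply: cvgM; last exact: cvg_cst.
by apply: cvgD; [exact: cvg_id|exact: norm_continuous].
Qed.

(** The square of the positive part: a C^1 function that vanishes exactly on the nonpositive
    half-line. *)
Definition sqr_pos (x : R) : R := x * Num.max x 0.

Lemma is_derive_sqr_pos (x : R) : is_derive x 1 sqr_pos (2 * Num.max x 0).
Proof.
have [x0|x0|->] := ltgtP x 0.
- have : is_derive x 1 (cst 0 : R -> R) (2 * 0).
    by apply: is_derive_eq; rewrite mulr0.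
  move=> H; apply: near_eq_is_derive H; near=> y.
  rewrite /sqr_pos max_r ?mulr0//; apply/ltW; near: y; exact: lt_nbhsl.
- have : is_derive x 1 (fun y => y * y : R) (2 * x).
    apply: is_derive_eq.
    by rewrite /GRing.scale/=; ring.
  move=> H; apply: near_eq_is_derive H; near=> y.
  rewrite /sqr_pos max_l//; apply/ltW; near: y; exact: lt_nbhsr.
have cv : h^-1 *: ((sqr_pos \o shift 0) (h *: (1 : R)) - sqr_pos 0) @[h --> (0 : R)^'] --> (0 : R).
  have mx : Num.max h 0 @[h --> (0 : R)^'] --> (0 : R).
    rewrite -[X in _ --> X](maxxx (0 : R)).
    exact: cvg_within_filter (@continuous_pos_part 0).
  apply: cvg_trans mx; apply: near_eq_cvg.
  near=> h.
  have h0 : h != 0 by near: h; exact: nbhs_dnbhs_neq.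
  rewrite /sqr_pos /= /GRing.scale /= mulr1 addr0 mul0r subr0 mulrA mulVf// mul1r.
  by [].
rewrite mulr0; apply: DeriveDef.
  by apply/cvg_ex; exists 0; exact: cv.
by apply/cvg_lim => //; exact: cv.
Unshelve. all: by end_near. Qed.

Lemma sqr_pos_ge0 x : 0 <= sqr_pos x.
Proof.
by rewrite /sqr_pos; case: (leP x 0) => x0; rewrite ?mulr0// mulr_ge0 ?ltW.
Qed.

(* A C^1 approximation, as n grows, of the indicator function of ]0, +oo[. *)
Definition step (n : nat) (x : R) : R := 1 - (1 + n.+1%:R * sqr_pos x)^-1.

Lemma step_denom n x : 0 < 1 + n.+1%:R * sqr_pos x.
Proof. by rewrite ltr_pwDl// mulr_ge0// sqr_pos_ge0. Qed.

Lemma step_itv n x : 0 <= step n x <= 1.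
Proof.
rewrite /step subr_ge0 gerBl invr_ge0 (ltW (step_denom _ _)) andbT.
by rewrite invf_le1 ?step_denom// lerDl mulr_ge0// sqr_pos_ge0.
Qed.

Lemma step_npos n x : x <= 0 -> step n x = 0.
Proof. by move=> x0; rewrite /step /sqr_pos max_r// !mulr0 addr0 invr1 subrr. Qed.

Definition dstep (n : nat) (x : R) : R :=
  (1 + n.+1%:R * sqr_pos x) ^- 2 * (n.+1%:R * (2 * Num.max x 0)).

Lemma is_derive_step n (x : R) : is_derive x 1 (step n) (dstep n x).
Proof.
rewrite /step.
have ds := is_derive_sqr_pos x.
have dd : is_derive x 1 (fun x => 1 + n.+1%:R * sqr_pos x) (n.+1%:R * (2 * Num.max x 0)).
  by apply: is_derive_eq; rewrite add0r mul1r.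
have dV := @is_deriveV R (fun x => 1 + n.+1%:R * sqr_pos x) x _ 1 (lt0r_neq0 (step_denom n x)) dd.
apply: is_derive_eq; rewrite add0r mul1r /dstep /GRing.scale/=.
by rewrite mulNr opprK.
Qed.

Lemma continuous_sqr_pos : continuous sqr_pos.
Proof. exact: is_derive_continuous is_derive_sqr_pos. Qed.

Lemma continuous_dstep n : continuous (dstep n).
Proof.
move=> x; apply: cvgM.
  apply: cvgV; first by rewrite expf_neq0// lt0r_neq0// step_denom.
  apply: (@cvg_comp _ _ _ _ (fun y => y ^+ 2) _ (nbhs (1 + n.+1%:R * sqr_pos x))).
    apply: cvgD; first exact: cvg_cst.
    by apply: cvgM; [exact: cvg_cst|exact: continuous_sqr_pos].
  exact: exprn_continuous.
apply: cvgM; first exact: cvg_cst.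
apply: cvgM; first exact: cvg_cst.
exact: continuous_pos_part.
Qed.

(** The argument may vary with n because [segment_step] has a shift by 1/(n+1). Once x n > l/2, the
    distance to 1 is at most a constant over n + 1. *)
Lemma cvg_step (x : nat -> R) (l : R) : x n @[n --> \oo] --> l -> 0 < l ->
  step n (x n) @[n --> \oo] --> (1 : R).
Proof.
move=> xl l0; rewrite /step -[X in _ --> X]subr0.
apply: cvgB; first exact: cvg_cst.
apply: (@squeeze_cvgr _ _ _ _ (fun=> 0) (fun n => (n.+1%:R * (l / 2) ^+ 2)^-1)).
- near=> n.
  have n0 : 0 < (n.+1%:R : R) by rewrite ltr0n.
  have xn : l / 2 < x n.
    near: n; apply: (cvgr_gt l) => //; lra.
  have l20 : 0 < l / 2 by lra.
  rewrite invr_ge0 ltW ?step_denom//=.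
  rewrite lef_pV2 ?posrE ?step_denom ?mulr_gt0 ?exprn_gt0//.
  rewrite ler_wpDl// ler_wpM2l ?ltW// /sqr_pos max_l; last by lra.
  by rewrite expr2 ltr_pM ?ltW.
- exact: cvg_cst.
rewrite (_ : (fun n => _) = (fun n => n.+1%:R^-1 * ((l / 2) ^+ 2)^-1)); last first.
  by apply/funext => n; rewrite invfM.
rewrite -[X in _ --> X](mul0r ((l / 2) ^+ 2)^-1).
by apply: cvgM; [exact: cvg_harmonic|exact: cvg_cst].
Unshelve. all: by end_near. Qed.

End real_calculus.

(** * The du Bois-Reymond lemma on an interval *)

Section du_bois_reymond.
Variable R : realType.
Local Notation mu := (@lebesgue_measure R).
Variables a b : R.
Hypothesis ab : a < b.
(** S collects the admissible endpoints of approximate indicator functions. Only its density is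
    assumed, so rational endpoints are enough and the test family can be countable. *)
Variable S : set R.
Hypothesis Sab : forall q, S q -> a < q < b.
Hypothesis Sdense : forall x y, a <= x -> x < y -> y <= b -> exists2 q, S q & x < q < y.
Implicit Types f g h : R -> R.

(** The primitive of h is continuous and vanishes on a dense set, hence inside the interval;
    Lebesgue's differentiation theorem recovers h. *)
Lemma primitive_eq0_ae h : mu.-integrable `[a, b] (EFin \o h) ->
  (forall q, S q -> \int[mu]_(x in `[a, q]) h x = 0) ->
  {ae mu, forall x, `[a, b]%classic x -> h x = 0}.
Proof.
move=> inth hS.
pose H t := \int[mu]_(x in `[a, t]) h x.
have H0 t : a < t < b -> H t = 0.
  move=> /andP[at_ tb]; apply/eqP; apply: contraT => Ht.
  have cH := parameterized_integral_continuous (ltW ab) inth.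
  have cHt : H y @[y --> t] --> H t.
    by apply: (within_continuous_continuous ab cH); rewrite in_itv/= at_.
  have Ht0 : 0 < `|H t| by rewrite normr_gt0.
  have /cvgrPdist_lt/(_ _ Ht0)[e /= e0 He] := cHt.
  have [|||q Sq /andP[tq qe]] := @Sdense t (Num.min b (t + e)).
  - exact: ltW.
  - by rewrite lt_min tb ltrDl.
  - by rewrite ge_min lexx.
  have bq : `|t - q| < e.
    move: qe; rewrite lt_min => /andP[_ qe].
    by rewrite ltr0_norm ?subr_lt0// opprB ltrBlDl.
  by have := He q bq; rewrite /H (hS q Sq) subr0 ltxx.
pose k := h \_ `[a, b].
have mab : measurable (`[a, b]%classic : set (measurableTypeR R)) by [].
have intk : mu.-integrable setT (EFin \o k).
  rewrite -restrict_EFin.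
  exact: (proj1 (integrable_mkcond _ mab) inth).
have := @FTC1 R k (BLeft a) (fun y => integrableS measurableT
  (measurable_itv _ : measurable (_ : set (measurableTypeR R)))
   (@subsetT _ _) intk) (integrable_locally mab inth).
move=> /= aek.
have aeab (c : R) : {ae mu, forall x, x != c}.
  exists [set c]; split => //.
    exact: lebesgue_measure_set1.
  by move=> x /= /negP; rewrite negbK => /eqP.
have aeF := ae_filter_ringOfSetsType mu.
move: (aeab a) (aeab b); apply: filterS3 aek => x + xa xb xab.
move: xab; rewrite /= in_itv/= !le_eqVlt eq_sym (negbTE xa) (negbTE xb)/= => /andP[ax xb'].
move=> /(_ ax)[_].
rewrite /k patchE mem_set/=; last by rewrite in_itv/= !ltW.
move=> <-; rewrite derive1E.
have : is_derive x 1 (cst 0 : R -> R) 0 by exact: is_derive_cst.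
move=> Hd; apply: derive_val; apply: near_eq_is_derive Hd.
near=> y.
have ay : a < y by near: y; exact: lt_nbhsr.
have yb : y < b by near: y; exact: lt_nbhsl.
rewrite /cst -(H0 y) ?ay//; apply: eq_Rintegral => z /set_mem/=.
rewrite in_itv/= => /andP[az zy]; rewrite patchE mem_set//= in_itv/= az.
by rewrite (le_trans zy (ltW yb)).
Unshelve. all: by end_near. Qed.

Variable chi : R -> nat -> R -> R.
Hypothesis chi_continuous : forall q n, S q -> continuous (chi q n).
Hypothesis chi_le1 : forall q n x, 0 <= chi q n x <= 1.
Hypothesis chi_cvg : forall q x, S q -> a <= x <= b ->
  chi q n x @[n --> \oo] --> (\1_(`]a, q[%classic : set R) x : R).

Let norm_chi q n x : `|chi q n x| <= 1.
Proof. by have /andP[? ?] := chi_le1 q n x; rewrite ger0_norm. Qed.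

Let chi_meas q n (A : set (measurableTypeR R)) : S q -> measurable_fun A (chi q n).
Proof.
by move=> Sq; apply: measurable_funTS; apply: continuous_measurable_fun; exact: chi_continuous.
Qed.

Lemma cvg_Rintegral_chi h q : S q -> mu.-integrable `[a, b] (EFin \o h) ->
  \int[mu]_(x in `[a, b]) (h x * chi q n x) @[n --> \oo] -->
  \int[mu]_(x in `[a, q]) h x.
Proof.
move=> Sq inth; have /andP[aq qb] := Sab Sq.
have mh := integrableRmeas inth.
have intq : mu.-integrable `[a, q] (EFin \o h).
  by apply: integrable_sub_itv inth => //; exact: ltW.
have -> : \int[mu]_(x in `[a, q]) h x =
    \int[mu]_(x in `[a, b]) (h x * \1_(`]a, q[%classic : set R) x).
  transitivity (\int[mu]_(x in `]a, q[) h x).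
    rewrite -Rintegral_itv_obnd_cbnd//; last first.
      by apply: integrableS intq => //; apply: subset_itvr; rewrite bnd_simp.
    rewrite -Rintegral_itv_bndo_bndc//.
    by apply: integrableS intq => //; apply: subset_itv; rewrite bnd_simp.
  rewrite Rintegral_mkcond [RHS]Rintegral_mkcond; apply: eq_Rintegral => x _.
  rewrite !patchE indicE !mem_setE !in_itv/=.
  case: (ltP a x) => /= ax; last by case: ifP => //; rewrite mulr0.
  rewrite (ltW ax)/=.
  case: (ltP x q) => xq; last by case: ifP => //; rewrite mulr0.
  by rewrite (ltW (lt_trans xq qb)) mulr1.
apply: (@Rintegral_dominated _ _ _ mu `[a, b] _ (fun n x => h x * chi q n x)
  (fun x => h x * \1_(`]a, q[%classic : set R) x) (fun x => `|h x|)) => //.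
- by move=> n; apply: measurable_funM => //; exact: chi_meas.
- by apply: measurable_funM => //; exact: measurable_indic.
- move=> x; rewrite /= in_itv/= => xab.
  by apply: cvgM; [exact: cvg_cst|exact: chi_cvg].
- exact: integrable_norm inth.
- by move=> n x _; rewrite normrM ler_piMr.
Qed.

Lemma orthogonal_chi_eq0 h : mu.-integrable `[a, b] (EFin \o h) ->
  (forall q n, S q -> \int[mu]_(x in `[a, b]) (h x * chi q n x) = 0) ->
  {ae mu, forall x, `[a, b]%classic x -> h x = 0}.
Proof.
move=> inth h0; apply: primitive_eq0_ae => // q Sq.
have := cvg_Rintegral_chi Sq inth.
under eq_fun do rewrite h0//.
by move=> /cvg_lim <- //; rewrite lim_cst.
Qed.

(** With P a primitive of g, integration by parts makes f - P orthogonal to each [dpsi], that is to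
    each chi corrected by a multiple of chi0 to have mean zero. Subtracting the constant c that
    makes f - P - c orthogonal to chi0 gives orthogonality to every chi. The hypothesis on psi b is
    the vanishing of the boundary term. It covers two situations: the integral of g is 0 (periodic
    case), or psi b = 0 (compact support). *)
Lemma du_bois_reymond (f g chi0 : R -> R) :
  mu.-integrable `[a, b] (EFin \o f) -> mu.-integrable `[a, b] (EFin \o g) ->
  continuous chi0 -> \int[mu]_(x in `[a, b]) chi0 x != 0 ->
  (forall q n, S q -> exists psi : R -> R,
    let dpsi x := (\int[mu]_(y in `[a, b]) chi0 y) * chi q n x -
                  (\int[mu]_(y in `[a, b]) chi q n y) * chi0 x in
    [/\ forall x : R, is_derive x 1 psi (dpsi x),
        (\int[mu]_(x in `[a, b]) g x) * psi b = 0 &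
        \int[mu]_(x in `[a, b]) (f x * dpsi x) = - \int[mu]_(x in `[a, b]) (g x * psi x)]) ->
  exists F : R -> R, primitive a b F g /\ {ae mu, forall x, `[a, b]%classic x -> f x = F x}.
Proof.
move=> intf intg c0 I0 Hpsi.
pose P t := \int[mu]_(x in `[a, t]) g x.
have pP : primitive a b P g by exact: primitive_integral.
have [C PC] := primitive_bounded pP.
have mP := primitive_measurable ab pP.
have intP : mu.-integrable `[a, b] (EFin \o P).
  apply: measurable_bounded_integrable => //.
  - by rewrite /= lebesgue_measure_itv/= lte_fin ab -EFinB ltry.
  - exists C; split; first exact: num_real.
    by move=> M CM x Dx /=; exact: le_trans (PC _ Dx) (ltW CM).
pose F x := f x - P x.
have intF : mu.-integrable `[a, b] (EFin \o F) by exact: integrableRB.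
have intc (k : R -> R) h : continuous k -> mu.-integrable `[a, b] (EFin \o h) ->
    mu.-integrable `[a, b] (EFin \o (fun x => h x * k x)).
  by move=> ck inth; exact: integrable_mul_continuous.
pose c := (\int[mu]_(x in `[a, b]) (F x * chi0 x)) / \int[mu]_(x in `[a, b]) chi0 x.
have intFc : mu.-integrable `[a, b] (EFin \o (fun x => F x - c)).
  by apply: integrableRB => //; apply: continuous_integrable_itv => x; exact: cvg_cst.
have Fc : {ae mu, forall x, `[a, b]%classic x -> F x - c = 0}.
  apply: orthogonal_chi_eq0 => // q n Sq.
  have [psi [dpsi Ppsi fpsi]] := Hpsi q n Sq.
  set I := \int[mu]_(x in `[a, b]) chi0 x in I0 c fpsi dpsi intFc *.
  set J := \int[mu]_(x in `[a, b]) chi q n x in fpsi dpsi *.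
  have cchi := @chi_continuous q n Sq.
  have cd : continuous (fun x => I * chi q n x - J * chi0 x).
    move=> x; apply: cvgB; apply: cvgM; [exact: cvg_cst|exact: cchi|exact: cvg_cst|exact: c0].
  have cpsi := is_derive_continuous dpsi.
  have ppsi : primitive a b psi (fun x => I * chi q n x - J * chi0 x).
    exact: primitive_derive.
  have := primitive_total ab (primitiveM ab pP ppsi).
  rewrite RintegralD//; last 2 first.
  - exact: intc.
  - exact: intc.
  rewrite Ppsi /P set_itv1 Rintegral_set1 mul0r subr0 => gP.
  have FI : \int[mu]_(x in `[a, b]) (F x * (I * chi q n x - J * chi0 x)) = 0.
    under eq_Rintegral do rewrite mulrBl.
    rewrite RintegralB//; [|exact: intc|exact: intc].
    by rewrite fpsi -opprD gP oppr0.
  have FchiE : \int[mu]_(x in `[a, b]) (F x * (I * chi q n x - J * chi0 x)) =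
     I * \int[mu]_(x in `[a, b]) (F x * chi q n x) -
     J * \int[mu]_(x in `[a, b]) (F x * chi0 x).
    rewrite -!RintegralZl//; [|exact: intc|exact: intc].
    rewrite -RintegralB//; [|by apply: integrableRZ => //; exact: intc..].
    by apply: eq_Rintegral => x _; ring.
  under eq_Rintegral do rewrite mulrBl.
  rewrite RintegralB//; last 2 first.
  - exact: intc.
  - by apply: integrableRZ => //; exact: continuous_integrable_itv.
  rewrite RintegralZl//; last exact: continuous_integrable_itv.
  apply: (mulfI I0); rewrite mulr0 mulrBr -[RHS]FI FchiE /c -/J.
  by field.
exists (fun t => c + P t); split.
  apply: (eq_primitive ab _ _ (primitiveD (primitive_cst a b c) pP)) => // t _.
  by rewrite add0r.
have aeF := ae_filter_ringOfSetsType mu.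
by apply: filterS Fc => x /[apply]; rewrite /F => /eqP; rewrite subr_eq0 subr_eq addrC => /eqP.
Qed.

End du_bois_reymond.

(** * Explicit test functions on the circle and on the segment *)

Section test_functions.
Variable R : realType.
Local Notation mu := (@lebesgue_measure R).
Implicit Types f F : R -> R.

Definition compact_support f :=
  exists delta : R, 0 < delta /\ forall z, 1 - delta <= `|z| -> f z = 0.

Definition per2pi f := forall t, f (t + 2 * pi) = f t.

Lemma testfun_prod (eta deta psi dpsi : R -> R) :
  (forall z : R, is_derive z 1 eta (deta z)) -> continuous deta -> compact_support eta ->
  (forall t : R, is_derive t 1 psi (dpsi t)) -> continuous dpsi -> per2pi psi ->
  [/\ testfun (fun z t => eta z * psi t),
      dz_ (fun z t => eta z * psi t) = (fun z t => deta z * psi t) &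
      dt_ (fun z t => eta z * psi t) = (fun z t => eta z * dpsi t)].
Proof.
move=> de cde [delta [d0 sup]] dp cdp per.
have ce := is_derive_continuous de; have cp := is_derive_continuous dp.
have Dz (z t : R) : is_derive z 1 (fun z' => eta z' * psi t) (deta z * psi t).
  have := de z => dez; apply: is_derive_eq.
  by rewrite /GRing.scale/=; ring.
have Dt (z t : R) : is_derive t 1 (fun t' => eta z * psi t') (eta z * dpsi t).
  have := dp t => dpt; apply: is_derive_eq.
  by rewrite /GRing.scale/=; ring.
have Ez : dz_ (fun z t => eta z * psi t) = (fun z t => deta z * psi t).
  by apply/funext => z; apply/funext => t; rewrite /dz_ derive1E derive_val.
have Et : dt_ (fun z t => eta z * psi t) = (fun z t => eta z * dpsi t).
  by apply/funext => z; apply/funext => t; rewrite /dt_ derive1E derive_val.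
have cprod (f g : R -> R) : continuous f -> continuous g ->
    continuous (fun p : R * R => f p.1 * g p.2).
  move=> cf cg p; apply: cvgM.
    by apply: continuous_comp; [exact: cvg_fst|exact: cf].
  by apply: continuous_comp; [exact: cvg_snd|exact: cg].
split => //; split; first by move=> z t; rewrite per.
split; first by exists delta; split => // z t /sup ->; rewrite mul0r.
split; first by move=> z t; split; [have := Dz z t|have := Dt z t] => ?; exact: ex_derive.
by split; [exact: cprod|split; [rewrite Ez|rewrite Et]; exact: cprod].
Qed.

Lemma antiderivative_eq f F (x y : R) : continuous f ->
  (forall x : R, is_derive x 1 F (f x)) -> x <= y ->
  F y - F x = \int[mu]_(s in `[x, y]) f s.
Proof.
move=> cf dF xy.
apply: (primitive_sub (primitive_derive x y dF cf)) => //.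
Qed.

(** F(t + 2 pi) - F(t) has zero derivative, and its value at t = - pi is the integral of f over one
    period. *)
Lemma periodic_antiderivative f : continuous f -> per2pi f ->
  \int[mu]_(t in `[- pi, pi]) f t = 0 ->
  exists F : R -> R, (forall x : R, is_derive x 1 F (f x)) /\ per2pi F.
Proof.
move=> cf pf f0; have [F dF] := continuous_antiderivative cf.
exists F; split => // t.
have piN : - pi <= pi :> R by rewrite lerNl opprK_ || rewrite -subr_ge0 opprK addr_ge0 ?pi_ge0.
have dG : forall x : R, is_derive x 1 (fun x => F (x + 2 * pi) - F x) 0.
  move=> x; have dFx := dF x.
  have dsh : is_derive x 1 (fun x => F (x + 2 * pi)) (f x).
    rewrite -pf.
    have did : is_derive x 1 (fun x : R => x + 2 * pi) 1.
      by apply: is_derive_eq; rewrite /GRing.scale/=; ring.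
    have dFs := dF (x + 2 * pi).
    have := @is_derive1_comp R F (fun x => x + 2 * pi) x _ _ dFs did.
    by rewrite mulr1.
  by apply: is_derive_eq; rewrite /GRing.scale/=; ring.
have := is_derive_0_is_cst t (- pi) dG => /=.
rewrite (_ : - pi + 2 * pi = pi); last by ring.
by rewrite (antiderivative_eq cf dF piN) f0 => /eqP; rewrite subr_eq0 => /eqP.
Qed.

(** Zero mean makes an antiderivative equal at -1 and 1; since it is locally constant near both
    ends, subtracting this one value removes it there. *)
Lemma compact_support_antiderivative f : continuous f -> compact_support f ->
  \int[mu]_(t in `[- 1, 1]) f t = 0 ->
  exists F : R -> R, (forall x : R, is_derive x 1 F (f x)) /\ compact_support F.
Proof.
move=> cf [delta [d0 sup]] f0; have [F dF] := continuous_antiderivative cf.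
exists (fun x => F x - F (- 1)); split.
  move=> x; have dFx := dF x; by apply: is_derive_eq; rewrite /GRing.scale/=; ring.
have cstF x y : x <= y -> (forall s, x <= s <= y -> f s = 0) -> F x = F y.
  move=> xy fs; apply/eqP; rewrite eq_sym -subr_eq0 (antiderivative_eq cf dF xy).
  apply/eqP; transitivity (\int[mu]_(s in `[x, y]) (0 : R)); last first.
    by rewrite Rintegral_cst// mul0r.
  by apply: eq_Rintegral => s /set_mem/=; rewrite in_itv/=; exact: fs.
have F1 : F 1 = F (- 1).
  by apply/eqP; rewrite -subr_eq0 (antiderivative_eq cf dF) ?f0//; lra.
exists (Num.min delta 1); split; first by rewrite lt_min d0/=.
move=> z; rewrite lerBlDr => hz; apply/eqP; rewrite subr_eq0; apply/eqP.
have dl : Num.min delta 1 <= delta by rewrite ge_min lexx.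
have dl1 : Num.min delta 1 <= 1 by rewrite ge_min lexx orbT.
have [z0|z0] := leP 0 z.
  rewrite ger0_norm// in hz; rewrite -F1.
  have [z1|z1] := leP z 1; [|symmetry]; apply: cstF; rewrite ?(ltW z1)// => s /andP[s1 s2];
    apply: sup; rewrite ger0_norm; lra.
rewrite ltr0_norm// in hz.
have [z1|z1] := leP z (- 1); [|symmetry]; apply: cstF; rewrite ?(ltW z1)// => s /andP[s1 s2];
  apply: sup; rewrite ler0_norm; lra.
Qed.

Definition rat_itv (a b : R) : set R := [set q | a < q < b /\ exists r : rat, q = ratr r].

Lemma rat_itvP (a b q : R) : rat_itv a b q -> a < q < b.
Proof. by case. Qed.

Lemma rat_itv_dense (a b x y : R) : a <= x -> x < y -> y <= b ->
  exists2 q, rat_itv a b q & x < q < y.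
Proof.
move=> ax xy yb; have [r] := rat_in_itvoo xy.
rewrite in_itv/= => /andP[xr ry]; exists (ratr r); last by rewrite xr.
by split; [rewrite (le_lt_trans ax xr) (lt_le_trans ry yb)|exists r].
Qed.

(* sin((t+pi)/2) sin((q-t)/2) is 2pi-periodic in t and positive on [-pi,pi] exactly on ]-pi,q[. *)
Definition circle_step (q : R) (n : nat) (t : R) : R :=
  step n (sin ((t + pi) / 2) * sin ((q - t) / 2)).

Definition dcircle_step (q : R) (n : nat) (t : R) : R :=
  dstep n (sin ((t + pi) / 2) * sin ((q - t) / 2)) *
  (2^-1 * (cos ((t + pi) / 2) * sin ((q - t) / 2) -
           sin ((t + pi) / 2) * cos ((q - t) / 2))).

Lemma is_derive_circle_step q n (t : R) :
  is_derive t 1 (circle_step q n) (dcircle_step q n t).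
Proof.
have d1 : is_derive t 1 (fun t => (t + pi) / 2) 2^-1.
  by apply: is_derive_eq; rewrite /GRing.scale/=; ring.
have d2 : is_derive t 1 (fun t => (q - t) / 2) (- 2^-1).
  by apply: is_derive_eq; rewrite /GRing.scale/=; ring.
have s1 := is_derive1_comp (is_derive_sin _) d1.
have s2 := is_derive1_comp (is_derive_sin _) d2.
have d3 := is_deriveM s1 s2.
have d4 : is_derive t 1 (circle_step q n) _ := is_derive1_comp (is_derive_step n _) d3.
apply: (@is_derive_eq _ _ _ _ _ _ _ _ d4).
rewrite /dcircle_step/=; congr (_ * _); rewrite /GRing.scale/=.
by ring.
Qed.

Lemma continuous_dcircle_step q n : continuous (dcircle_step q n).
Proof.
have c1 : continuous (fun t : R => (t + pi) / 2).
  by move=> t; apply: cvgM; [apply: cvgD; [exact: cvg_id|exact: cvg_cst]|exact: cvg_cst].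
have c2 : continuous (fun t : R => (q - t) / 2).
  by move=> t; apply: cvgM; [apply: cvgB; [exact: cvg_cst|exact: cvg_id]|exact: cvg_cst].
have cs (h : R -> R) : continuous h -> continuous (fun t => sin (h t)).
  by move=> ch t; apply: continuous_comp; [exact: ch|exact: continuous_sin].
have cc (h : R -> R) : continuous h -> continuous (fun t => cos (h t)).
  by move=> ch t; apply: continuous_comp; [exact: ch|exact: continuous_cos].
move=> t; apply: cvgM.
  apply: (@continuous_comp _ _ _ (fun t => sin ((t + pi) / 2) * sin ((q - t) / 2))).
    by apply: cvgM; [exact: (cs _ c1)|exact: (cs _ c2)].
  exact: continuous_dstep.
apply: cvgM; first exact: cvg_cst.
apply: cvgB; apply: cvgM;
  [exact: (cc _ c1)|exact: (cs _ c2)|exact: (cs _ c1)|exact: (cc _ c2)].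
Qed.

Lemma continuous_circle_step q n : continuous (circle_step q n).
Proof. exact: is_derive_continuous (is_derive_circle_step q n). Qed.

Lemma circle_step_per q n : per2pi (circle_step q n).
Proof.
move=> t; rewrite /circle_step.
(* A full turn shifts each half-angle by pi: both sines change sign and their product does not. *)
rewrite (_ : (t + 2 * pi + pi) / 2 = (t + pi) / 2 + pi); last by field.
rewrite (_ : (q - (t + 2 * pi)) / 2 = (q - t) / 2 - pi); last by field.
rewrite sinDpi (_ : sin ((q - t) / 2 - pi) = - sin ((q - t) / 2)) ?mulrNN//.
by rewrite sinB sinpi cospi; ring.
Qed.

Lemma circle_step_itv q n t : 0 <= circle_step q n t <= 1.
Proof. exact: step_itv. Qed.

Lemma circle_step_cvg (q t : R) : - pi < q < pi -> - pi <= t <= pi ->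
  circle_step q n t @[n --> \oo] --> (\1_(`]-pi, q[%classic : set R) t : R).
Proof.
move=> /andP[q1 q2] /andP[]; rewrite le_eqVlt => /predU1P[<- _|t1 t2].
  rewrite indicE memNset; last by rewrite /= in_itv/= ltxx.
  rewrite /circle_step addNr mul0r sin0 mul0r.
  by under eq_fun do rewrite step_npos//; exact: cvg_cst.
rewrite indicE mem_setE in_itv/= t1/=.
have [tq|qt] := ltP t q.
  apply: (cvg_step (cvg_cst _)); rewrite mulr_gt0// sin_gt0_pi//; apply/andP; split; lra.
have H n : circle_step q n t = 0.
  apply: step_npos; rewrite mulr_ge0_le0//; first by apply: sin_ge0_pi; apply/andP; split; lra.
  rewrite -oppr_ge0 -sinN; apply: sin_ge0_pi; apply/andP; split; lra.
by under eq_fun do rewrite H; exact: cvg_cst.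
Qed.

(* The first factor is shifted by 1/(n+1) so that the support stays away from z = -1. *)
Definition segment_step (q : R) (n : nat) (z : R) : R :=
  step n ((z + 1 - n.+1%:R^-1) * (q - z)).

Definition dsegment_step (q : R) (n : nat) (z : R) : R :=
  dstep n ((z + 1 - n.+1%:R^-1) * (q - z)) * (q - z - (z + 1 - n.+1%:R^-1)).

Lemma is_derive_segment_step q n (z : R) :
  is_derive z 1 (segment_step q n) (dsegment_step q n z).
Proof.
have d1 : is_derive z 1 (fun z => z + 1 - n.+1%:R^-1) 1.
  by apply: is_derive_eq; rewrite /GRing.scale/=; ring.
have d2 : is_derive z 1 (fun z => q - z) (- 1).
  by apply: is_derive_eq; rewrite /GRing.scale/=; ring.
have d3 := is_deriveM d1 d2.
have d4 : is_derive z 1 (segment_step q n) _ := is_derive1_comp (is_derive_step n _) d3.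
apply: (@is_derive_eq _ _ _ _ _ _ _ _ d4).
rewrite /dsegment_step/=; congr (_ * _); rewrite /GRing.scale/=.
by ring.
Qed.

Lemma continuous_dsegment_step q n : continuous (dsegment_step q n).
Proof.
have c1 : continuous (fun z : R => z + 1 - n.+1%:R^-1).
  by move=> z; apply: cvgB; [apply: cvgD; [exact: cvg_id|exact: cvg_cst]|exact: cvg_cst].
have c2 : continuous (fun z : R => q - z).
  by move=> z; apply: cvgB; [exact: cvg_cst|exact: cvg_id].
move=> z; apply: cvgM.
  apply: (@continuous_comp R R R (fun z => (z + 1 - n.+1%:R^-1) * (q - z)) (dstep n)).
    by apply: cvgM; [exact: c1|exact: c2].
  exact: continuous_dstep.
by apply: cvgB; [exact: c2|exact: c1].
Qed.

Lemma continuous_segment_step q n : continuous (segment_step q n).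
Proof. exact: is_derive_continuous (is_derive_segment_step q n). Qed.

Lemma segment_step_itv q n t : 0 <= segment_step q n t <= 1.
Proof. exact: step_itv. Qed.

Lemma segment_step_support (q : R) n : - 1 < q < 1 -> compact_support (segment_step q n).
Proof.
move=> /andP[q1 q2].
have n0 : 0 < n.+1%:R^-1 :> R by rewrite invr_gt0.
have n1 : n.+1%:R^-1 <= 1 :> R by rewrite invf_le1// ler1n.
(* The first bound makes the shifted factor nonpositive near z = -1; the other two fix the sign of
   [q - z] near z = 1 and near z = -1. *)
pose d := Num.min (n.+1%:R^-1) (Num.min (1 - q) (q + 1)).
have dn : d <= n.+1%:R^-1 by rewrite ge_min lexx.
have dq : d <= 1 - q by rewrite !ge_min lexx !orbT.
have dq' : d <= q + 1 by rewrite !ge_min lexx !orbT.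
have d0 : 0 < d by rewrite !lt_min n0 /=; apply/andP; split; lra.
exists d; split=> //; clearbody d.
move=> z hz; apply: step_npos.
move: (n.+1%:R^-1 : R) n0 n1 dn => e n0 n1 dn.
have [z0|z0] := leP 0 z.
  by rewrite ger0_norm// in hz; apply: mulr_ge0_le0; lra.
by rewrite ltr0_norm// in hz; apply: mulr_le0_ge0; lra.
Qed.

Lemma segment_step_cvg (q z : R) : - 1 < q < 1 -> - 1 <= z <= 1 ->
  segment_step q n z @[n --> \oo] --> (\1_(`]-1, q[%classic : set R) z : R).
Proof.
move=> /andP[q1 q2] /andP[z1 z2].
have hn : (n.+1%:R^-1 : R) @[n --> \oo] --> (0 : R) by exact: cvg_harmonic.
have hc : (z + 1 - n.+1%:R^-1) * (q - z) @[n --> \oo] --> (z + 1) * (q - z).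
  apply: cvgM; last exact: cvg_cst.
  by rewrite -[X in _ --> X]subr0; apply: cvgB; [exact: cvg_cst|exact: hn].
rewrite indicE mem_setE in_itv/=.
have zero : (\forall n \near \oo, (z + 1 - n.+1%:R^-1) * (q - z) <= 0) ->
    segment_step q n z @[n --> \oo] --> (0 : R).
  move=> H; apply: cvg_near_cst; apply: filterS H => n H.
  by rewrite /segment_step step_npos.
have [z1'|z1'] := ltP (- 1) z; last first.
  have zE : z = - 1 by apply/eqP; rewrite eq_le z1'.
  apply: zero; near=> n; apply: mulr_le0_ge0; last by rewrite zE; lra.
  by rewrite zE addNr sub0r oppr_le0 invr_ge0.
have [zq|qz] /= := ltP z q.
  by apply: (cvg_step hc); rewrite mulr_gt0; lra.
apply: zero; near=> n; apply: mulr_ge0_le0; last by lra.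
rewrite subr_ge0; apply: ltW; near: n; apply: (cvgr_lt 0) => //; lra.
Unshelve. all: by end_near. Qed.

End test_functions.

(** * Weak derivatives on the cylinder *)

Section cylinder_domain.
Variable R : realType.
Local Notation mu := (@lebesgue_measure R).
Local Notation A := (`[- 1, 1]%classic : set (measurableTypeR R)).
Local Notation B := (`[- pi, pi]%classic : set (measurableTypeR R)).
Implicit Types f g : sfield R.

(** The point at which countability of the test family is used: it produces one null set of heights
    z valid for all test functions. *)
Lemma ae_forall_countable (T : countType) (P : T -> R -> Prop) :
  (forall i, {ae mu, forall x, P i x}) -> {ae mu, forall x, forall i, P i x}.
Proof.
move=> aeP; have aeF := ae_filter_ringOfSetsType mu.
have : {ae mu, forall x, forall n, if unpickle n is Some i then P i x else True}.
  apply: ae_foralln => n; case: (unpickle n) => [i|]; first exact: aeP.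
  exact: aeW.
by apply: filterS => x H i; have := H (pickle i); rewrite pickleK.
Qed.

(** Measurability refers to the product sigma-algebra, which is generated by rectangles; an open set
    of the plane is the countable union of the rational boxes it contains. *)
Lemma continuous_measurable_fun2 (f : R * R -> R) : continuous f ->
  measurable_fun [set: measurableTypeR R * measurableTypeR R] f.
Proof.
move=> cf; apply: (measurability _ (RGenOpens.measurableE R)).
move=> _ [_ [a [b ->] <-]]; rewrite setTI.
have oab : open (`]a, b[%classic : set R) by exact: interval_open.
have /continuousP/(_ _ oab) oU := cf.
set U := f @^-1` _ in oU *.
pose bx (a b c d : rat) : set (measurableTypeR R * measurableTypeR R) :=
  `]ratr a, ratr b[ `*` `]ratr c, ratr d[.
pose F a b c d := if pselect (bx a b c d `<=` U) then bx a b c d else set0.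
have -> : U = \bigcup_a \bigcup_b \bigcup_c \bigcup_d F a b c d.
  apply/seteqP; split => [[x y] Uxy|[x y] [a' _ [b' _ [c' _ [d' _]]]]]; last first.
    by rewrite /F; case: pselect => // H /H.
  have /nbhs_ballP[e /= e0 He] : nbhs (x, y) U by exact: open_nbhs_nbhs.
  have ex z : z - e < z by rewrite ltrBlDr ltrDl.
  have ex' z : z < z + e by rewrite ltrDl.
  have [r1] := rat_in_itvoo (ex x); rewrite in_itv/= => /andP[r11 r12].
  have [r2] := rat_in_itvoo (ex' x); rewrite in_itv/= => /andP[r21 r22].
  have [r3] := rat_in_itvoo (ex y); rewrite in_itv/= => /andP[r31 r32].
  have [r4] := rat_in_itvoo (ex' y); rewrite in_itv/= => /andP[r41 r42].
  exists r1 => //; exists r2 => //; exists r3 => //; exists r4 => //.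
  suff H : bx r1 r2 r3 r4 `<=` U.
    have -> : F r1 r2 r3 r4 = bx r1 r2 r3 r4 by rewrite /F; case: pselect.
    by split; rewrite /= in_itv/= ?r12 ?r21 ?r32 ?r41.
  move=> [u v] [/= uI vI]; apply: He; split => /=.
    by move: uI; rewrite in_itv/= => /andP[u1 u2]; rewrite /ball/= ltr_norml; apply/andP; split; lra.
  by move: vI; rewrite in_itv/= => /andP[v1 v2]; rewrite /ball/= ltr_norml; apply/andP; split; lra.
apply: bigcupT_measurable_rat => c1; apply: bigcupT_measurable_rat => c2.
apply: bigcupT_measurable_rat => c3; apply: bigcupT_measurable_rat => c4.
have [->|->] : F c1 c2 c3 c4 = bx c1 c2 c3 c4 \/ F c1 c2 c3 c4 = set0.
- by rewrite /F; case: pselect; [left|right].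
- exact: measurableX.
- exact: measurable0.
Qed.

Lemma measurable_Dom : measurable (@Dom R : set (measurableTypeR R * measurableTypeR R)).
Proof. exact: measurableX. Qed.

Let mA : measurable A. Proof. by []. Qed.
Let mB : measurable B. Proof. by []. Qed.

Definition measurable2 f := measurable_fun [set: measurableTypeR R * measurableTypeR R]
  (fun p => f p.1 p.2).
Definition integrable2 f := (@mu2 R).-integrable (@Dom R) (fun p => (f p.1 p.2)%:E).

Lemma I2_iterated f : integrable2 f ->
  I2 f = \int[mu]_(z in A) \int[mu]_(t in B) f z t.
Proof. by move=> intf; rewrite /I2 (Rintegral_rectangle mA mB intf). Qed.

Lemma ae_section_integrable f : integrable2 f ->
  {ae mu, forall z, A z -> mu.-integrable B (EFin \o f z)}.
Proof. exact: (ae_integrable_section mA mB). Qed.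

Lemma integrable_section f : integrable2 f ->
  mu.-integrable A (EFin \o (fun z => \int[mu]_(t in B) f z t)).
Proof. exact: (integrable_section_Rintegral mA mB). Qed.

Lemma integrable2D f g : integrable2 f -> integrable2 g -> integrable2 (fun z t => f z t + g z t).
Proof. exact: (integrableRD measurable_Dom). Qed.

Lemma integrable2B f g : integrable2 f -> integrable2 g -> integrable2 (fun z t => f z t - g z t).
Proof. exact: (integrableRB measurable_Dom). Qed.

Lemma integrable2Z (k : R) f : integrable2 f -> integrable2 (fun z t => k * f z t).
Proof. exact: (integrableRZ measurable_Dom). Qed.

Lemma I2D f g : integrable2 f -> integrable2 g -> I2 (fun z t => f z t + g z t) = I2 f + I2 g.
Proof. by move=> intf intg; rewrite /I2 (RintegralD measurable_Dom intf intg). Qed.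

Lemma I2B f g : integrable2 f -> integrable2 g -> I2 (fun z t => f z t - g z t) = I2 f - I2 g.
Proof. by move=> intf intg; rewrite /I2 (RintegralB measurable_Dom intf intg). Qed.

Lemma I2Z (k : R) f : integrable2 f -> I2 (fun z t => k * f z t) = k * I2 f.
Proof. by move=> intf; rewrite /I2 (RintegralZl k measurable_Dom intf). Qed.

Definition ae2 (P : R -> R -> Prop) :=
  {ae (mu \x mu)%E, forall p, @Dom R p -> P p.1 p.2}.

Lemma ae2P (P : R -> R -> Prop) : (@mu2 R).-negligible (@Dom R `&` [set p | ~ P p.1 p.2]) <->
  ae2 P.
Proof.
suff -> : @Dom R `&` [set p | ~ P p.1 p.2] = ~` [set p | @Dom R p -> P p.1 p.2] by [].
by apply/seteqP; split => p /= => [[Dp nP] /(_ Dp)//|/not_implyP].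
Qed.

Lemma ae2_section (P : R -> R -> Prop) : ae2 P ->
  {ae mu, forall z, A z -> {ae mu, forall t, B t -> P z t}}.
Proof.
move=> /ae_xsection; have aeF := ae_filter_ringOfSetsType mu.
apply: filterS => z H Az; apply: filterS H => t + Bt.
by apply; split.
Qed.

(** Stated for the vanishing of a measurable function, so that the exceptional set is measurable and
    null sections imply a null set. *)
Lemma section_ae2 f : measurable2 f ->
  {ae mu, forall z, A z -> {ae mu, forall t, B t -> f z t = 0}} ->
  ae2 (fun z t => f z t = 0).
Proof.
move=> mf H; apply: xsection_ae.
  rewrite [X in measurable X](_ : _ = @Dom R `&` (fun p => f p.1 p.2) @^-1` [set~ 0]).
    apply: measurableI; first exact: measurable_Dom.
    by rewrite -[X in measurable X]setTI; apply: mf => //; exact: measurableC.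
  by apply/seteqP; split => p /= => [/not_implyP|[Dp nP] /(_ Dp)].
have aeF := ae_filter_ringOfSetsType mu.
apply: filterS H => z H.
have [Az|nA] := pselect (A z); last by apply: aeW => t [].
by apply: filterS (H Az) => t + [_ Bt]; exact.
Qed.

Lemma eq_integrable2 f g : (forall z t, A z -> B t -> f z t = g z t) -> integrable2 f -> integrable2 g.
Proof.
by move=> fg; apply: (eq_integrableR measurable_Dom) => -[z t] [/= Az Bt]; exact: fg.
Qed.

Lemma eq_I2 f g : (forall z t, A z -> B t -> f z t = g z t) -> I2 f = I2 g.
Proof.
by move=> fg; apply: eq_Rintegral => -[z t] /set_mem[/= Az Bt]; exact: fg.
Qed.

Lemma ae_eq_I2 f g : measurable2 f -> measurable2 g -> ae2 (fun z t => f z t = g z t) -> I2 f = I2 g.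
Proof.
move=> mf mg fg; apply: (ae_eq_Rintegral measurable_Dom) => //.
- exact: measurable_funTS mf.
- exact: measurable_funTS mg.
Qed.

Definition bounded2 f := exists C : R, forall z t, A z -> B t -> `|f z t| <= C.

Lemma mu2_Dom_lty : ((mu \x mu)%E (@Dom R) < +oo)%E.
Proof.
rewrite [X in (X < _)%E](product_measure1E mu mu mA mB).
have fin (a b : R) : (mu `[a, b]%classic < +oo)%E.
  by rewrite /= lebesgue_measure_itv/=; case: ifP => _; rewrite ?ltry// -EFinB ltry.
apply: lte_mul_pinfty => //; last exact: fin.
by rewrite ge0_fin_numE//; exact: fin.
Qed.

Lemma bounded_integrable2 f : measurable2 f -> bounded2 f -> integrable2 f.
Proof.
move=> mf [C fC]; apply: (measurable_bounded_integrable measurable_Dom mu2_Dom_lty).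
  exact: measurable_funTS mf.
exists C; split; first exact: num_real.
by move=> M CM [z t] [/= Az Bt]; exact: le_trans (fC _ _ Az Bt) (ltW CM).
Qed.

Lemma integrable2_boundedM f g : integrable2 f -> measurable2 g -> bounded2 g -> integrable2 (fun z t => f z t * g z t).
Proof.
move=> intf mg [C gC].
apply: (integrable_boundedM measurable_Dom intf (measurable_funTS mg) (C := C)).
by move=> [z t] [/= Az Bt]; exact: gC.
Qed.

Lemma L2M f g : L2 f -> L2 g -> integrable2 (fun z t => f z t * g z t).
Proof.
move=> [mf if2] [mg ig2].
have int : integrable2 (fun z t => f z t ^+ 2 + g z t ^+ 2).
  exact: (@integrable2D (fun z t => f z t ^+ 2) (fun z t => g z t ^+ 2)).
apply: le_integrable int => //; first exact: measurable_Dom.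
  apply/measurable_EFinP; apply: measurable_funTS; exact: measurable_funM.
move=> p _; rewrite /= lee_fin normrM [leRHS]ger0_norm ?addr_ge0 ?sqr_ge0//.
rewrite -(real_normK (num_real (f _ _))) -(real_normK (num_real (g _ _))).
have := sqr_ge0 (`|f p.1 p.2| - `|g p.1 p.2|).
have := normr_ge0 (f p.1 p.2); have := normr_ge0 (g p.1 p.2); nra.
Qed.

Lemma bounded_L2 f : measurable2 f -> bounded2 f -> L2 f.
Proof.
move=> mf [C fC]; split => //; apply: (@bounded_integrable2 (fun z t => f z t ^+ 2)).
  exact: measurable_funX.
exists (C ^+ 2) => z t Az Bt; rewrite normrX lerXn2r ?nnegrE//; last exact: fC.
exact: le_trans (fC _ _ Az Bt).
Qed.

Lemma L2_int f : L2 f -> integrable2 f.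
Proof.
move=> Lf; have L1 : L2 (fun _ _ : R => 1 : R).
  by apply: bounded_L2; [exact: measurable_cst|exists 1 => z t _ _; rewrite normr1].
by apply: eq_integrable2 (L2M Lf L1) => z t _ _; rewrite mulr1.
Qed.

Lemma L2D f g : L2 f -> L2 g -> L2 (fun z t => f z t + g z t).
Proof.
move=> Lf Lg; split; first exact: measurable_funD Lf.1 Lg.1.
have := integrable2D (@integrable2D (fun z t => f z t ^+ 2) (fun z t => g z t ^+ 2) Lf.2 Lg.2) (integrable2Z 2 (L2M Lf Lg)).
by apply: (@eq_integrable2 _ (fun z t => (f z t + g z t) ^+ 2)) => z t _ _; ring.
Qed.

Lemma L2_boundedM f g : L2 f -> measurable2 g -> bounded2 g -> L2 (fun z t => f z t * g z t).
Proof.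
move=> Lf mg [C gC]; split; first exact: measurable_funM Lf.1 mg.
have : integrable2 (fun z t => f z t ^+ 2 * g z t ^+ 2).
  apply: (@integrable2_boundedM (fun z t => f z t ^+ 2) (fun z t => g z t ^+ 2)); [exact: Lf.2|exact: measurable_funX|].
  exists (C ^+ 2) => z t Az Bt; rewrite normrX lerXn2r ?nnegrE//; last exact: gC.
  exact: le_trans (gC _ _ Az Bt).
by apply: (@eq_integrable2 _ (fun z t => (f z t * g z t) ^+ 2)) => z t _ _; ring.
Qed.

Lemma measurable2_z (f : R -> R) : measurable_fun [set: measurableTypeR R] f -> measurable2 (fun z _ => f z).
Proof. by move=> mf; apply: (measurableT_comp mf); exact: measurable_fst. Qed.

Lemma measurable2_t (f : R -> R) : measurable_fun [set: measurableTypeR R] f -> measurable2 (fun _ t => f t).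
Proof. by move=> mf; apply: (measurableT_comp mf); exact: measurable_snd. Qed.

Lemma bounded2_z (f : R -> R) : continuous f -> bounded2 (fun z _ => f z).
Proof.
by move=> /(@continuous_bounded_itv _ _ (- 1) 1)[C fC]; exists C => z t Az _; exact: fC.
Qed.

Lemma bounded2_t (f : R -> R) : continuous f -> bounded2 (fun _ t => f t).
Proof.
by move=> /(@continuous_bounded_itv _ _ (- pi) pi)[C fC]; exists C => z t _ Bt; exact: fC.
Qed.

(** Localization in z: the circle integral, as a function of z, is orthogonal to approximations of
    the indicator of every ]-1, q[ with q rational. *)
Lemma section_Rintegral_eq0 f : integrable2 f ->
  (forall q n, rat_itv (- 1) 1 q -> I2 (fun z t => f z t * segment_step q n z) = 0) ->
  {ae mu, forall z, A z -> \int[mu]_(t in B) f z t = 0}.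
Proof.
move=> intf If0.
have N11 : - 1 < 1 :> R by lra.
apply: (@orthogonal_chi_eq0 R (- 1) 1 N11 (rat_itv (- 1) 1) (@rat_itvP _ _ _)
  (@rat_itv_dense _ _ _) (@segment_step R)).
- by move=> q n _; exact: continuous_segment_step.
- exact: segment_step_itv.
- by move=> q x /rat_itvP; exact: segment_step_cvg.
- exact: integrable_section.
move=> q n Sq; rewrite -[RHS](If0 q n Sq).
have aeF := ae_filter_ringOfSetsType mu.
have intfs : integrable2 (fun z t => f z t * segment_step q n z).
  apply: integrable2_boundedM => //.
    by apply: measurable2_z; apply: continuous_measurable_fun; exact: continuous_segment_step.
  by apply: bounded2_z; exact: continuous_segment_step.
rewrite I2_iterated//; apply: (ae_eq_Rintegral mA).
- apply: measurable_funM; first exact: integrableRmeas (integrable_section intf).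
  by apply: measurable_funTS; apply: continuous_measurable_fun; exact: continuous_segment_step.
- exact: integrableRmeas (integrable_section intfs).
apply: filterS (ae_section_integrable intf) => z + Az => /(_ Az) iz.
by rewrite RintegralZr.
Qed.

End cylinder_domain.

(** * Weak derivatives restricted to almost every circle *)

Section weak_derivatives.
Variable R : realType.
Local Notation mu := (@lebesgue_measure R).
Local Notation A := (`[- 1, 1]%classic : set (measurableTypeR R)).
Local Notation B := (`[- pi, pi]%classic : set (measurableTypeR R)).
Implicit Types f g h : sfield R.

Definition weak_dt f g := forall phi, testfun phi ->
  I2 (fun z t => f z t * dt_ phi z t) = - I2 (fun z t => g z t * phi z t).

Definition weak_dz f g := forall phi, testfun phi ->
  I2 (fun z t => f z t * dz_ phi z t) = - I2 (fun z t => g z t * phi z t).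

Let mA : measurable A. Proof. by []. Qed.
Let mB : measurable B. Proof. by []. Qed.
Let N11 : - 1 < 1 :> R. Proof. by lra. Qed.
Let Npipi : - pi < pi :> R. Proof. by have := pi_gt0 R; lra. Qed.

Lemma integrable2_mul_tensor f (eta psi : R -> R) : integrable2 f -> continuous eta -> continuous psi ->
  integrable2 (fun z t => f z t * (eta z * psi t)).
Proof.
move=> intf ce cp.
have := integrable2_boundedM intf (measurable2_z (continuous_measurable_fun ce)) (bounded2_z ce).
move=> /integrable2_boundedM/(_ (measurable2_t (continuous_measurable_fun cp)) (bounded2_t cp)).
by apply: eq_integrable2 => z t _ _; ring.
Qed.

Lemma integrable2_mul_t f (psi : R -> R) : integrable2 f -> continuous psi ->
  integrable2 (fun z t => f z t * psi t).
Proof.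
by move=> intf cp; apply: integrable2_boundedM => //;
  [exact: measurable2_t (continuous_measurable_fun cp)|exact: bounded2_t].
Qed.

(** The fundamental lemma one variable at a time. Products of a step in z and a step in t localize
    in z first, for each rational endpoint and each n in t; after the countable intersection, the
    same argument is run in t on almost every circle. *)
Lemma testfun_orthogonal_eq0 h : measurable2 h -> integrable2 h ->
  (forall phi, testfun phi -> I2 (fun z t => h z t * phi z t) = 0) ->
  ae2 (fun z t => h z t = 0).
Proof.
move=> mh inth h0; have aeF := ae_filter_ringOfSetsType mu.
apply: section_ae2 => //.
have H : {ae mu, forall z, forall i : rat * nat, A z ->
    (- pi < (ratr i.1 : R) < pi) -> \int[mu]_(t in B) (h z t * circle_step (ratr i.1) i.2 t) = 0}.
  apply: (@ae_forall_countable R (rat * nat)%type (fun i z => _)) => -[r n] /=.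
  have [rpi|rpi] := pselect (- pi < (ratr r : R) < pi); last by apply: aeW.
  have : {ae mu, forall z, A z -> \int[mu]_(t in B) (h z t * circle_step (ratr r) n t) = 0}.
    apply: (@section_Rintegral_eq0 _ (fun z t => h z t * circle_step (ratr r) n t)).
      by apply: integrable2_mul_t => //; exact: continuous_circle_step.
    move=> q k /rat_itvP Sq.
    have [tf _ _] := testfun_prod (is_derive_segment_step q k)
      (@continuous_dsegment_step _ q k) (segment_step_support k Sq)
      (is_derive_circle_step (ratr r) n) (@continuous_dcircle_step _ (ratr r) n)
      (circle_step_per (ratr r) n).
    by rewrite -[RHS](h0 _ tf); apply: eq_I2 => z t _ _; ring.
  by apply: filterS => z + Az _; exact.
apply: filterS2 (ae_section_integrable inth) H => z inth' H Az.
apply: (@orthogonal_chi_eq0 R (- pi) pi Npipi (rat_itv (- pi) pi) (@rat_itvP _ _ _)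
  (@rat_itv_dense _ _ _) (@circle_step R)).
- by move=> q n _; exact: continuous_circle_step.
- exact: circle_step_itv.
- by move=> q x /rat_itvP; exact: circle_step_cvg.
- exact: inth'.
- by move=> q n [qpi [r qr]]; have := H (r, n); rewrite /= -qr; exact.
Qed.

(** In the test function eta(z) psi(t) the t-derivative falls on psi alone, so eta can be used to
    localize in z. The null set of heights still depends on psi. *)
Lemma weak_dt_section f g (psi dpsi : R -> R) : integrable2 f -> integrable2 g -> weak_dt f g ->
  (forall t : R, is_derive t 1 psi (dpsi t)) -> continuous dpsi -> per2pi psi ->
  {ae mu, forall z, A z ->
    \int[mu]_(t in B) (f z t * dpsi t) = - \int[mu]_(t in B) (g z t * psi t)}.
Proof.
move=> intf intg wfg dp cdp per; have aeF := ae_filter_ringOfSetsType mu.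
have cp := is_derive_continuous dp.
have ifd := integrable2_mul_t intf cdp; have igp := integrable2_mul_t intg cp.
have := @section_Rintegral_eq0 _ _ (integrable2D ifd igp).
case.
  move=> q n /rat_itvP Sq.
  have [tf _ dtE] := testfun_prod (is_derive_segment_step q n)
    (@continuous_dsegment_step _ q n) (segment_step_support n Sq) dp cdp per.
  have cs := @continuous_segment_step R q n.
  have := wfg _ tf; rewrite dtE => /eqP; rewrite -subr_eq0 opprK => /eqP.
  rewrite -I2D; last 2 first.
  - exact: integrable2_mul_tensor.
  - exact: integrable2_mul_tensor.
  by move=> <-; apply: eq_I2 => z t _ _; ring.
move=> N [mN N0 HN].
have : {ae mu, forall z, A z -> \int[mu]_(t in B) (f z t * dpsi t + g z t * psi t) = 0}.
  by exists N.
apply: filterS3 (ae_section_integrable intf) (ae_section_integrable intg) => z + + + Az.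
move=> /(_ Az) fz /(_ Az) gz /(_ Az); rewrite RintegralD//; last 2 first.
- exact: integrable_mul_continuous.
- exact: integrable_mul_continuous.
by move=> /eqP; rewrite addr_eq0 => /eqP.
Qed.

(** Absolute continuity on circles. For each rational endpoint and each n, a periodic psi with
    derivative [dpsi] (the step minus its mean, up to a factor) is fixed before z is chosen; the
    exceptional heights then form one null set, and the du Bois-Reymond lemma applies on all other
    circles. *)
Lemma weak_dt_primitive f g : integrable2 f -> integrable2 g -> weak_dt f g ->
  {ae mu, forall z, A z -> exists F : R -> R,
    [/\ primitive (- pi) pi F (g z), F pi = F (- pi) &
        {ae mu, forall t, B t -> f z t = F t}]}.
Proof.
move=> intf intg wfg; have aeF := ae_filter_ringOfSetsType mu.
pose Ione : R := \int[mu]_(y in B) 1.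
pose dpsi (q : R) n (x : R) := Ione * circle_step q n x -
  (\int[mu]_(y in B) circle_step q n y) * 1.
have cdpsi q n : continuous (dpsi q n).
  move=> x; apply: cvgB; last exact: cvg_cst.
  by apply: cvgM; [exact: cvg_cst|exact: continuous_circle_step].
have psiP q n : exists psi : R -> R, (forall t : R, is_derive t 1 psi (dpsi q n t)) /\ per2pi psi.
  apply: periodic_antiderivative => //.
    by move=> t; rewrite /dpsi circle_step_per.
  have ic := continuous_integrable_itv (- pi) pi (@continuous_circle_step R q n).
  rewrite /dpsi RintegralB//; last 2 first.
  - exact: integrableRZ.
  - by apply: continuous_integrable_itv => x; exact: cvg_cst.
  rewrite RintegralZl// RintegralZl//; last exact: continuous_integrable_itv (@continuous_cst1 R).
  by rewrite mulrC subrr.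
(* The test function psi = 1 shows that g has mean zero on almost every circle. This removes the
   boundary term below and also closes up the primitive: F pi = F (- pi). *)
have H1 : {ae mu, forall z, A z -> \int[mu]_(t in B) g z t = 0}.
  have d1 (t : R) : is_derive t 1 (fun _ : R => 1 : R) (0 : R) by exact: is_derive_cst.
  have c0 : continuous (fun _ : R => 0 : R) by move=> x; exact: cvg_cst.
  have := weak_dt_section intf intg wfg d1 c0 (fun=> erefl).
  apply: filterS => z H Az; have := H Az; cbv beta.
  have -> : \int[mu]_(t in B) (f z t * 0) = 0.
    transitivity (\int[mu]_(t in B) (0 : R)); last by rewrite Rintegral_cst// mul0r.
    by apply: eq_Rintegral => t _; rewrite mulr0.
  have -> : \int[mu]_(t in B) (g z t * 1) = \int[mu]_(t in B) g z t.
    by apply: eq_Rintegral => t _; rewrite mulr1.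
  by move=> /eqP; rewrite eq_sym oppr_eq0 => /eqP.
have H2 : {ae mu, forall z, forall i : rat * nat, A z -> exists psi : R -> R,
    (forall t : R, is_derive t 1 psi (dpsi (ratr i.1) i.2 t)) /\
    \int[mu]_(t in B) (f z t * dpsi (ratr i.1) i.2 t) = - \int[mu]_(t in B) (g z t * psi t)}.
  apply: (@ae_forall_countable R (rat * nat)%type (fun i z => _)) => -[r n] /=.
  have [psi [dp per]] := psiP (ratr r) n.
  have := weak_dt_section intf intg wfg dp (cdpsi _ _) per.
  by apply: filterS => z + Az => /(_ Az) E; exists psi.
have Hfg : {ae mu, forall z, A z ->
    mu.-integrable B (EFin \o f z) /\ mu.-integrable B (EFin \o g z)}.
  apply: filterS2 (ae_section_integrable intf) (ae_section_integrable intg) => z fz gz Az.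
  by split; [exact: fz|exact: gz].
apply: filterS3 Hfg H1 H2 => z {}Hfg {}H1 {}H2 Az.
have [fz gz] := Hfg Az; have g0 := H1 Az.
have [F [pF fF]] : exists F : R -> R, primitive (- pi) pi F (g z) /\
    {ae mu, forall x, B x -> f z x = F x}.
  apply: (@du_bois_reymond R (- pi) pi Npipi (rat_itv (- pi) pi) (@rat_itvP _ _ _)
    (@rat_itv_dense _ _ _) (@circle_step R) _ (@circle_step_itv R) _ (f z) (g z) (fun=> 1)) => //.
  - by move=> q n _; exact: continuous_circle_step.
  - by move=> q x /rat_itvP; exact: circle_step_cvg.
  - exact: (@continuous_cst1 R).
  - rewrite Rintegral_cst// mul1r /= lebesgue_measure_itv/= lte_fin Npipi -EFinB/=.
    by apply: lt0r_neq0; have := pi_gt0 R; lra.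
  move=> q n [_ [r ->]]; have [psi [dp E]] := H2 (r, n) Az.
  by exists psi; split => //; rewrite g0 mul0r.
exists F; split => //.
by apply/eqP; rewrite -subr_eq0 -(primitive_total Npipi pF) g0.
Qed.

(** In the z direction only circle averages against a fixed psi are needed. Pairing with eta(z)
    psi(t) reduces to the du Bois-Reymond lemma on [-1, 1], where the boundary term vanishes because
    eta 1 = 0. *)
Lemma weak_dz_mean f g (psi dpsi : R -> R) : integrable2 f -> integrable2 g -> weak_dz f g ->
  (forall t : R, is_derive t 1 psi (dpsi t)) -> continuous dpsi -> per2pi psi ->
  exists F : R -> R,
    primitive (- 1) 1 F (fun z => \int[mu]_(t in B) (g z t * psi t)) /\
    {ae mu, forall z, A z -> \int[mu]_(t in B) (f z t * psi t) = F z}.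
Proof.
move=> intf intg wfg dp cdp per; have aeF := ae_filter_ringOfSetsType mu.
have cp := is_derive_continuous dp.
have ifp := integrable2_mul_t intf cp; have igp := integrable2_mul_t intg cp.
have intFG (k : R -> R) h : integrable2 h -> continuous k ->
    \int[mu]_(z in A) ((\int[mu]_(t in B) (h z t * psi t)) * k z) =
    I2 (fun z t => h z t * (k z * psi t)).
  move=> inth ck; rewrite I2_iterated; last exact: integrable2_mul_tensor.
  have ih := integrable2_mul_t inth cp.
  apply: (ae_eq_Rintegral mA).
  - by apply: integrableRmeas; apply: integrable_mul_continuous => //; exact: integrable_section ih.
  - by apply: integrableRmeas; apply: integrable_section; exact: integrable2_mul_tensor.
  apply: filterS (ae_section_integrable ih) => z + Az => /(_ Az) iz.
  by rewrite -RintegralZr//; apply: eq_Rintegral => t _; ring.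
pose q0 : R := 0.
have q0P : - 1 < q0 < 1 by rewrite /q0; apply/andP; split; lra.
have [N hN] : exists N : nat, \int[mu]_(z in A) segment_step q0 N z != 0.
  apply: contrapT => /forallNP H.
  have := @cvg_Rintegral_chi R (- 1) 1 (fun q => - 1 < q < 1) (fun q => id) (@segment_step R)
    (fun q n _ => @continuous_segment_step R q n) (@segment_step_itv R)
    (fun q x => @segment_step_cvg R q x) (fun=> 1) q0 q0P
    (continuous_integrable_itv _ _ (@continuous_cst1 R)).
  have E n : \int[mu]_(x in A) (1 * segment_step q0 n x) = 0.
    under eq_Rintegral do rewrite mul1r.
    by apply/eqP; apply: contrapT => /negP; exact: H.
  under eq_fun do rewrite E.
  move=> /cvg_lim; rewrite lim_cst// => /(_ (@Rhausdorff R)).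
  rewrite Rintegral_cst// mul1r /= lebesgue_measure_itv/= lte_fin.
  by rewrite /q0 ifT -?EFinB/=; lra.
pose chi0 := segment_step q0 N.
have cc0 : continuous chi0 by exact: continuous_segment_step.
apply: (@du_bois_reymond R (- 1) 1 N11 (rat_itv (- 1) 1) (@rat_itvP _ _ _)
    (@rat_itv_dense _ _ _) (@segment_step R) _ (@segment_step_itv R) _ _ _ chi0) => //.
- by move=> q n _; exact: continuous_segment_step.
- by move=> q x /rat_itvP; exact: segment_step_cvg.
- exact: integrable_section ifp.
- exact: integrable_section igp.
move=> q n /rat_itvP Sq.
set I := \int[mu]_(y in A) chi0 y; set J := \int[mu]_(y in A) segment_step q n y.
pose deta x := I * segment_step q n x - J * chi0 x.
have cdeta : continuous deta.
  by move=> x; apply: cvgB; apply: cvgM; [exact: cvg_cst|exact: continuous_segment_step|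
    exact: cvg_cst|exact: cc0].
have [eta [de se]] : exists F : R -> R, (forall x : R, is_derive x 1 F (deta x)) /\
    compact_support F.
  apply: compact_support_antiderivative => //.
    have [d1 [d10 H1]] := segment_step_support n Sq.
    have [d2 [d20 H2]] := segment_step_support N q0P.
    exists (Num.min d1 d2); split; first by rewrite lt_min d10.
    move=> z hz; have h1 : Num.min d1 d2 <= d1 by rewrite ge_min lexx.
    have h2 : Num.min d1 d2 <= d2 by rewrite ge_min lexx orbT.
    by rewrite /deta /chi0 H1 ?H2 ?mulr0 ?subrr//; lra.
  rewrite /deta RintegralB//; last 2 first.
  - by apply: integrableRZ => //; apply: continuous_integrable_itv; exact: continuous_segment_step.
  - by apply: integrableRZ => //; exact: continuous_integrable_itv.
  rewrite !RintegralZl//; last 2 first.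
  - exact: continuous_integrable_itv.
  - by apply: continuous_integrable_itv; exact: continuous_segment_step.
  by rewrite -/I -/J mulrC subrr.
have ceta := is_derive_continuous de.
exists eta; split => //.
  have [d [d0 ->]] := se; first by rewrite mulr0.
  by rewrite normr1; lra.
have [tf dzE _] := testfun_prod de cdeta se dp cdp per.
have := wfg _ tf; rewrite dzE -!intFG//.
Qed.

End weak_derivatives.

(** * Classical derivatives of fields depending on t alone are weak derivatives *)

Section smooth_fields.
Variable R : realType.
Local Notation mu := (@lebesgue_measure R).
Local Notation A := (`[- 1, 1]%classic : set (measurableTypeR R)).
Local Notation B := (`[- pi, pi]%classic : set (measurableTypeR R)).

Let mA : measurable A. Proof. by []. Qed.
Let mB : measurable B. Proof. by []. Qed.
Let N11 : - 1 < 1 :> R. Proof. by lra. Qed.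
Let Npipi : - pi < pi :> R. Proof. by have := pi_gt0 R; lra. Qed.

Lemma continuous_integrable2 (phi : sfield R) : continuous (fun p : R * R => phi p.1 p.2) ->
  integrable2 phi.
Proof.
move=> cphi; apply: bounded_integrable2; first exact: continuous_measurable_fun2.
have cD : compact (@Dom R).
  by apply: compact_setX; exact: segment_compact.
have cK : compact ((fun p : R * R => phi p.1 p.2) @` (@Dom R)).
  by apply: continuous_compact => //; exact: continuous_subspaceT.
have [M [_ HM]] := compact_bounded cK.
exists (M + 1) => z t Az Bt; apply: (HM (M + 1)); first by rewrite ltrDl.
by exists (z, t).
Qed.

Lemma per2pi_ends (f : R -> R) : per2pi f -> f pi = f (- pi).
Proof. by move=> pf; rewrite -(pf (- pi)); congr f; ring. Qed.

Lemma testfun_dt (phi : sfield R) z : testfun phi ->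
  [/\ forall t : R, is_derive t 1 (phi z) (dt_ phi z t), continuous (dt_ phi z) & per2pi (phi z)].
Proof.
move=> [per [_ [der [_ [_ cdt]]]]]; split.
- move=> t; have [_ d] := der z t; apply: DeriveDef => //.
  by rewrite /dt_ derive1E.
- move=> t; apply: (@continuous_comp R (R * R)%type R (fun t => (z, t)) (fun p => dt_ phi p.1 p.2)).
    exact: (@cvg_pair _ _ _ (nbhs t) (nbhs z) (nbhs t) _ _ _ _ _ (cvg_cst _) cvg_id).
  exact: cdt.
- by move=> t; rewrite per.
Qed.

Lemma testfun_dz (phi : sfield R) t : testfun phi ->
  [/\ forall z : R, is_derive z 1 (phi^~ t) (dz_ phi z t), continuous (dz_ phi ^~ t),
      phi 1 t = 0 & phi (- 1) t = 0].
Proof.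
move=> [_ [[d [d0 sup]] [der [_ [cdz _]]]]]; split.
- move=> z; have [de _] := der z t; apply: DeriveDef => //.
  by rewrite /dz_ derive1E.
- move=> z; apply: (@continuous_comp R (R * R)%type R (fun z => (z, t)) (fun p => dz_ phi p.1 p.2)).
    exact: (@cvg_pair _ _ _ (nbhs z) (nbhs z) (nbhs t) _ _ _ _ _ cvg_id (cvg_cst _)).
  exact: cdz.
- by apply: sup; rewrite normr1; lra.
- by apply: sup; rewrite normrN normr1; lra.
Qed.

Variables w dw : R -> R.
Hypothesis dwP : forall t : R, is_derive t 1 w (dw t).
Hypothesis cdw : continuous dw.
Hypothesis perw : per2pi w.

Let cw : continuous w. Proof. exact: is_derive_continuous dwP. Qed.

Lemma weak_dt_smooth : weak_dt (fun _ => w) (fun _ => dw).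
Proof.
move=> phi tphi; have [_ [_ [_ [cphi [_ cdt]]]]] := tphi.
have i1 : integrable2 (fun z t => w t * dt_ phi z t).
  by apply: eq_integrable2 (integrable2_mul_t (continuous_integrable2 cdt) cw) => z t _ _; rewrite mulrC.
have i2 : integrable2 (fun z t => dw t * phi z t).
  by apply: eq_integrable2 (integrable2_mul_t (continuous_integrable2 cphi) cdw) => z t _ _; rewrite mulrC.
apply/eqP; rewrite -addr_eq0 -I2D// I2_iterated; last exact: integrable2D.
apply/eqP; transitivity (\int[mu]_(z in A) (0 : R)); last by rewrite Rintegral_cst// mul0r.
apply: eq_Rintegral => z _; have [dphi cdphi pphi] := testfun_dt z tphi.
have pw := primitive_derive (- pi) pi dwP cdw.
have pp := primitive_derive (- pi) pi dphi cdphi.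
have := primitive_total Npipi (primitiveM Npipi pw pp).
rewrite (per2pi_ends perw) (per2pi_ends pphi) subrr => <-.
by apply: eq_Rintegral => t _; rewrite addrC.
Qed.

Lemma weak_dz_smooth : weak_dz (fun _ => w) (fun _ _ => 0).
Proof.
move=> phi tphi; have [_ [_ [_ [cphi [cdz _]]]]] := tphi.
have i1 : integrable2 (fun z t => w t * dz_ phi z t).
  by apply: eq_integrable2 (integrable2_mul_t (continuous_integrable2 cdz) cw) => z t _ _; rewrite mulrC.
have -> : I2 (fun z t => 0 * phi z t) = 0.
  rewrite (@eq_I2 _ _ (fun _ _ => 0)) => [|z t _ _]; last by rewrite mul0r.
  by rewrite /I2 Rintegral_cst ?mul0r//; exact: measurable_Dom.
rewrite oppr0 /I2 (Rintegral_rectangle_swap mA mB i1)/=.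
transitivity (\int[mu]_(t in B) (0 : R)); last by rewrite Rintegral_cst// mul0r.
apply: eq_Rintegral => t _; have [dphi cdphi p1 pN1] := testfun_dz t tphi.
have pp := primitive_derive (- 1) 1 dphi cdphi.
rewrite RintegralZl//; last exact: primitive_integrable pp.
by rewrite (primitive_total N11 pp) p1 pN1 subrr mulr0.
Qed.

Lemma smooth_L2 : L2 (fun _ => w).
Proof.
apply: bounded_L2; first exact: measurable2_t (continuous_measurable_fun cw).
exact: bounded2_t.
Qed.

End smooth_fields.

(** * Existence and uniqueness of weak gradients *)

Section weak_gradients.
Variable R : realType.
Local Notation mu := (@lebesgue_measure R).
Implicit Types (m : field R) (G : field R * field R).

Lemma weak_gradP m G : weak_grad m G -> forall i,
  [/\ L2 (fun z t => m z t i), L2 (fun z t => G.1 z t i), L2 (fun z t => G.2 z t i),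
      weak_dz (fun z t => m z t i) (fun z t => G.1 z t i) &
      weak_dt (fun z t => m z t i) (fun z t => G.2 z t i)].
Proof.
move=> [_ [_ [_ H]]] i; have [L0 [L1 [L2' Hphi]]] := H i.
by split => // phi tphi; have [] := Hphi phi tphi.
Qed.

Lemma weak_grad_smooth (w dw : 'I_3 -> R -> R) :
  (forall i (t : R), is_derive t 1 (w i) (dw i t)) -> (forall i, continuous (dw i)) ->
  (forall i, per2pi (w i)) -> (forall i, per2pi (dw i)) ->
  weak_grad (fun _ t i => w i t) (fun _ _ _ => 0, fun _ t i => dw i t).
Proof.
move=> dP cd per perd.
split; first by move=> z t; apply/funext => i; exact: per.
split; first by [].
split; first by move=> z t; apply/funext => i; exact: perd.
move=> i; split; first exact: smooth_L2 (dP i).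
split; first by apply: bounded_L2; [exact: measurable_cst|exists 0 => *; rewrite normr0].
split.
  apply: bounded_L2; first exact: measurable2_t (continuous_measurable_fun (cd i)).
  exact: bounded2_t.
move=> phi tphi; split.
- exact: (weak_dz_smooth (dP i) tphi).
- exact: (weak_dt_smooth (dP i) (cd i) (per i) tphi).
Qed.

(** The difference of two weak gradients is orthogonal to all test functions. This lets every
    statement about an arbitrary weak gradient of an explicit field be computed with the classical
    one. *)
Lemma weak_grad_unique m G G' : weak_grad m G -> weak_grad m G' ->
  ae2 (fun z t => G.1 z t = G'.1 z t /\ G.2 z t = G'.2 z t).
Proof.
move=> mG mG'; have aeF2 := ae_filter_ringOfSetsType (mu \x mu)%E.
have eq0 (g g' : sfield R) : L2 g -> L2 g' ->
    (forall phi, testfun phi -> I2 (fun z t => g z t * phi z t) = I2 (fun z t => g' z t * phi z t)) ->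
    ae2 (fun z t => g z t - g' z t = 0).
  move=> Lg Lg' E; apply: (@testfun_orthogonal_eq0 _ (fun z t => g z t - g' z t)).
  - exact: measurable_funB Lg.1 Lg'.1.
  - by apply: integrable2B; exact: L2_int.
  move=> phi tphi; have [_ [_ [_ [cphi _]]]] := tphi.
  have Lphi : L2 phi.
    split; first exact: continuous_measurable_fun2.
    apply: (@continuous_integrable2 _ (fun z t => phi z t ^+ 2)).
    move=> p; apply: (@cvg_comp _ _ _ _ (fun y => y ^+ 2) _ (nbhs (phi p.1 p.2))).
      exact: cphi.
    exact: exprn_continuous.
  have -> : I2 (fun z t => (g z t - g' z t) * phi z t) =
      I2 (fun z t => g z t * phi z t - g' z t * phi z t).
    by apply: eq_I2 => z t _ _; ring.
  by rewrite I2B; [rewrite E// subrr|exact: L2M|exact: L2M].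
have H1 i : ae2 (fun z t => G.1 z t i - G'.1 z t i = 0).
  have [_ L1 _ w1 _] := weak_gradP mG i; have [_ L1' _ w1' _] := weak_gradP mG' i.
  apply: (eq0 (fun z t => G.1 z t i) (fun z t => G'.1 z t i) ) => // phi tphi.
  by apply: oppr_inj; rewrite -w1// -w1'.
have H2 i : ae2 (fun z t => G.2 z t i - G'.2 z t i = 0).
  have [_ _ L1 _ w1] := weak_gradP mG i; have [_ _ L1' _ w1'] := weak_gradP mG' i.
  apply: (eq0 (fun z t => G.2 z t i) (fun z t => G'.2 z t i) ) => // phi tphi.
  by apply: oppr_inj; rewrite -w1// -w1'.
have all3 (P : 'I_3 -> R -> R -> Prop) : (forall i, ae2 (P i)) ->
    ae2 (fun z t => forall i, P i z t).
  move=> HP; apply: filterS3 (HP i0) (HP i1) (HP i2) => p P0 P1 P2 Dp [[|[|[|//]]] Hi].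
  - by rewrite (_ : Ordinal Hi = i0); [exact: P0|exact: val_inj].
  - by rewrite (_ : Ordinal Hi = i1); [exact: P1|exact: val_inj].
  - by rewrite (_ : Ordinal Hi = i2); [exact: P2|exact: val_inj].
apply: filterS2 (all3 _ H1) (all3 _ H2) => p E1 E2 Dp.
by split; apply/funext => i; apply/eqP; rewrite -subr_eq0; apply/eqP; [exact: E1|exact: E2].
Qed.

End weak_gradients.

(** * Calibrations on circles *)

Section pointwise.
Variable R : realFieldType.
Implicit Types u v w a b c x z : R.

Let bernstein_ge0 n k x : 0 <= x <= 1 -> 0 <= x ^+ n * (1 - x) ^+ k.
Proof. by move=> /andP[x0 x1]; rewrite mulr_ge0// exprn_ge0// subr_ge0. Qed.

(* The two bounds below hold with nonnegative coefficients in the Bernstein basis. *)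
Let p1_ge0 x : 0 <= x <= 1 ->
  0 <= 99 / 100 * (3 - 1 / 100) - x * (4 - 13 / 3 * x + 2 * x ^+ 2) ^+ 2.
Proof.
move=> x01.
have := bernstein_ge0 0 7 x01; have := bernstein_ge0 1 6 x01.
have := bernstein_ge0 2 5 x01; have := bernstein_ge0 3 4 x01.
have := bernstein_ge0 4 3 x01; have := bernstein_ge0 5 2 x01.
have := bernstein_ge0 6 1 x01; have := bernstein_ge0 7 0 x01.
lra.
Qed.

Let p2_ge0 x : 0 <= x <= 1 ->
  0 <= 99 / 100 * (2 + x - 1 / 100) - x * (2 - 2 / 3 * x + x ^+ 2 / 3) ^+ 2.
Proof.
move=> x01.
have := bernstein_ge0 0 5 x01; have := bernstein_ge0 1 4 x01.
have := bernstein_ge0 2 3 x01; have := bernstein_ge0 3 2 x01.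
have := bernstein_ge0 4 1 x01; have := bernstein_ge0 5 0 x01.
lra.
Qed.

(* The inequality is affine in z, so it follows from the cases z = 0 and z = 1 - x. *)
Let calibration_norm x z : 0 <= x -> 0 <= z -> x + z <= 1 ->
  x * ((2 - 2 / 3 * x + x ^+ 2 / 3) ^+ 2 +
       (1 - x - z) * (x * (2 - 5 / 3 * x) ^+ 2 - (2 - 8 / 3 * x + 2 * x ^+ 2) ^+ 2))
  <= 99 / 100 * (3 * x + 2 * z - (x + z) / 100).
Proof.
move=> x0 z0 xz; rewrite -subr_ge0; set G := (X in 0 <= X).
have x1 : x <= 1 by lra.
have := p1_ge0 (x := x); rewrite x0 x1 => /(_ isT).
have := p2_ge0 (x := x); rewrite x0 x1 => /(_ isT).
set P2 := (X in 0 <= X -> _); set P1 := (X in _ -> 0 <= X -> _) => hP2 hP1.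
(* [x * P1] is the value of G at z = 0 and [P2] its value at z = 1 - x. *)
have GE : (1 - x) * G = (1 - x - z) * (x * P1) + z * P2.
  by rewrite /G /P1 /P2; field.
have G1 : 0 <= (1 - x) * G.
  by rewrite GE addr_ge0// ?mulr_ge0//; lra.
(* Division by 1 - x excludes the point x = 1, where z = 0 and the inequality is numerical. *)
move: x1; rewrite le_eqVlt => /predU1P[xE|x1]; last first.
  by rewrite pmulr_rge0 in G1 => //; lra.
have zE : z = 0 by lra.
by rewrite /G xE zE; lra.
Qed.

(* The last two lines are the derivative, on the sphere, of 2uvq - (u^2+v^2+w^2-1) kap.
   On the circle w = 0, u = cos th, v = sin th, the one-form 2(u dv - v du) + 2 d(uvq) is
   2 v^2 (4 - 13/3 v^2 + 2 v^4) d th, whose coefficient is less than 2 sqrt 3 |v|; this is what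
   3 v^2 in the potential can absorb. The term in kap removes the component of the form normal
   to the sphere. *)
Lemma calibration_ge u v w a b c x q kap : u ^+ 2 + v ^+ 2 + w ^+ 2 = 1 ->
  x = v ^+ 2 -> q = - 1 + 2 / 3 * x - x ^+ 2 / 3 ->
  kap = u * v * (- 2 + 8 / 3 * x - 2 * x ^+ 2) ->
  (a ^+ 2 + b ^+ 2 + c ^+ 2 + v ^+ 2 + w ^+ 2) / 100 <=
  a ^+ 2 + b ^+ 2 + c ^+ 2 + 2 * (u * b - v * a) + 3 * v ^+ 2 + 2 * w ^+ 2
  + 2 * (a * v * q + u * b * q + u * v * (2 * v * b * (2 / 3 - 2 / 3 * x)))
  - 2 * kap * (u * a + v * b + w * c).
Proof.
move=> sph xE qE kE.
have yE : u ^+ 2 = 1 - x - w ^+ 2 by rewrite xE; lra.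
(* (A, B, C) is half the coefficient vector of (a, b, c) in the part of the density linear in the
   derivatives. With 1/100 of the quadratic part kept in reserve, nonnegativity amounts to |(A, B,
   C)|^2 <= 99/100 times the reduced potential. *)
pose A := - v + v * q - kap * u.
pose B := u + u * q + u * (2 * x) * (2 / 3 - 2 / 3 * x) - kap * v.
pose C := - kap * w.
have x0 : 0 <= x by rewrite xE sqr_ge0.
have z0 : 0 <= w ^+ 2 by exact: sqr_ge0.
have u0 : 0 <= u ^+ 2 by exact: sqr_ge0.
have xz : x + w ^+ 2 <= 1 by lra.
have := calibration_norm x0 z0 xz; rewrite -yE.
set N := (X in X <= _) => hN.
have NE : A ^+ 2 + B ^+ 2 + C ^+ 2 = N.
  have -> : A ^+ 2 + B ^+ 2 + C ^+ 2 =
      N + x * u ^+ 2 * (2 - 8 / 3 * x + 2 * x ^+ 2) ^+ 2 * (u ^+ 2 + v ^+ 2 + w ^+ 2 - 1).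
    by rewrite /A /B /C /N kE qE xE; field.
  by rewrite sph subrr mulr0 addr0.
(* 99/100 is the coefficient left in front of a^2 + b^2 + c^2; multiplying by it completes the
   squares without fractions. *)
rewrite -subr_ge0 -(@pmulr_rge0 _ (99 / 100)); last by lra.
rewrite [X in 0 <= X](_ : _ = (99 / 100 * a + A) ^+ 2 + (99 / 100 * b + B) ^+ 2 + (99 / 100 * c + C) ^+ 2
  + (99 / 100 * (3 * x + 2 * w ^+ 2 - (x + w ^+ 2) / 100) - (A ^+ 2 + B ^+ 2 + C ^+ 2))).
  rewrite NE; apply: addr_ge0; last by rewrite subr_ge0.
  by apply: addr_ge0; [apply: addr_ge0|]; exact: sqr_ge0.
by rewrite /A /B /C kE qE xE; field.
Qed.

(* The null Lagrangian is here the derivative of -2uv + 2uv(u^2+v^2+w^2-1). *)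
Lemma local_calibration_ge (k u v w a b c : R) : 1 <= k -> u ^+ 2 + v ^+ 2 + w ^+ 2 = 1 ->
  v ^+ 2 + w ^+ 2 <= 1 / 4 ->
  0 <= a ^+ 2 + b ^+ 2 + c ^+ 2 + 2 * (u * b - v * a) + k * v ^+ 2 + (k - 1) * w ^+ 2
    - 2 * (a * v + u * b) + 4 * (u * v) * (u * a + v * b + w * c).
Proof.
move=> k1 sph s4.
pose s := v ^+ 2 + w ^+ 2.
(* Besides the squares there remains (k - 1)(v^2 + w^2) + v^2 (1 - 4 s), whence the threshold 1/4 on
   s. *)
have v0 := sqr_ge0 v; have w0 := sqr_ge0 w.
rewrite [X in 0 <= X](_ : _ = (a - 2 * v * s) ^+ 2 + (b + 2 * u * v ^+ 2) ^+ 2 + (c + 2 * u * v * w) ^+ 2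
   + (k * v ^+ 2 + (k - 1) * w ^+ 2 - 4 * v ^+ 2 * s)).
  apply: addr_ge0; first by apply: addr_ge0; [apply: addr_ge0|]; exact: sqr_ge0.
  have : 0 <= (k - 1) * v ^+ 2 by apply: mulr_ge0; lra.
  have : 0 <= (k - 1) * w ^+ 2 by apply: mulr_ge0; lra.
  have : 0 <= v ^+ 2 * (1 - 4 * s) by apply: mulr_ge0 => //; rewrite /s; lra.
  by lra.
have uE : u ^+ 2 = 1 - s by rewrite /s; lra.
have -> : 4 * (u * v) * (u * a + v * b + w * c) =
   4 * v * a * u ^+ 2 + 4 * u * v * (v * b + w * c) by ring.
rewrite (_ : (b + _) ^+ 2 = b ^+ 2 + 4 * b * u * v ^+ 2 + 4 * u ^+ 2 * v ^+ 4); last by ring.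
rewrite (_ : (c + _) ^+ 2 = c ^+ 2 + 4 * c * u * v * w + 4 * u ^+ 2 * v ^+ 2 * w ^+ 2); last by ring.
by rewrite uE /s; ring.
Qed.

End pointwise.

(** * Energy inequalities on a single circle *)

Section slice_inequalities.
Variable R : realType.
Local Notation mu := (@lebesgue_measure R).
Local Notation B := (`[- pi, pi]%classic : set (measurableTypeR R)).
Let Npipi : - pi < pi :> R. Proof. by have := pi_gt0 R; lra. Qed.
Let mB : measurable B. Proof. by []. Qed.

Variables u v w du dv dw : R -> R.
Hypotheses (pu : primitive (- pi) pi u du) (pv : primitive (- pi) pi v dv)
  (pw : primitive (- pi) pi w dw).
Hypotheses (eu : u pi = u (- pi)) (ev : v pi = v (- pi)) (ew : w pi = w (- pi)).
Hypothesis sph : {ae mu, forall t, B t -> u t ^+ 2 + v t ^+ 2 + w t ^+ 2 = 1}.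

Let d2 t := du t ^+ 2 + dv t ^+ 2 + dw t ^+ 2.
Let s2 t := v t ^+ 2 + w t ^+ 2.
Definition slice_energy (k : R) t :=
  d2 t + 2 * (u t * dv t - v t * du t) + k * v t ^+ 2 + (k - 1) * w t ^+ 2.

Hypothesis id2 : mu.-integrable B (EFin \o d2).

Lemma primitive_integrableM (F f G g : R -> R) : primitive (- pi) pi F f ->
  primitive (- pi) pi G g -> mu.-integrable B (EFin \o (fun t => F t * g t)).
Proof.
move=> pF [intg _]; have [C FC] := primitive_bounded pF.
have := integrable_boundedM mB intg (primitive_measurable Npipi pF) FC.
by apply: (eq_integrableR mB) => t _; rewrite mulrC.
Qed.

Lemma primitive_integrable_self (F f : R -> R) : primitive (- pi) pi F f ->
  mu.-integrable B (EFin \o F).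
Proof.
move=> pF; have [C FC] := primitive_bounded pF.
have i1 := continuous_integrable_itv (- pi) pi (@continuous_cst1 R).
have := integrable_boundedM mB i1 (primitive_measurable Npipi pF) FC.
by apply: (eq_integrableR mB) => t _; rewrite mul1r.
Qed.

Let is2 : mu.-integrable B (EFin \o s2).
Proof.
have := primitive_integrable_self (primitiveD (primitiveM Npipi pv pv) (primitiveM Npipi pw pw)).
by apply: (eq_integrableR mB).
Qed.

Lemma slice_energy_integrable k : mu.-integrable B (EFin \o slice_energy k).
Proof.
have iv := primitive_integrable_self (primitiveM Npipi pv pv).
have iw := primitive_integrable_self (primitiveM Npipi pw pw).
have i1 := primitive_integrableM pu pv; have i2 := primitive_integrableM pv pu.
have := integrableRD mB (integrableRD mB id2 (integrableRZ mB 2 (integrableRB mB i1 i2)))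
  (integrableRD mB (integrableRZ mB k iv) (integrableRZ mB (k - 1) iw)).
by apply: (eq_integrableR mB) => t _; rewrite /slice_energy; ring.
Qed.

(** The density of a periodic primitive has zero integral, so it may be added before comparing
    pointwise. *)
Let add_null (F f g h : R -> R) : primitive (- pi) pi F f -> F pi = F (- pi) ->
  mu.-integrable B (EFin \o g) -> mu.-integrable B (EFin \o h) ->
  {ae mu, forall t, B t -> g t <= h t + f t} ->
  \int[mu]_(t in B) g t <= \int[mu]_(t in B) h t.
Proof.
move=> pF eF ig ih gh; have [if_ _] := pF.
have := ae_le_Rintegral mB ig (integrableRD mB ih if_) gh.
by rewrite RintegralD// (primitive_total Npipi pF) eF subrr addr0.
Qed.

Lemma slice_global :
  (\int[mu]_(t in B) (d2 t + s2 t)) / 100 <= \int[mu]_(t in B) slice_energy 3 t.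
Proof.
have aeF := ae_filter_ringOfSetsType mu.
have pM F f G g := @primitiveM R _ _ Npipi F f G g.
have pc c := primitive_cst (- pi) (pi : R) c.
have px := pM _ _ _ _ pv pv.
have puv := pM _ _ _ _ pu pv.
have pq := primitiveD (primitiveD (pc (- 1)) (primitiveZ (2 / 3) px))
  (primitiveZ (- (1 / 3)) (pM _ _ _ _ px px)).
have puvq := pM _ _ _ _ puv pq.
have pk := pM _ _ _ _ puv (primitiveD (primitiveD (pc (- 2)) (primitiveZ (8 / 3) px))
  (primitiveZ (- 2) (pM _ _ _ _ px px))).
(* [ps] is the primitive u^2 + v^2 + w^2 - 1. Subtracting the derivative of its product with kap
   ([pk]) uses the constraint without first proving u u' + v v' + w w' = 0 almost everywhere. *)
have ps := primitiveD (primitiveD (primitiveD (pM _ _ _ _ pu pu) px) (pM _ _ _ _ pw pw)) (pc (- 1)).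
have pPhi := primitiveD (primitiveZ 2 puvq) (primitiveZ (- 1) (pM _ _ _ _ ps pk)).
rewrite mulrC -RintegralZl//; last exact: integrableRD.
apply: (add_null pPhi).
- by rewrite /= eu ev ew.
- by apply: integrableRZ => //; exact: integrableRD.
- exact: slice_energy_integrable.
apply: filterS sph => t + Bt => /(_ Bt) st.
have := calibration_ge (du t) (dv t) (dw t) st erefl erefl erefl.
rewrite /= -subr_ge0 => h; rewrite -subr_ge0 /slice_energy /d2 /s2.
have {}st : u t ^+ 2 + v t ^+ 2 + w t ^+ 2 - 1 = 0 by rewrite st subrr.
(* The product rule also differentiates kap; that term [kd] is multiplied by u^2 + v^2 + w^2 - 1,
   which vanishes almost everywhere. *)
match type of st with ?S = 0 => match goal with |- is_true (0 <= ?X) =>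
  match type of h with is_true (0 <= ?Y) =>
  pose kd := (du t * v t + u t * dv t) * (- 2 + 8 / 3 * v t ^+ 2 - 2 * v t ^+ 4)
    + u t * v t * (2 * v t * dv t * (8 / 3 - 4 * v t ^+ 2));
  have -> : X = Y - S * kd end end end.
  by rewrite /kd; field.
by rewrite st mul0r subr0.
Qed.

Lemma slice_local k : 1 < k -> \int[mu]_(t in B) s2 t <= 1 / 72 ->
  0 <= \int[mu]_(t in B) slice_energy k t.
Proof.
move=> k1 b72.
have aeF := ae_filter_ringOfSetsType mu.
have pM F f G g := @primitiveM R _ _ Npipi F f G g.
have puv := pM _ _ _ _ pu pv.
have pm2 := primitiveZ (- 2) puv.
(* If the Dirichlet part does not dominate, the mean value estimate gives v^2 + w^2 <= 18/72
   everywhere, and the local calibration applies. *)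
have [big|small] := leP (16 * \int[mu]_(t in B) s2 t) (\int[mu]_(t in B) d2 t).
  apply: (@le_trans _ _ (\int[mu]_(t in B) (1 / 2 * d2 t - 8 * s2 t))).
    rewrite RintegralB//; [|exact: integrableRZ|exact: integrableRZ].
    rewrite !RintegralZl//; clear b72; move: big.
    by move: (Rintegral _ _ _) (Rintegral _ _ _) => x y; lra.
  (* Adding the derivative of -2uv turns the cross term into -4 v u', which is absorbed by half of
     u'^2 and 8 v^2. *)
  apply: (add_null pm2).
  - by rewrite /= eu ev.
  - by apply: integrableRB => //; exact: integrableRZ.
  - exact: slice_energy_integrable.
  clear b72 big; apply: aeW => t _; rewrite /slice_energy /d2 /s2.
  have : 0 <= (1 / 2) * (du t - 4 * v t) ^+ 2 by apply: mulr_ge0; [lra|exact: sqr_ge0].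
  have := sqr_ge0 (dv t); have := sqr_ge0 (dw t).
  have : 0 <= k * v t ^+ 2 by apply: mulr_ge0; [lra|exact: sqr_ge0].
  have : 0 <= (k - 1) * w t ^+ 2 by apply: mulr_ge0; [lra|exact: sqr_ge0].
  have := sqr_ge0 (w t).
  by nra.
have ps2 := primitiveD (pM _ _ _ _ pv pv) (pM _ _ _ _ pw pw).
have sup t : B t -> s2 t <= 1 / 4.
  move=> Bt; have tpi : - pi <= t <= pi by move: Bt; rewrite /= in_itv.
  have := primitive_le_mean Npipi ps2 tpi.
  set I1 := Rintegral _ _ _; set I2 := Rintegral _ _ _ => H.
  have I1E : I1 = \int[mu]_(t in B) s2 t by apply: eq_Rintegral.
  have I2E : I2 <= \int[mu]_(t in B) (d2 t + s2 t).
    apply: le_Rintegral => //.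
    - by apply: integrable_norm; have [] := ps2.
    - exact: integrableRD.
    move=> x _; rewrite /d2 /s2 ler_norml; apply/andP; split.
      have := sqr_ge0 (v x + dv x); have := sqr_ge0 (w x + dw x); have := sqr_ge0 (du x).
      by clear b72 small H; nra.
    have := sqr_ge0 (v x - dv x); have := sqr_ge0 (w x - dw x); have := sqr_ge0 (du x).
    by clear b72 small H; nra.
  rewrite RintegralD// in I2E.
  have pi1 : 1 <= pi :> R by move: (pihalf_ge1 R); clear b72 small H I2E; lra.
  have s2E : s2 t = v t * v t + w t * w t by rewrite /s2; clear b72; ring.
  rewrite -s2E I1E in H.
  have b0 : 0 <= \int[mu]_(t in B) s2 t.
    by apply: Rintegral_ge0 => x _; rewrite /s2 addr_ge0 ?sqr_ge0.
  move: H I2E small b72 b0 pi1.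
  move: (\int[mu]_(t in B) s2 t) (\int[mu]_(t in B) d2 t) I2 => b d I2 H I2E small b72 b0 pi1.
  (* 17 = 16 + 1 comes from |2 v v' + 2 w w'| <= |D|^2 + v^2 + w^2. The mean itself is absorbed
     through 1 <= 2 pi and gives 18, and 18/72 = 1/4. *)
  have H2 : (pi - - pi) * I2 <= (pi - - pi) * (17 * b) by apply: ler_wpM2l; lra.
  have H3 : (pi - - pi) * s2 t <= (pi - - pi) * (18 * b).
    apply: le_trans H _; apply: (@le_trans _ _ (b + (pi - - pi) * (17 * b))); first by rewrite lerD2l.
    have : 1 * b <= (pi - - pi) * b by apply: ler_wpM2r => //; lra.
    by lra.
  rewrite ler_pM2l in H3; lra.
have ps := primitiveD (primitiveD (pM _ _ _ _ pu pu) ps2) (primitive_cst (- pi) (pi : R) (- 1)).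
have pPhi := primitiveD pm2 (primitiveZ 2 (pM _ _ _ _ ps puv)).
rewrite -[leLHS](_ : \int[mu]_(t in B) 0 = 0); last by rewrite Rintegral_cst// mul0r.
apply: (add_null pPhi).
- by rewrite /= eu ev ew.
- by apply: continuous_integrable_itv => x; exact: cvg_cst.
- exact: slice_energy_integrable.
apply: filterS sph => t + Bt => /(_ Bt) st.
have := local_calibration_ge (du t) (dv t) (dw t) (ltW k1) st (sup t Bt).
move=> h; rewrite /slice_energy /d2.
have {}st : u t ^+ 2 + v t ^+ 2 + w t ^+ 2 - 1 = 0 by rewrite st subrr.
match type of st with ?S = 0 => match goal with |- is_true (0 <= ?X) =>
  match type of h with is_true (0 <= ?Y) =>
  have -> : X = Y + S * (2 * (du t * v t + u t * dv t)) end end end.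
  by ring.
by rewrite st mul0r addr0.
Qed.

End slice_inequalities.

(** * The moving frame and minimality *)

Section vector_fields.
Variable R : realType.
Local Notation mu := (@lebesgue_measure R).
Local Notation A := (`[- 1, 1]%classic : set (measurableTypeR R)).
Local Notation B := (`[- pi, pi]%classic : set (measurableTypeR R)).
Implicit Types (X Y : field R).

Lemma dotE (u v : vec R) : dot u v = u i0 * v i0 + u i1 * v i1 + u i2 * v i2.
Proof.
rewrite /dot !big_ord_recl big_ord0 addr0 addrA.
by congr (_ * _ + _ * _ + _ * _); congr (_ _); exact: val_inj.
Qed.

Lemma ord3P (P : 'I_3 -> Prop) : P i0 -> P i1 -> P i2 -> forall i, P i.
Proof.
move=> P0 P1 P2 [[|[|[|//]]] Hi].
- by rewrite (_ : Ordinal Hi = i0)//; exact: val_inj.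
- by rewrite (_ : Ordinal Hi = i1)//; exact: val_inj.
- by rewrite (_ : Ordinal Hi = i2)//; exact: val_inj.
Qed.

Lemma measurable2D (f g : sfield R) : measurable2 f -> measurable2 g -> measurable2 (fun z t => f z t + g z t).
Proof. exact: measurable_funD. Qed.
Lemma measurable2B (f g : sfield R) : measurable2 f -> measurable2 g -> measurable2 (fun z t => f z t - g z t).
Proof. exact: measurable_funB. Qed.
Lemma measurable2M (f g : sfield R) : measurable2 f -> measurable2 g -> measurable2 (fun z t => f z t * g z t).
Proof. exact: measurable_funM. Qed.
Lemma measurable2_cst (c : R) : measurable2 (fun _ _ => c).
Proof. exact: measurable_cst. Qed.

Lemma measurable2X (f : sfield R) n : measurable2 f -> measurable2 (fun z t => f z t ^+ n).
Proof. exact: measurable_funX. Qed.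

Lemma eq_measurable2 (f g : sfield R) : (forall z t, f z t = g z t) -> measurable2 f -> measurable2 g.
Proof. by move=> fg; apply: eq_measurable_fun => p _; exact: fg. Qed.

Lemma measurable2_dot X Y : (forall i, measurable2 (fun z t => X z t i)) -> (forall i, measurable2 (fun z t => Y z t i)) ->
  measurable2 (fun z t => dot (X z t) (Y z t)).
Proof.
move=> mX mY.
have := measurable2D (measurable2D (measurable2M (mX i0) (mY i0)) (measurable2M (mX i1) (mY i1))) (measurable2M (mX i2) (mY i2)).
by apply: eq_measurable2 => z t; rewrite dotE.
Qed.

Lemma integrable2_dot X Y : (forall i, L2 (fun z t => X z t i)) -> (forall i, L2 (fun z t => Y z t i)) ->
  integrable2 (fun z t => dot (X z t) (Y z t)).
Proof.
move=> mX mY.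
have := integrable2D (integrable2D (L2M (mX i0) (mY i0)) (L2M (mX i1) (mY i1))) (L2M (mX i2) (mY i2)).
by apply: eq_integrable2 => z t _ _; rewrite dotE.
Qed.

Lemma L2_rotate (f g : sfield R) (a b : R -> R) : L2 f -> L2 g -> continuous a -> continuous b ->
  L2 (fun z t => f z t * a t + g z t * b t).
Proof.
move=> Lf Lg ca cb; apply: L2D; apply: L2_boundedM => //;
  by [exact: measurable2_t (continuous_measurable_fun _)|exact: bounded2_t].
Qed.

Lemma I2_le (f g : sfield R) : integrable2 f -> integrable2 g -> ae2 (fun z t => f z t <= g z t) ->
  I2 f <= I2 g.
Proof.
move=> intf intg fg.
exact: (@ae_le_Rintegral _ _ _ _ _ (@measurable_Dom R) (fun p => f p.1 p.2) (fun p => g p.1 p.2)).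
Qed.

Lemma I2_ge0 (f : sfield R) : measurable2 f -> ae2 (fun z t => 0 <= f z t) -> 0 <= I2 f.
Proof.
move=> mf f0.
apply: (@ae_Rintegral_ge0 _ _ _ _ _ (@measurable_Dom R) (fun p => f p.1 p.2)) => //.
exact: measurable_funTS mf.
Qed.

Lemma I2_eq0_ae (f : sfield R) : integrable2 f -> ae2 (fun z t => 0 <= f z t) -> I2 f <= 0 ->
  ae2 (fun z t => f z t = 0).
Proof.
move=> intf f0 if0.
exact: (@ae_Rintegral_eq0 _ _ _ _ _ (@measurable_Dom R) (fun p => f p.1 p.2)).
Qed.

Lemma I2_section_ge0 (f : sfield R) : integrable2 f ->
  {ae mu, forall z, A z -> 0 <= \int[mu]_(t in B) f z t} -> 0 <= I2 f.
Proof.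
move=> intf f0; rewrite I2_iterated//.
have mA : measurable A by [].
by apply: (ae_Rintegral_ge0 mA) => //; exact: integrableRmeas (integrable_section intf).
Qed.

Lemma I2_cst1 : I2 (fun _ _ : R => 1 : R) = 4 * pi.
Proof.
have Npipi : - pi < pi :> R by have := pi_gt0 R; lra.
have N11 : - 1 < 1 :> R by lra.
rewrite I2_iterated; last first.
  by apply: bounded_integrable2; [exact: measurable2_cst|exists 1 => z t _ _; rewrite normr1].
rewrite Rintegral_cst// Rintegral_cst//= !lebesgue_measure_itv/= !lte_fin Npipi N11 -!EFinB/=.
ring.
Qed.

Lemma continuous_Nsin : continuous (fun t : R => - sin t).
Proof. by move=> t; apply: cvgN; exact: continuous_sin. Qed.

End vector_fields.

(** * Components in the moving frame and the form of the energy *)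

Section frame.
Variable R : realType.
Local Notation mu := (@lebesgue_measure R).
Local Notation A := (`[- 1, 1]%classic : set (measurableTypeR R)).
Local Notation B := (`[- pi, pi]%classic : set (measurableTypeR R)).
Let Npipi : - pi < pi :> R. Proof. by have := pi_gt0 R; lra. Qed.
Let mA : measurable A. Proof. by []. Qed.
Let mB : measurable B. Proof. by []. Qed.

Variables (m : field R) (G : field R * field R).
Hypothesis mG : weak_grad m G.
Hypothesis sph : ae2 (fun z t => dot (m z t) (m z t) = 1).

(* Components of m and of its t-derivative in the moving frame (n, n', e3); since n'' = - n,
   the derivatives of the components differ from the components of the derivative. *)
Definition frU : sfield R := fun z t => m z t i0 * cos t + m z t i1 * sin t.
Definition frV : sfield R := fun z t => m z t i0 * - sin t + m z t i1 * cos t.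
Definition frW : sfield R := fun z t => m z t i2.
Definition frDU : sfield R := fun z t => G.2 z t i0 * cos t + G.2 z t i1 * sin t + frV z t.
Definition frDV : sfield R := fun z t => G.2 z t i0 * - sin t + G.2 z t i1 * cos t - frU z t.
Definition frDW : sfield R := fun z t => G.2 z t i2.
Definition frD2 : sfield R := fun z t => frDU z t ^+ 2 + frDV z t ^+ 2 + frDW z t ^+ 2.
Definition frS2 : sfield R := fun z t => frV z t ^+ 2 + frW z t ^+ 2.
Definition frE (k : R) : sfield R := fun z t =>
  slice_energy (frU z) (frV z) (frW z) (frDU z) (frDV z) (frDW z) k t.

Let Lm i : L2 (fun z t => m z t i). Proof. by have [] := weak_gradP mG i. Qed.
Let LG1 i : L2 (fun z t => G.1 z t i). Proof. by have [] := weak_gradP mG i. Qed.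
Let LG2 i : L2 (fun z t => G.2 z t i). Proof. by have [] := weak_gradP mG i. Qed.

Lemma L2_frU : L2 frU.
Proof. by apply: L2_rotate => //; [exact: continuous_cos|exact: continuous_sin]. Qed.
Lemma L2_frV : L2 frV.
Proof. by apply: L2_rotate => //; [exact: continuous_Nsin|exact: continuous_cos]. Qed.

Let L2N (f : sfield R) : L2 f -> L2 (fun z t => - f z t).
Proof.
move=> Lf; have L1 : bounded2 (fun _ _ : R => - 1 : R) by exists 1 => *; rewrite normrN normr1.
have := L2_boundedM Lf (measurable2_cst (- 1)) L1.
rewrite (_ : (fun z t => _) = (fun z t => - f z t))//.
by apply/funext => z; apply/funext => t; rewrite mulrN1.
Qed.

Lemma L2_frDU : L2 frDU.
Proof.
apply: L2D; last exact: L2_frV.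
by apply: L2_rotate => //; [exact: continuous_cos|exact: continuous_sin].
Qed.
Lemma L2_frDV : L2 frDV.
Proof.
apply: L2D; last exact: L2N L2_frU.
by apply: L2_rotate => //; [exact: continuous_Nsin|exact: continuous_cos].
Qed.

Lemma integrable2_frD2 : integrable2 frD2.
Proof.
exact: integrable2D (integrable2D (L2M L2_frDU L2_frDU) (L2M L2_frDV L2_frDV)) (L2M (LG2 i2) (LG2 i2)).
Qed.

Lemma integrable2_frS2 : integrable2 frS2.
Proof. exact: integrable2D (L2M L2_frV L2_frV) (L2M (Lm i2) (Lm i2)). Qed.

Lemma integrable2_frE k : integrable2 (frE k).
Proof.
have i1 := L2M L2_frU L2_frDV; have i2' := L2M L2_frV L2_frDU.
have := integrable2D (integrable2D integrable2_frD2 (integrable2Z 2 (integrable2B i1 i2')))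
  (integrable2D (integrable2Z k (L2M L2_frV L2_frV)) (integrable2Z (k - 1) (L2M (Lm i2) (Lm i2)))).
by apply: eq_integrable2 => z t _ _; rewrite /frE /slice_energy /frD2 /frW; ring.
Qed.

Lemma frame_sphere : ae2 (fun z t => frU z t ^+ 2 + frV z t ^+ 2 + frW z t ^+ 2 = 1).
Proof.
have aeF2 := ae_filter_ringOfSetsType (mu \x mu)%E.
apply: filterS sph => p + Dp => /(_ Dp) <-; rewrite dotE /frU /frV /frW.
transitivity ((cos p.2 ^+ 2 + sin p.2 ^+ 2) * (m p.1 p.2 i0 ^+ 2 + m p.1 p.2 i1 ^+ 2) + m p.1 p.2 i2 ^+ 2).
  by ring.
by rewrite cos2Dsin2; ring.
Qed.

(** On almost every circle the Cartesian components have absolutely continuous periodic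
    representatives. Rotating these by the smooth functions cos and sin gives the frame components,
    and the product rule gives their densities; u, v, w agree with the components of m for almost
    every t only. *)
Lemma frame_slices : {ae mu, forall z, A z -> exists u v w du dv dw : R -> R,
  [/\ [/\ primitive (- pi) pi u du, primitive (- pi) pi v dv & primitive (- pi) pi w dw],
      [/\ u pi = u (- pi), v pi = v (- pi) & w pi = w (- pi)],
      {ae mu, forall t, B t -> [/\ u t = frU z t, v t = frV z t & w t = frW z t]} /\
      {ae mu, forall t, B t -> [/\ du t = frDU z t, dv t = frDV z t & dw t = frDW z t]},
      {ae mu, forall t, B t -> u t ^+ 2 + v t ^+ 2 + w t ^+ 2 = 1} &
      mu.-integrable B (EFin \o (fun t => du t ^+ 2 + dv t ^+ 2 + dw t ^+ 2))]}.
Proof.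
have aeF := ae_filter_ringOfSetsType mu.
have pF i : {ae mu, forall z, A z -> exists F : R -> R,
    [/\ primitive (- pi) pi F (fun t => G.2 z t i), F pi = F (- pi) &
        {ae mu, forall t, B t -> m z t i = F t}]}.
  have [_ _ _ _ wt] := weak_gradP mG i.
  exact: weak_dt_primitive (L2_int (Lm i)) (L2_int (LG2 i)) wt.
have sp := ae2_section frame_sphere.
have iD2 := ae_section_integrable integrable2_frD2.
have pFall : {ae mu, forall z, forall i : 'I_3, A z -> exists F : R -> R,
    [/\ primitive (- pi) pi F (fun t => G.2 z t i), F pi = F (- pi) &
        {ae mu, forall t, B t -> m z t i = F t}]}.
  exact: ae_forall_countable.
apply: filterS3 pFall sp iD2 => z HF Hs HD Az.
have [F0 [p0 e0 f0]] := HF i0 Az; have [F1 [p1 e1 f1]] := HF i1 Az.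
have [F2 [p2 e2 f2]] := HF i2 Az.
have cNs := @continuous_Nsin R.
have dNs (t : R) : is_derive t 1 (fun t => - sin t) (- cos t) by apply: is_derive_eq.
have cNc : continuous (fun t : R => - cos t) by move=> t; apply: cvgN; exact: continuous_cos.
have pcos := primitive_derive (- pi) pi (@is_derive_cos R) cNs.
have psin := primitive_derive (- pi) pi (@is_derive_sin R) (@continuous_cos R).
have pNsin := primitive_derive (- pi) pi dNs cNc.
pose u t := F0 t * cos t + F1 t * sin t.
pose v t := F0 t * - sin t + F1 t * cos t.
pose du t := G.2 z t i0 * cos t + G.2 z t i1 * sin t + v t.
pose dv t := G.2 z t i0 * - sin t + G.2 z t i1 * cos t - u t.
have pu : primitive (- pi) pi u du.
  apply: (eq_primitive Npipi _ _ (primitiveD (primitiveM Npipi p0 pcos) (primitiveM Npipi p1 psin))) => // t _.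
  by rewrite /du /v; ring.
have pv : primitive (- pi) pi v dv.
  apply: (eq_primitive Npipi _ _ (primitiveD (primitiveM Npipi p0 pNsin) (primitiveM Npipi p1 pcos))) => // t _.
  by rewrite /dv /u; ring.
have uvE : {ae mu, forall t, B t -> [/\ u t = frU z t, v t = frV z t & F2 t = frW z t]}.
  apply: filterS3 f0 f1 f2 => t f0 f1 f2 Bt.
  by rewrite /u /v /frU /frV /frW f0// f1// f2.
have dE : {ae mu, forall t, B t -> [/\ du t = frDU z t, dv t = frDV z t & G.2 z t i2 = frDW z t]}.
  apply: filterS uvE => t + Bt => /(_ Bt)[uE vE _].
  by rewrite /du /dv /frDU /frDV uE vE.
exists u, v, F2, du, dv, (fun t => G.2 z t i2); split => //.
- by rewrite /u /v e0 e1 e2 cosN sinN sinpi !oppr0.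
- apply: filterS2 uvE (Hs Az) => t + + Bt => /(_ Bt)[-> -> ->] /(_ Bt).
  by [].
- apply: (ae_eq_integrable mB _ _ (HD Az)).
    have mf (f : R -> R) F : primitive (- pi) pi F f -> measurable_fun B f.
      by move=> [/integrableRmeas].
    apply: measurable_funD; first apply: measurable_funD.
    + by apply: measurable_funX; exact: mf pu.
    + by apply: measurable_funX; exact: mf pv.
    + by apply: measurable_funX; exact: mf p2.
  by apply: filterS dE => t + Bt => /(_ Bt)[-> -> ->].
Qed.

Lemma frE_integral_ge0 k : {ae mu, forall z, A z -> 1 < k ->
  \int[mu]_(t in B) frS2 z t <= 1 / 72 -> 0 <= \int[mu]_(t in B) frE k z t}.
Proof.
have aeF := ae_filter_ringOfSetsType mu.
apply: filterS3 frame_slices (ae_section_integrable (integrable2_frE k)) (ae_section_integrable integrable2_frS2).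
move=> z Hz iE iS Az k1.
have [u [v [w [du [dv [dw [[pu pv pw] [eu ev ew] [uvE dE] sp id2]]]]]]] := Hz Az.
have mE := integrableRmeas (slice_energy_integrable pu pv pw id2 k).
have is2 : measurable_fun B (fun t => v t ^+ 2 + w t ^+ 2).
  by apply: measurable_funD; apply: measurable_funX;
    [exact: (primitive_measurable Npipi pv)|exact: (primitive_measurable Npipi pw)].
rewrite -(ae_eq_Rintegral mB is2 (integrableRmeas (iS Az))); last first.
  by apply: filterS uvE => t + Bt => /(_ Bt)[_ -> ->].
rewrite -(ae_eq_Rintegral mB mE (integrableRmeas (iE Az))); last first.
  apply: filterS2 uvE dE => t + + Bt => /(_ Bt)[uE vE wE] /(_ Bt)[duE dvE dwE].
  by rewrite /frE /slice_energy uE vE wE duE dvE dwE.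
exact: (slice_local pu pv pw).
Qed.

Lemma frE_global_section : {ae mu, forall z, A z ->
  (\int[mu]_(t in B) (frD2 z t + frS2 z t)) / 100 <= \int[mu]_(t in B) frE 3 z t}.
Proof.
have aeF := ae_filter_ringOfSetsType mu.
apply: filterS3 frame_slices (ae_section_integrable (integrable2_frE 3))
  (ae_section_integrable (integrable2D integrable2_frD2 integrable2_frS2)).
move=> z Hz iE iS Az.
have [u [v [w [du [dv [dw [[pu pv pw] [eu ev ew] [uvE dE] sp id2]]]]]]] := Hz Az.
have mE := integrableRmeas (slice_energy_integrable pu pv pw id2 3).
have is2 : measurable_fun B (fun t => v t ^+ 2 + w t ^+ 2).
  by apply: measurable_funD; apply: measurable_funX;
    [exact: (primitive_measurable Npipi pv)|exact: (primitive_measurable Npipi pw)].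
rewrite -(ae_eq_Rintegral mB (measurable_funD (integrableRmeas id2) is2) (integrableRmeas (iS Az))); last first.
  apply: filterS2 uvE dE => t + + Bt => /(_ Bt)[uE vE wE] /(_ Bt)[duE dvE dwE].
  by rewrite /= /frD2 /frS2 vE wE duE dvE dwE.
rewrite -(ae_eq_Rintegral mB mE (integrableRmeas (iE Az))); last first.
  apply: filterS2 uvE dE => t + + Bt => /(_ Bt)[uE vE wE] /(_ Bt)[duE dvE dwE].
  by rewrite /frE /slice_energy uE vE wE duE dvE dwE.
exact: (slice_global pu pv pw).
Qed.

Definition frZ2 : sfield R := fun z t => dot (G.1 z t) (G.1 z t).

Lemma integrable2_frZ2 : integrable2 frZ2.
Proof. exact: integrable2_dot. Qed.

Lemma cross_nfield (z t : R) :
  dot (cross (m z t) (cyl_nfield z t)) (cross (m z t) (cyl_nfield z t)) = frS2 z t.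
Proof.
rewrite dotE /cross /cyl_nfield /vec3 /= /frS2 /frV /frW.
transitivity (m z t i2 ^+ 2 * (cos t ^+ 2 + sin t ^+ 2) +
  (m z t i0 * sin t - m z t i1 * cos t) ^+ 2); first by ring.
by rewrite cos2Dsin2; ring.
Qed.

Lemma integrable2_cst (c : R) : integrable2 (fun _ _ => c).
Proof. by apply: bounded_integrable2; [exact: measurable2_cst|exists `|c|]. Qed.

(** Since n' is the second frame vector and n'' = - n, |m_t|^2 = |D|^2 + 2 (u v_t - v u_t) + u^2 +
    v^2. On the sphere u^2 + v^2 = 1 - w^2, which produces the coefficient k - 1 of w^2 and the area
    4 pi. *)
Lemma energyE k : energy k m G = I2 frZ2 + I2 (frE k) + 4 * pi.
Proof.
have aeF2 := ae_filter_ringOfSetsType (mu \x mu)%E.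
rewrite -I2_cst1 -I2D//; [|exact: integrable2_frZ2|exact: integrable2_frE].
rewrite -I2D; [|exact: integrable2D integrable2_frZ2 (integrable2_frE k)|exact: integrable2_cst].
rewrite /energy; apply: ae_eq_I2.
- have mS : measurable2 frS2.
    exact: (measurable2D (measurable2X 2 L2_frV.1) (measurable2X 2 (Lm i2).1)).
  have := measurable2D (measurable2D (measurable2_dot (fun i => (LG2 i).1) (fun i => (LG2 i).1))
    (measurable2_dot (fun i => (LG1 i).1) (fun i => (LG1 i).1))) (measurable2M (measurable2_cst k) mS).
  by apply: eq_measurable2 => z t; rewrite cross_nfield.
- have mD (f : sfield R) : L2 f -> measurable2 f by case.
  apply: measurable2D; last exact: measurable2_cst.
  apply: measurable2D; first exact: measurable2_dot (fun i => (LG1 i).1) (fun i => (LG1 i).1).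
  have mU := L2_frU.1; have mV := L2_frV.1; have mW := (Lm i2).1.
  have mDU := L2_frDU.1; have mDV := L2_frDV.1; have mDW := (LG2 i2).1.
  exact: (measurable2D (measurable2D (measurable2D (measurable2D (measurable2D (measurable2X 2 mDU) (measurable2X 2 mDV)) (measurable2X 2 mDW))
    (measurable2M (measurable2_cst 2) (measurable2B (measurable2M mU mDV) (measurable2M mV mDU)))) (measurable2M (measurable2_cst k) (measurable2X 2 mV)))
    (measurable2M (measurable2_cst (k - 1)) (measurable2X 2 mW))).
apply: filterS frame_sphere => p + Dp => /(_ Dp) sp.
rewrite cross_nfield /frZ2 -[in RHS]sp /frE /slice_energy /frS2 /frDU /frDV /frDW !dotE.
rewrite [G.2 p.1 p.2 i0 * _ + _](_ : _ = (cos p.2 ^+ 2 + sin p.2 ^+ 2) *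
  (G.2 p.1 p.2 i0 ^+ 2 + G.2 p.1 p.2 i1 ^+ 2)).
  by ring.
by rewrite cos2Dsin2; ring.
Qed.

End frame.

(** * The explicit fields and their gradients *)

Section constant_frames.
Variable R : realType.
Local Notation mu := (@lebesgue_measure R).
Local Notation A := (`[- 1, 1]%classic : set (measurableTypeR R)).
Local Notation B := (`[- pi, pi]%classic : set (measurableTypeR R)).
Let Npipi : - pi < pi :> R. Proof. by have := pi_gt0 R; lra. Qed.
Let mA : measurable A. Proof. by []. Qed.
Let mB : measurable B. Proof. by []. Qed.

(** A sign [sg] with sg^2 = 1 treats n and - n together. *)
Definition scaled_nfield (sg : R) : field R := fun _ t => vec3 (sg * cos t) (sg * sin t) 0.
Definition scaled_tangent (sg : R) : field R := fun _ t => vec3 (sg * - sin t) (sg * cos t) 0.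
Definition cst_field (a b c : R) : field R := fun _ _ => vec3 a b c.
Definition zero_field : field R := fun _ _ _ => 0.

Lemma nfieldE : @cyl_nfield R = scaled_nfield 1.
Proof.
apply/funext => z; apply/funext => t; apply/funext.
by apply: ord3P; rewrite /cyl_nfield /scaled_nfield /vec3 /= ?mul1r.
Qed.

Lemma oppnfieldE : cyl_oppf (@cyl_nfield R) = scaled_nfield (- 1).
Proof.
apply/funext => z; apply/funext => t; apply/funext.
by apply: ord3P; rewrite /cyl_oppf /cyl_nfield /scaled_nfield /vec3 /= ?mulN1r ?oppr0.
Qed.

Lemma e3fieldE : @cyl_e3field R = cst_field 0 0 1. Proof. by []. Qed.

Lemma oppe3fieldE : cyl_oppf (@cyl_e3field R) = cst_field 0 0 (- 1).
Proof.
apply/funext => z; apply/funext => t; apply/funext.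
by apply: ord3P; rewrite /cyl_oppf /cyl_e3field /cst_field /vec3 /= ?oppr0.
Qed.

Lemma weak_grad_cst_field a b c : weak_grad (cst_field a b c) (zero_field, zero_field).
Proof.
apply: (@weak_grad_smooth R (fun i t => vec3 a b c i) (fun i t => 0)) => //.
by move=> i; exact: cst_continuous.
Qed.

Lemma cos_per : per2pi (@cos R).
Proof. by move=> t; rewrite mulrC mulr_natr cosD2pi. Qed.

Lemma sin_per : per2pi (@sin R).
Proof. by move=> t; rewrite mulrC mulr_natr sinD2pi. Qed.

Lemma weak_grad_nfield sg : weak_grad (scaled_nfield sg) (zero_field, scaled_tangent sg).
Proof.
have dc (t : R) : is_derive t 1 (fun t => sg * cos t) (sg * - sin t).
  by apply: is_derive_eq; rewrite /GRing.scale/=; ring.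
have ds (t : R) : is_derive t 1 (fun t => sg * sin t) (sg * cos t).
  by apply: is_derive_eq; rewrite /GRing.scale/=; ring.
have cc : continuous (fun t : R => sg * cos t).
  by move=> t; apply: cvgM; [exact: cvg_cst|exact: continuous_cos].
have cs : continuous (fun t : R => sg * - sin t).
  by move=> t; apply: cvgM; [exact: cvg_cst|exact: continuous_Nsin].
apply: (@weak_grad_smooth R (fun i t => scaled_nfield sg 0 t i) (fun i t => scaled_tangent sg 0 t i)).
- by apply: ord3P; [exact: dc|exact: ds|move=> t; exact: is_derive_cst].
- by apply: ord3P; [exact: cs|exact: cc|exact: cst_continuous].
- by apply: ord3P => t; rewrite /scaled_nfield /vec3/= ?cos_per ?sin_per.
- by apply: ord3P => t; rewrite /scaled_tangent /vec3/= ?cos_per ?sin_per.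
Qed.

Lemma measurable2_nfield sg i : measurable2 (fun z t => scaled_nfield sg z t i).
Proof. by have [[]] := weak_gradP (weak_grad_nfield sg) i. Qed.
Lemma L2_nfield sg i : L2 (fun z t => scaled_nfield sg z t i).
Proof. by have [] := weak_gradP (weak_grad_nfield sg) i. Qed.
Lemma ae2_negligible (b : R -> R -> bool) : ae2 (fun z t => b z t) <->
  (@mu2 R).-negligible (@Dom R `&` [set p | ~~ b p.1 p.2]).
Proof.
rewrite -ae2P; suff -> : [set p : R * R | ~~ b p.1 p.2] = [set p | ~ b p.1 p.2] by [].
by apply/seteqP; split => p /= /negP.
Qed.

Lemma nfield_H1S2 sg : sg ^+ 2 = 1 -> H1S2 (scaled_nfield sg).
Proof.
move=> sg1; split; first by exists (zero_field, scaled_tangent sg); exact: weak_grad_nfield.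
apply/(@ae2_negligible (fun z t => dot (scaled_nfield sg z t) (scaled_nfield sg z t) == 1)).
apply: aeW => p _; apply/eqP; rewrite dotE /scaled_nfield /vec3/=.
transitivity (sg ^+ 2 * (cos p.2 ^+ 2 + sin p.2 ^+ 2)); first by ring.
by rewrite cos2Dsin2 mulr1.
Qed.

Lemma cst_field_H1S2 sg : sg ^+ 2 = 1 -> H1S2 (cst_field 0 0 sg).
Proof.
move=> sg1; split; first by exists (zero_field, zero_field); exact: weak_grad_cst_field.
apply/(@ae2_negligible (fun z t => dot (cst_field 0 0 sg z t) (cst_field 0 0 sg z t) == 1)).
by apply: aeW => p _; apply/eqP; rewrite dotE /cst_field /vec3/= -[RHS]sg1; ring.
Qed.

Lemma H1S2_sphere m : H1S2 m -> ae2 (fun z t => dot (m z t) (m z t) = 1 :> R).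
Proof.
move=> [_ /(@ae2_negligible (fun z t => dot (m z t) (m z t) == 1)) H].
have aeF2 := ae_filter_ringOfSetsType (mu \x mu)%E.
by apply: filterS H => p + Dp => /(_ Dp)/eqP.
Qed.

Lemma nfield_grad sg G : weak_grad (scaled_nfield sg) G ->
  ae2 (fun z t => G.1 z t = zero_field z t /\ G.2 z t = scaled_tangent sg z t).
Proof. by move=> wG; exact: (weak_grad_unique wG (weak_grad_nfield sg)). Qed.

Lemma cst_field_grad a b c G : weak_grad (cst_field a b c) G ->
  ae2 (fun z t => G.1 z t = zero_field z t /\ G.2 z t = zero_field z t).
Proof. by move=> wG; exact: (weak_grad_unique wG (weak_grad_cst_field a b c)). Qed.

End constant_frames.

(** * Global energy bound and circle means of m.n *)

Section energy_bounds.
Variable R : realType.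
Local Notation mu := (@lebesgue_measure R).
Local Notation A := (`[- 1, 1]%classic : set (measurableTypeR R)).
Local Notation B := (`[- pi, pi]%classic : set (measurableTypeR R)).
Let Npipi : - pi < pi :> R. Proof. by have := pi_gt0 R; lra. Qed.
Let N11 : - 1 < 1 :> R. Proof. by lra. Qed.
Let mA : measurable A. Proof. by []. Qed.
Let mB : measurable B. Proof. by []. Qed.

Lemma energy_nfield (k sg : R) (G : field R * field R) : sg ^+ 2 = 1 -> weak_grad (scaled_nfield sg) G -> energy k (scaled_nfield sg) G = 4 * pi.
Proof.
move=> sg1 wG; have aeF2 := ae_filter_ringOfSetsType (mu \x mu)%E.
have sp := H1S2_sphere (nfield_H1S2 sg1).
have iE := integrable2_frE wG k.
have iZ := integrable2_frZ2 wG.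
rewrite (energyE wG sp) -[RHS]add0r; congr (_ + _).
rewrite -I2D//.
transitivity (I2 (fun _ _ : R => 0 : R)); last first.
  by rewrite /I2 Rintegral_cst ?mul0r//; exact: measurable_Dom.
apply: ae_eq_I2; last 2 first.
- exact: measurable2_cst.
- apply: filterS (nfield_grad wG) => p + Dp => /(_ Dp)[E1 E2].
  have cs := cos2Dsin2 p.2.
  have V0 : frV (scaled_nfield sg) p.1 p.2 = 0 by rewrite /frV /scaled_nfield /vec3/=; ring.
  have U1 : frU (scaled_nfield sg) p.1 p.2 = sg.
    by rewrite /frU /scaled_nfield /vec3/= -[RHS]mulr1 -cs; ring.
  rewrite /frZ2 /frE /slice_energy /frDU /frDV /frDW V0 U1 E1 E2.
  rewrite dotE /zero_field /scaled_tangent /frW /scaled_nfield /vec3/=.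
  have -> : sg * - sin p.2 * cos p.2 + sg * cos p.2 * sin p.2 = 0 by ring.
  have -> : sg * - sin p.2 * - sin p.2 + sg * cos p.2 * cos p.2 = sg.
    by rewrite -[RHS]mulr1 -cs; ring.
  by ring.
have mm i := (let: And5 a _ _ _ _ := weak_gradP wG i in a).1.
have m1 i := (let: And5 _ a _ _ _ := weak_gradP wG i in a).1.
have m2 i := (let: And5 _ _ a _ _ := weak_gradP wG i in a).1.
apply: measurable2D; first exact: measurable2_dot.
have mU := (L2_frU wG).1; have mV := (L2_frV wG).1; have mW := mm i2.
have mDU := (L2_frDU wG).1; have mDV := (L2_frDV wG).1; have mDW := m2 i2.
exact: (measurable2D (measurable2D (measurable2D (measurable2D (measurable2D (measurable2X 2 mDU) (measurable2X 2 mDV)) (measurable2X 2 mDW))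
    (measurable2M (measurable2_cst 2) (measurable2B (measurable2M mU mDV) (measurable2M mV mDU)))) (measurable2M (measurable2_cst k) (measurable2X 2 mV)))
    (measurable2M (measurable2_cst (k - 1)) (measurable2X 2 mW))).
Qed.

Variables (m : field R) (G : field R * field R).
Hypothesis mG : weak_grad m G.
Hypothesis sph : ae2 (fun z t => dot (m z t) (m z t) = 1).

Lemma frZ2_ge0 z t : 0 <= frZ2 G z t.
Proof. by rewrite /frZ2 dotE !addr_ge0 -?expr2 ?sqr_ge0. Qed.

Lemma I2_frZ2_ge0 : 0 <= I2 (frZ2 G).
Proof. by apply: Rintegral_ge0 => p _; exact: frZ2_ge0. Qed.

Lemma frDS_ge0 z t : 0 <= frD2 m G z t + frS2 m z t.
Proof. by rewrite /frD2 /frS2 !addr_ge0 ?sqr_ge0. Qed.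

(** The potential is nondecreasing in k, so the circle inequality for k = 3 is integrated over z. *)
Lemma energy_global (k : R) : 3 <= k ->
  4 * pi + I2 (frZ2 G) + (I2 (fun z t => frD2 m G z t + frS2 m z t)) / 100 <= energy k m G.
Proof.
move=> k3; have aeF := ae_filter_ringOfSetsType mu.
rewrite (energyE mG sph) [leRHS]addrC -addrA lerD2l lerD2l.
have iDS := integrable2D (integrable2_frD2 mG) (integrable2_frS2 mG).
apply: (@le_trans _ _ (I2 (frE m G 3))); last first.
  apply: I2_le; [exact: integrable2_frE|exact: integrable2_frE|].
  apply: aeW => p _; rewrite /frE /slice_energy -subr_ge0.
  have := sqr_ge0 (frV m p.1 p.2); have := sqr_ge0 (frW m p.1 p.2) => w0 v0.
  have k30 : 0 <= k - 3 by rewrite subr_ge0.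
  rewrite [X in 0 <= X](_ : _ = (k - 3) * frV m p.1 p.2 ^+ 2 + (k - 3) * frW m p.1 p.2 ^+ 2).
    by apply: addr_ge0; apply: mulr_ge0.
  by ring.
rewrite mulrC -I2Z// -subr_ge0 -I2B; [|exact: integrable2_frE|exact: integrable2Z].
apply: I2_section_ge0; first by apply: integrable2B; [exact: integrable2_frE|exact: integrable2Z].
apply: filterS3 (frE_global_section mG sph) (ae_section_integrable iDS)
  (ae_section_integrable (integrable2_frE mG 3)) => z H iz iE Az.
have {}iE := iE Az; have {}iz := iz Az; have {}H := H Az.
rewrite (RintegralB mB iE (integrableRZ mB 100^-1 iz)) subr_ge0.
by rewrite (RintegralZl 100^-1 mB iz) mulrC.
Qed.

Let Lm i : L2 (fun z t => m z t i). Proof. by have [] := weak_gradP mG i. Qed.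
Let LG1 i : L2 (fun z t => G.1 z t i). Proof. by have [] := weak_gradP mG i. Qed.

Definition frZU : sfield R := fun z t => G.1 z t i0 * cos t + G.1 z t i1 * sin t.

Lemma L2_frZU : L2 frZU.
Proof. by apply: L2_rotate => //; [exact: continuous_cos|exact: continuous_sin]. Qed.

Lemma frZU_le z t : frZU z t ^+ 2 <= frZ2 G z t.
Proof.
rewrite /frZ2 dotE /frZU -subr_ge0.
have cs := cos2Dsin2 t.
have -> : G.1 z t i0 * G.1 z t i0 + G.1 z t i1 * G.1 z t i1 + G.1 z t i2 * G.1 z t i2
   - (G.1 z t i0 * cos t + G.1 z t i1 * sin t) ^+ 2
   = (G.1 z t i0 * sin t - G.1 z t i1 * cos t) ^+ 2 + G.1 z t i2 ^+ 2
     + (1 - (cos t ^+ 2 + sin t ^+ 2)) * (G.1 z t i0 ^+ 2 + G.1 z t i1 ^+ 2) by ring.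
by rewrite cs subrr mul0r addr0 addr_ge0// sqr_ge0.
Qed.

(** Because n is independent of z, the circle mean of m.n is absolutely continuous in z and its
    density is the circle mean of m_z.n. This is the only link between different circles. *)
Lemma frU_mean : exists K : R -> R,
  primitive (- 1) 1 K (fun z => \int[mu]_(t in B) frZU z t) /\
  {ae mu, forall z, A z -> \int[mu]_(t in B) frU m z t = K z}.
Proof.
have aeF := ae_filter_ringOfSetsType mu.
have cs := @continuous_sin R; have cc := @continuous_cos R; have cNs := @continuous_Nsin R.
have [_ _ _ w0 _] := weak_gradP mG i0; have [_ _ _ w1 _] := weak_gradP mG i1.
have [K0 [p0 E0]] := weak_dz_mean (L2_int (Lm i0)) (L2_int (LG1 i0)) w0
  (@is_derive_cos R) cNs (@cos_per R).
have [K1 [p1 E1]] := weak_dz_mean (L2_int (Lm i1)) (L2_int (LG1 i1)) w1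
  (@is_derive_sin R) cc (@sin_per R).
exists (fun z => K0 z + K1 z).
have key (X : field R) : (forall i, integrable2 (fun z t => X z t i)) ->
   {ae mu, forall z, A z -> \int[mu]_(t in B) (X z t i0 * cos t + X z t i1 * sin t) =
     \int[mu]_(t in B) (X z t i0 * cos t) + \int[mu]_(t in B) (X z t i1 * sin t)}.
  move=> iX; apply: filterS2 (ae_section_integrable (iX i0)) (ae_section_integrable (iX i1)).
  move=> z h0 h1 Az; rewrite RintegralD//.
  - by apply: integrable_mul_continuous => //; exact: h0.
  - by apply: integrable_mul_continuous => //; exact: h1.
split; last first.
  apply: filterS3 E0 E1 (key m (fun i => L2_int (Lm i))) => z E0 E1 E Az.
  by rewrite /frU E// E0// E1.
have [i pE] := primitiveD p0 p1.
have aeE := key G.1 (fun i => L2_int (LG1 i)).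
have mR : measurable_fun A (fun z => \int[mu]_(t in B) frZU z t).
  exact: integrableRmeas (integrable_section (L2_int L2_frZU)).
split.
  apply: (ae_eq_integrable mA mR _ i).
  by apply: filterS aeE => z E Az; rewrite /frZU E.
move=> z /andP[z1 z2]; rewrite pE ?z1//; congr (_ + _).
have sub : `[- 1, z]%classic `<=` A by apply: subset_itvScc; rewrite bnd_simp.
apply: ae_eq_Rintegral => //.
- by apply: measurable_funS sub (integrableRmeas i).
- by apply: measurable_funS sub mR.
- by apply: filterS aeE => y E /sub Ay; rewrite /frZU E.
Qed.

End energy_bounds.

(** * Local and global minimality, and uniqueness *)

Section minimality.
Variable R : realType.
Local Notation mu := (@lebesgue_measure R).
Local Notation A := (`[- 1, 1]%classic : set (measurableTypeR R)).
Local Notation B := (`[- pi, pi]%classic : set (measurableTypeR R)).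
Let Npipi : - pi < pi :> R. Proof. by have := pi_gt0 R; lra. Qed.
Let N11 : - 1 < 1 :> R. Proof. by lra. Qed.
Let mA : measurable A. Proof. by []. Qed.
Let mB : measurable B. Proof. by []. Qed.

Lemma L2B (f g : sfield R) : L2 f -> L2 g -> L2 (fun z t => f z t - g z t).
Proof.
move=> Lf Lg; apply: L2D => //.
have L1 : bounded2 (fun _ _ : R => - 1 : R) by exists 1 => *; rewrite normrN normr1.
have := L2_boundedM Lg (measurable2_cst (- 1)) L1.
rewrite (_ : (fun z t => _) = (fun z t => - g z t))//.
by apply/funext => z; apply/funext => t; rewrite mulrN1.
Qed.

Section one_map.
Variables (m : field R) (G : field R * field R).
Hypothesis mG : weak_grad m G.
Hypothesis sph : ae2 (fun z t => dot (m z t) (m z t) = 1).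

Let iU := L2_int (L2_frU mG).

Let integrable2_dist (sg : R) : integrable2 (fun z t => 2 * (1 - sg * frU m z t)).
Proof. by apply: integrable2Z; apply: integrable2B; [exact: integrable2_cst|exact: integrable2Z]. Qed.

(** On the sphere 2 (1 - sg u) equals |m - sg n|^2. Being affine in u, it inherits the absolutely
    continuous circle mean. *)
Lemma frU_dist_mean (sg : R) : exists C : R -> R,
  primitive (- 1) 1 C (fun z => - 2 * sg * \int[mu]_(t in B) frZU G z t) /\
  {ae mu, forall z, A z -> \int[mu]_(t in B) (2 * (1 - sg * frU m z t)) = C z}.
Proof.
have aeF := ae_filter_ringOfSetsType mu.
have [K [pK EK]] := frU_mean mG.
exists (fun z => 4 * pi + - 2 * sg * K z); split.
  apply: (eq_primitive N11 _ _ (primitiveD (primitive_cst (- 1) 1 (4 * pi)) (primitiveZ (- 2 * sg) pK))) => // z _.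
  by rewrite add0r.
apply: filterS2 EK (ae_section_integrable iU) => z + + Az => /(_ Az) EK /(_ Az) iz.
have i1 : mu.-integrable B (EFin \o (fun=> 2 : R)).
  by apply: continuous_integrable_itv => x; exact: cvg_cst.
transitivity (\int[mu]_(t in B) (2 + - 2 * sg * frU m z t)).
  by apply: eq_Rintegral => t _; ring.
rewrite (RintegralD mB i1 (integrableRZ mB (- 2 * sg) iz)) (RintegralZl _ mB iz) EK.
congr (_ + _); rewrite Rintegral_cst//= lebesgue_measure_itv/= lte_fin Npipi -EFinB/=.
by ring.
Qed.

(* The W^{1,1} norm on [-1,1] of the squared L^2 distance of the slices to sg n controls its
   supremum; the free parameter r comes from 2|x| <= r + x^2/r. *)
Lemma frU_dist_sup (sg r : R) : sg ^+ 2 = 1 -> 0 < r ->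
  {ae mu, forall z, A z -> 2 * \int[mu]_(t in B) frS2 m z t <=
    I2 (fun z t => 2 * (1 - sg * frU m z t)) + 2 * (r * (4 * pi) + r^-1 * I2 (frZ2 G))}.
Proof.
move=> sg1 r0; have aeF := ae_filter_ringOfSetsType mu.
have [C [pC EC]] := frU_dist_mean sg.
have iS := integrable2_frS2 mG; have iZU := L2M (L2_frZU mG) (L2_frZU mG).
have sgn : `|sg| = 1.
  by apply/eqP; rewrite -sqrp_eq1// -normrX sg1 normr1.
have HC : I2 (fun z t => 2 * (1 - sg * frU m z t)) = \int[mu]_(z in A) C z.
  rewrite I2_iterated//; apply: ae_eq_Rintegral => //.
  - exact: integrableRmeas (integrable_section (integrable2_dist sg)).
  - exact: (primitive_measurable N11 pC).
have HD : \int[mu]_(z in A) `|- 2 * sg * \int[mu]_(t in B) frZU G z t| <=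
    r * (4 * pi) + r^-1 * I2 (frZ2 G).
  have i2 : integrable2 (fun z t => r * 1 + r^-1 * (frZU G z t * frZU G z t)).
    by apply: integrable2D; apply: integrable2Z; [exact: integrable2_cst|exact: iZU].
  apply: (@le_trans _ _ (I2 (fun z t => r * 1 + r^-1 * (frZU G z t * frZU G z t)))); last first.
    rewrite I2D; [|exact: integrable2Z (integrable2_cst 1)|exact: integrable2Z iZU].
    rewrite (I2Z r (integrable2_cst 1)) I2_cst1 (I2Z r^-1 iZU) lerD2l ler_pM2l ?invr_gt0//.
    apply: I2_le => //; first exact: (integrable2_frZ2 mG).
    by apply: aeW => p _; rewrite -expr2; exact: frZU_le.
  rewrite (I2_iterated i2); apply: ae_le_Rintegral => //.
  - by apply: integrable_norm; have [] := pC.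
  - exact: integrable_section i2.
  apply: filterS2 (ae_section_integrable (L2_int (L2_frZU mG))) (ae_section_integrable i2).
  move=> z + + Az => /(_ Az) iz /(_ Az) i2z.
  rewrite normrM normrM sgn normrN (ger0_norm (ler0n _ 2)) (mulr1 (2 : R)).
  apply: (@le_trans _ _ (2 * \int[mu]_(t in B) `|frZU G z t|)).
    by apply: ler_wpM2l => //; exact: le_normr_Rintegral.
  have inz := integrable_norm iz.
  rewrite -(RintegralZl 2 mB inz); apply: (le_Rintegral mB (integrableRZ mB 2 inz) i2z).
  move=> t _; rewrite mulr1 -(ler_pM2l r0) mulrDr mulrA mulrA divff ?lt0r_neq0// mul1r.
  rewrite -[X in _ <= _ + X]expr2 -(real_normK (num_real (frZU G z t))).
  by have := sqr_ge0 (r - `|frZU G z t|); rewrite /=; move: `|frZU G z t| => y; lra.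
have cmp := ae2_section (frame_sphere sph).
have ints : {ae mu, forall z, (A z -> mu.-integrable B (EFin \o frS2 m z)) /\
    (A z -> mu.-integrable B (EFin \o (fun t => 2 * (1 - sg * frU m z t))))}.
  by apply: filterS2 (ae_section_integrable iS) (ae_section_integrable (integrable2_dist sg)).
apply: filterS3 EC cmp ints => z EC sz [iSz idz] Az.
have {}EC := EC Az; have {}sz := sz Az; have {}iSz := iSz Az; have {}idz := idz Az.
have z11 : - 1 <= z <= 1 by move: Az; rewrite /= in_itv.
have := primitive_le_mean N11 pC z11.
rewrite -HC -EC opprK => H.
(* On the sphere the difference of the integrands is the square of 1 - sg u. *)
have H2 : \int[mu]_(t in B) frS2 m z t <= \int[mu]_(t in B) (2 * (1 - sg * frU m z t)).
  apply: ae_le_Rintegral => //.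
  apply: filterS sz => t + Bt => /(_ Bt) s1.
  rewrite /frS2; have := sqr_ge0 (1 - sg * frU m z t).
  have -> : (1 - sg * frU m z t) ^+ 2 = 1 - 2 * sg * frU m z t + sg ^+ 2 * frU m z t ^+ 2 by ring.
  rewrite sg1; lra.
move: H H2 HD.
move: (I2 _) (Rintegral _ _ _) (Rintegral _ _ _) (Rintegral _ _ _) (_ + r^-1 * _).
by move=> a1 a2 a3 a4 a5 H H2 HD; lra.
Qed.

Lemma energy_local (k sg : R) : 1 < k -> sg ^+ 2 = 1 ->
  I2 (fun z t => 2 * (1 - sg * frU m z t)) <= 1 / 50 * (1 / 100) * (1 / 100) * (1 / 2) ->
  I2 (frZ2 G) <= 1 / 50 * (1 / 100) * (1 / 100) * (1 / 2) -> 4 * pi <= energy k m G.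
Proof.
move=> k1 sg1 h1 h2; have aeF := ae_filter_ringOfSetsType mu.
rewrite (energyE mG sph) lerDr; apply: addr_ge0; first exact: I2_frZ2_ge0.
apply: I2_section_ge0; first exact: integrable2_frE.
(* With r = 1/5000, pi <= 4 and both integrals at most 10^-6, the circle integral of v^2 + w^2 is at
   most 10^-6 / 2 + 16/5000 + 1/200, below the 1/72 needed on each circle. *)
have r0 : 0 < 1 / 50 * (1 / 100) :> R by lra.
apply: filterS2 (frU_dist_sup sg1 r0) (frE_integral_ge0 mG sph k) => z Hs HE Az.
apply: HE => //; have := Hs Az.
have p4 : pi <= 4 :> R by have := pihalf_lt2 R; lra.
have Z : (1 / 50 * (1 / 100) : R)^-1 * I2 (frZ2 G) <= 1 / 200.
  have -> : (1 / 50 * (1 / 100) : R)^-1 = 50 * 100 by field.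
  by lra.
by lra.
Qed.

End one_map.

(** The squared H^1 distance dominates both quantities that [energy_local] needs small: its
    zeroth-order part is 2 (1 - sg u) on the sphere, and its z-derivative part is |m'_z|^2 because n
    is independent of z. *)
Lemma nfield_local_minimizer (k sg : R) : 1 < k -> sg ^+ 2 = 1 -> cyl_local_minimizer k (scaled_nfield sg).
Proof.
move=> k1 sg1; split; first exact: nfield_H1S2.
move=> G wG; exists (1 / 50 * (1 / 100) * (1 / 100) * (1 / 2)); split; first by lra.
move=> m' G' mS mG dist; have aeF2 := ae_filter_ringOfSetsType (mu \x mu)%E.
rewrite (energy_nfield k sg1 wG).
have sph := H1S2_sphere mS.
have LG i : L2 (fun z t => G.1 z t i) /\ L2 (fun z t => G.2 z t i).
  by have [] := weak_gradP wG i.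
have LG' i : L2 (fun z t => G'.1 z t i) /\ L2 (fun z t => G'.2 z t i).
  by have [] := weak_gradP mG i.
have Lm i : L2 (fun z t => m' z t i) by have [] := weak_gradP mG i.
have id1 : integrable2 (fun z t => dot (cyl_subf m' (scaled_nfield sg) z t) (cyl_subf m' (scaled_nfield sg) z t)).
  by apply: integrable2_dot => i; exact: (L2B (Lm i) (L2_nfield sg i)).
have id2 : integrable2 (fun z t => dot (cyl_subf G'.1 G.1 z t) (cyl_subf G'.1 G.1 z t)).
  by apply: integrable2_dot => i; exact: (L2B (LG' i).1 (LG i).1).
have id3 : integrable2 (fun z t => dot (cyl_subf G'.2 G.2 z t) (cyl_subf G'.2 G.2 z t)).
  by apply: integrable2_dot => i; exact: (L2B (LG' i).2 (LG i).2).
have dge0 (v : vec R) : 0 <= dot v v by rewrite dotE -!expr2 !addr_ge0 ?sqr_ge0.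
apply: (energy_local mG sph k1 sg1); apply: le_trans (ltW dist); apply: I2_le.
- apply: integrable2Z; apply: integrable2B; first exact: integrable2_cst.
  by apply: integrable2Z; exact: L2_int (L2_frU mG).
- exact: integrable2D (integrable2D id1 id2) id3.
- apply: filterS sph => p + Dp => /(_ Dp) sp.
  rewrite -addrA; apply: (@le_trans _ _ (dot (cyl_subf m' (scaled_nfield sg) p.1 p.2) (cyl_subf m' (scaled_nfield sg) p.1 p.2)));
    last by rewrite lerDl addr_ge0.
  have {}sp : dot (m' p.1 p.2) (m' p.1 p.2) + sg ^+ 2 * (cos p.2 ^+ 2 + sin p.2 ^+ 2) = 2.
    by rewrite sp sg1 cos2Dsin2; ring.
  rewrite le_eqVlt; apply/orP; left; apply/eqP.
  transitivity (dot (m' p.1 p.2) (m' p.1 p.2) + sg ^+ 2 * (cos p.2 ^+ 2 + sin p.2 ^+ 2)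
    - 2 * sg * (m' p.1 p.2 i0 * cos p.2 + m' p.1 p.2 i1 * sin p.2)).
    by rewrite sp /frU; ring.
  by rewrite !dotE /cyl_subf /scaled_nfield /vec3/=; ring.
- exact: (integrable2_frZ2 mG).
- exact: integrable2D (integrable2D id1 id2) id3.
apply: filterS (nfield_grad wG) => p + Dp => /(_ Dp)[E1 _].
rewrite /frZ2 addrAC; apply: (@le_trans _ _ (dot (cyl_subf G'.1 G.1 p.1 p.2) (cyl_subf G'.1 G.1 p.1 p.2)));
  last by rewrite lerDr addr_ge0.
by rewrite /cyl_subf E1 /zero_field !dotE !subr0.
Qed.

Lemma nfield_global_minimizer (k sg : R) : 3 <= k -> sg ^+ 2 = 1 -> cyl_global_minimizer k (scaled_nfield sg).
Proof.
move=> k3 sg1; split; first exact: nfield_H1S2.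
move=> G wG m' G' mS mG; rewrite (energy_nfield k sg1 wG).
apply: le_trans (energy_global mG (H1S2_sphere mS) k3).
rewrite -addrA lerDl addr_ge0//; first exact: I2_frZ2_ge0.
by rewrite divr_ge0//; apply: Rintegral_ge0 => p _; exact: frDS_ge0.
Qed.

Lemma global_minimizer_unique (k : R) m : 3 <= k -> cyl_global_minimizer k m ->
  cyl_ae_eq m (scaled_nfield 1) \/ cyl_ae_eq m (scaled_nfield (- 1)).
Proof.
move=> k3 [mS mmin]; have [[G mG] _] := mS.
have aeF := ae_filter_ringOfSetsType mu; have aeF2 := ae_filter_ringOfSetsType (mu \x mu)%E.
have sph := H1S2_sphere mS.
have sg1 : (1 : R) ^+ 2 = 1 by rewrite expr1n.
have := mmin G mG _ _ (nfield_H1S2 sg1) (weak_grad_nfield 1).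
rewrite (energy_nfield k sg1 (weak_grad_nfield 1)) => Ele.
have := le_trans (energy_global mG sph k3) Ele.
have Z0 := I2_frZ2_ge0 G.
have DS0 : 0 <= I2 (fun z t => frD2 m G z t + frS2 m z t).
  by apply: Rintegral_ge0 => p _; exact: frDS_ge0.
rewrite -addrA gerDl => le0.
have IZ : I2 (frZ2 G) <= 0.
  by apply: le_trans le0; rewrite lerDl divr_ge0.
have IDS : I2 (fun z t => frD2 m G z t + frS2 m z t) <= 0.
  rewrite -(@pmulr_lle0 _ (100^-1)) ?invr_gt0//.
  by apply: le_trans le0; rewrite lerDr.
have zge : ae2 (fun z t => 0 <= frZ2 G z t) by apply: aeW => p _; exact: frZ2_ge0.
have dge : ae2 (fun z t => 0 <= frD2 m G z t + frS2 m z t).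
  by apply: aeW => p _; exact: frDS_ge0.
have aeZ := I2_eq0_ae (integrable2_frZ2 mG) zge IZ.
have iDS := integrable2D (integrable2_frD2 mG) (integrable2_frS2 mG).
have aeDS := I2_eq0_ae iDS dge IDS.
have [K [pK EK]] := frU_mean mG.
have [iK KE] := pK.
have Kcst z : A z -> K z = K (- 1).
  move=> Az; have z11 : - 1 <= z <= 1 by move: Az; rewrite /= in_itv.
  rewrite KE// -[RHS]addr0; congr (_ + _).
  transitivity (\int[mu]_(x in `[- 1, z]) (0 : R)); last by rewrite Rintegral_cst// mul0r.
  have sub : `[- 1, z]%classic `<=` A.
    by apply: subset_itvScc; rewrite bnd_simp//; case/andP: z11.
  apply: ae_eq_Rintegral => //; first exact: measurable_funS sub (integrableRmeas iK).
  apply: filterS (ae2_section aeZ) => y Hy /sub Ay.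
  transitivity (\int[mu]_(t in B) (0 : R)); last by rewrite Rintegral_cst// mul0r.
  apply: ae_eq_Rintegral => //.
    apply: measurable_funTS.
    exact: (measurableT_comp (L2_frZU mG).1 (pair1_measurable y)).
  apply: filterS (Hy Ay) => t + Bt => /(_ Bt) Z.
  apply/eqP; rewrite -sqrf_eq0 eq_le sqr_ge0 andbT -Z; exact: frZU_le.
(* A priori the sign s depends on the circle. Recording K(-1) = 2 pi s, where K(-1) no longer
   depends on z, forces the same sign on almost all circles. *)
have slice : {ae mu, forall z, A z -> exists s : R, s ^+ 2 = 1 /\ K (- 1) = s * (2 * pi) /\
   {ae mu, forall t, B t -> [/\ frU m z t = s, frV m z t = 0 & frW m z t = 0]}}.
  apply: filterS3 (frame_slices mG sph) (ae2_section aeDS) EK => z Hz HDS HK Az.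
  have [u [v [w [du [dv [dw [[pu pv pw] _ [uvE dE] sp _]]]]]]] := Hz Az.
  have DS : {ae mu, forall t, B t -> [/\ du t = 0, v t = 0 & w t = 0]}.
    apply: filterS3 uvE dE (HDS Az) => t + + + Bt.
    move=> /(_ Bt)[_ -> ->] /(_ Bt)[-> _ _] /(_ Bt); rewrite /frD2 /frS2 => E.
    have d1 := sqr_ge0 (frDU m G z t); have d2 := sqr_ge0 (frDV m G z t).
    have d3 := sqr_ge0 (frDW G z t); have d4 := sqr_ge0 (frV m z t).
    have d5 := sqr_ge0 (frW m z t).
    by split; apply/eqP; rewrite -sqrf_eq0; apply/eqP; lra.
  have [idu uE] := pu.
  have ucst t : B t -> u t = u (- pi).
    move=> Bt; have tpi : - pi <= t <= pi by move: Bt; rewrite /= in_itv.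
    rewrite uE// -[RHS]addr0; congr (_ + _).
    transitivity (\int[mu]_(x in `[- pi, t]) (0 : R)); last by rewrite Rintegral_cst// mul0r.
    have sub : `[- pi, t]%classic `<=` B.
      by apply: subset_itvScc; rewrite bnd_simp//; case/andP: tpi.
    apply: ae_eq_Rintegral => //; first exact: measurable_funS sub (integrableRmeas idu).
    by apply: filterS DS => y Hy /sub /Hy[].
  have uvw : {ae mu, forall t, B t -> [/\ frU m z t = u (- pi), frV m z t = 0 & frW m z t = 0]}.
    apply: filterS2 uvE DS => t + + Bt => /(_ Bt)[<- <- <-] /(_ Bt)[_ -> ->].
    by split => //; exact: ucst.
  exists (u (- pi)); split; last split => //.
  (* An almost-everywhere statement about a constant; integrating it over the circle, of positive
     length, extracts the equality. *)
  - have H : {ae mu, forall t, B t -> u (- pi) ^+ 2 = 1}.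
      apply: filterS2 sp DS => t + + Bt => /(_ Bt) + /(_ Bt)[_ v0 w0].
      by rewrite v0 w0 ucst// expr0n/= !addr0.
    have := ae_eq_Rintegral mB (measurable_cst _) (measurable_cst _) H.
    rewrite !Rintegral_cst//= lebesgue_measure_itv/= lte_fin Npipi -EFinB/=.
    by apply: mulIf; apply: lt0r_neq0; have := pi_gt0 R; lra.
  rewrite -(Kcst z Az) -HK//.
  transitivity (\int[mu]_(t in B) u (- pi)).
    apply: ae_eq_Rintegral => //.
      apply: measurable_funTS.
      exact: (measurableT_comp (L2_frU mG).1 (pair1_measurable z)).
    by apply: filterS uvw => t + Bt => /(_ Bt)[].
  rewrite Rintegral_cst//= lebesgue_measure_itv/= lte_fin Npipi -EFinB/=.
  by congr (_ * _); ring.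
have final (sg : R) : {ae mu, forall z, A z -> {ae mu, forall t, B t ->
    [/\ frU m z t = sg, frV m z t = 0 & frW m z t = 0]}} -> cyl_ae_eq m (scaled_nfield sg).
  move=> H.
  have Lm i : L2 (fun z t => m z t i) by have [] := weak_gradP mG i.
  (* Equality of vector fields is encoded as the vanishing of |m - sg n|^2, a measurable scalar
     function, to pass from circles to the cylinder. *)
  have mf : measurable2 (fun z t => dot (cyl_subf m (scaled_nfield sg) z t) (cyl_subf m (scaled_nfield sg) z t)).
    by apply: measurable2_dot => i; exact: (L2B (Lm i) (L2_nfield sg i)).1.
  have : ae2 (fun z t => dot (cyl_subf m (scaled_nfield sg) z t) (cyl_subf m (scaled_nfield sg) z t) = 0).
    apply: section_ae2 => //; apply: filterS H => z H Az.
    apply: filterS (H Az) => t + Bt => /(_ Bt)[U V W].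
    have cs := cos2Dsin2 t.
    have m0 : m z t i0 = sg * cos t.
      rewrite -U -[LHS]mulr1 -cs -[RHS]subr0 -[X in _ = _ - X](mul0r (sin t)) -V /frU /frV; ring.
    have m1 : m z t i1 = sg * sin t.
      rewrite -U -[LHS]mulr1 -cs -[RHS]addr0 -[X in _ = _ + X](mul0r (cos t)) -V /frU /frV; ring.
    rewrite dotE /cyl_subf m0 m1 (_ : m z t i2 = 0)// /scaled_nfield /vec3/=; ring.
  move=> H0; apply/(@ae2_negligible _ (fun z t => m z t == scaled_nfield sg z t)).
  apply: filterS H0 => p + Dp => /(_ Dp); rewrite dotE -!expr2 => E.
  apply/eqP/funext => i.
  have d0 := sqr_ge0 (cyl_subf m (scaled_nfield sg) p.1 p.2 i0).
  have d1 := sqr_ge0 (cyl_subf m (scaled_nfield sg) p.1 p.2 i1).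
  have d2 := sqr_ge0 (cyl_subf m (scaled_nfield sg) p.1 p.2 i2).
  apply/eqP; rewrite -subr_eq0 -sqrf_eq0 -/(cyl_subf m (scaled_nfield sg) p.1 p.2 i); move: i.
  by apply: ord3P; apply/eqP; lra.
have pi0 : 2 * pi != 0 :> R by apply: lt0r_neq0; have := pi_gt0 R; lra.
have [KE1|KN1] := eqVneq (K (- 1)) (2 * pi); [left|right]; apply: final;
  apply: filterS slice => z H Az; have [s [s1 [Ks Hs]]] := H Az.
  suff -> : (1 : R) = s by [].
  by apply: (mulIf pi0); rewrite mul1r -Ks KE1.
suff -> : (- 1 : R) = s by [].
move/eqP: s1; rewrite sqrf_eq1 => /orP[/eqP s1|/eqP ->//].
by move: KN1; rewrite Ks s1 mul1r eqxx.
Qed.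

End minimality.

(** * Criticality and stability *)

Section critical_points.
Variable R : realType.
Local Notation mu := (@lebesgue_measure R).
Local Notation A := (`[- 1, 1]%classic : set (measurableTypeR R)).
Local Notation B := (`[- pi, pi]%classic : set (measurableTypeR R)).
Let Npipi : - pi < pi :> R. Proof. by have := pi_gt0 R; lra. Qed.
Let mA : measurable A. Proof. by []. Qed.
Let mB : measurable B. Proof. by []. Qed.
Implicit Types (k : R) (m phi : field R) (G Gphi : field R * field R).

Let weak_mf m G : weak_grad m G -> [/\ forall i, measurable2 (fun z t => m z t i),
  forall i, measurable2 (fun z t => G.1 z t i) & forall i, measurable2 (fun z t => G.2 z t i)].
Proof. by move=> wG; split => i; have [[? _] [? _] [? _] _ _] := weak_gradP wG i. Qed.

Let measurable2_n i : measurable2 (fun z t => cyl_nfield z t i : R).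
Proof. by rewrite nfieldE; exact: measurable2_nfield. Qed.

Let measurable2_lam k m G : weak_grad m G -> measurable2 (lam k m G).
Proof.
move=> wG; have [mm m1 m2] := weak_mf wG.
apply: measurable2B; first by apply: measurable2D; exact: measurable2_dot.
by apply: measurable2M; [exact: measurable2_cst|apply: measurable2X; exact: measurable2_dot].
Qed.

Let measurable2_critical k m G phi Gphi : weak_grad m G -> weak_grad phi Gphi ->
  measurable2 (fun z t => gradprod G Gphi z t
          - k * dot (m z t) (cyl_nfield z t) * dot (phi z t) (cyl_nfield z t)
          - lam k m G z t * dot (m z t) (phi z t)).
Proof.
move=> wG wp; have [mm m1 m2] := weak_mf wG; have [pm p1 p2] := weak_mf wp.
apply: measurable2B; last by apply: measurable2M; [exact: measurable2_lam|exact: measurable2_dot].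
apply: measurable2B; first by apply: measurable2D; exact: measurable2_dot.
by apply: measurable2M; [apply: measurable2M; [exact: measurable2_cst|]|]; exact: measurable2_dot.
Qed.

Let measurable2_second_var k m G phi Gphi : weak_grad m G -> weak_grad phi Gphi ->
  measurable2 (fun z t => gradsq Gphi z t - k * (dot (phi z t) (cyl_nfield z t)) ^+ 2
                 - lam k m G z t * dot (phi z t) (phi z t)).
Proof.
move=> wG wp; have [pm p1 p2] := weak_mf wp.
apply: measurable2B; last by apply: measurable2M; [exact: measurable2_lam|exact: measurable2_dot].
apply: measurable2B; first by apply: measurable2D; exact: measurable2_dot.
by apply: measurable2M; [exact: measurable2_cst|apply: measurable2X; exact: measurable2_dot].
Qed.

Lemma dot_nfield (sg : R) z t : dot (scaled_nfield sg z t) (cyl_nfield z t) = sg.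
Proof.
rewrite dotE /scaled_nfield /cyl_nfield /vec3/= -[RHS]mulr1 -(cos2Dsin2 t); ring.
Qed.

Lemma lam_nfield k (sg : R) G : sg ^+ 2 = 1 -> weak_grad (scaled_nfield sg) G ->
  ae2 (fun z t => [/\ G.1 z t = zero_field z t, G.2 z t = scaled_tangent sg z t & lam k (scaled_nfield sg) G z t = 1 - k]).
Proof.
move=> sg1 wG; have aeF2 := ae_filter_ringOfSetsType (mu \x mu)%E.
apply: filterS (nfield_grad wG) => p + Dp => /(_ Dp)[E1 E2]; split => //.
rewrite /lam /gradsq dot_nfield E1 E2 sg1 !dotE /zero_field /scaled_tangent /vec3/=.
transitivity (sg ^+ 2 * (cos p.2 ^+ 2 + sin p.2 ^+ 2) - k); first by ring.
by rewrite sg1 cos2Dsin2 mulr1.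
Qed.

(** Since [lam] is 1 - k, the terms in k cancel and the weak equation reduces to the integral of
    phi_t.n' - phi.n. As phi need not vanish at z = -1 and z = 1, n is not tested against phi: the
    roles are exchanged, and the components of n' serve as periodic test functions for phi on almost
    every circle, with n'' = - n. *)
Lemma nfield_critical k (sg : R) : sg ^+ 2 = 1 -> cyl_critical k (scaled_nfield sg).
Proof.
move=> sg1; split; first exact: nfield_H1S2.
move=> G wG phi Gphi [wp _].
have aeF := ae_filter_ringOfSetsType mu; have aeF2 := ae_filter_ringOfSetsType (mu \x mu)%E.
have [L0 _ G0 _ w0] := weak_gradP wp i0; have [L1 _ G1 _ w1] := weak_gradP wp i1.
have cs := @continuous_sin R; have cc := @continuous_cos R; have cNs := @continuous_Nsin R.
have cNc : continuous (fun t : R => - cos t) by move=> t; apply: cvgN; exact: cc.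
have dNs (t : R) : is_derive t 1 (fun t => - sin t) (- cos t) by apply: is_derive_eq.
have pNs : per2pi (fun t : R => - sin t) by move=> t; rewrite sin_per.
have e0 := weak_dt_section (L2_int L0) (L2_int G0) w0 dNs cNc pNs.
have e1 := weak_dt_section (L2_int L1) (L2_int G1) w1 (@is_derive_cos R) cNs (@cos_per R).
pose g : sfield R := fun z t => Gphi.2 z t i0 * - sin t + Gphi.2 z t i1 * cos t.
pose h : sfield R := fun z t => phi z t i0 * - cos t + phi z t i1 * - sin t.
have Lg : L2 g by exact: L2_rotate.
have Lh : L2 h by exact: L2_rotate.
transitivity (I2 (fun z t => sg * (g z t + h z t))).
  apply: ae_eq_I2; first exact: measurable2_critical.
    by apply: measurable2M; [exact: measurable2_cst|exact: measurable2D Lg.1 Lh.1].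
  apply: filterS (lam_nfield k sg1 wG) => p + Dp => /(_ Dp)[E1 E2 El].
  rewrite El /gradprod E1 E2 dot_nfield !dotE /zero_field /scaled_tangent /scaled_nfield /cyl_nfield /vec3/= /g /h.
  by ring.
rewrite (I2Z sg (integrable2D (L2_int Lg) (L2_int Lh))) I2_iterated; last exact: integrable2D (L2_int Lg) (L2_int Lh).
rewrite [X in _ * X](_ : _ = 0) ?mulr0//.
transitivity (\int[mu]_(z in A) (0 : R)); last by rewrite Rintegral_cst// mul0r.
apply: ae_eq_Rintegral => //.
  exact: integrableRmeas (integrable_section (integrable2D (L2_int Lg) (L2_int Lh))).
have ints : {ae mu, forall z, A z -> [/\ mu.-integrable B (EFin \o (fun t => phi z t i0)),
    mu.-integrable B (EFin \o (fun t => phi z t i1)),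
    mu.-integrable B (EFin \o (fun t => Gphi.2 z t i0)) &
    mu.-integrable B (EFin \o (fun t => Gphi.2 z t i1))]}.
  have H1 : {ae mu, forall z, A z -> mu.-integrable B (EFin \o (fun t => phi z t i0)) /\
      mu.-integrable B (EFin \o (fun t => phi z t i1))}.
    apply: filterS2 (ae_section_integrable (L2_int L0)) (ae_section_integrable (L2_int L1)).
    by move=> z h0 h1 Az; split; [exact: h0|exact: h1].
  apply: filterS3 H1 (ae_section_integrable (L2_int G0)) (ae_section_integrable (L2_int G1)).
  by move=> z h0 h1 h2 Az; have [? ?] := h0 Az; split => //; [exact: h1|exact: h2].
apply: filterS3 e0 e1 ints => z e0 e1 ii Az; have [f0 f1 g0 g1] := ii Az.
have j0 := integrable_mul_continuous g0 cNs; have j1 := integrable_mul_continuous g1 cc.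
have j2 := integrable_mul_continuous f0 cNc; have j3 := integrable_mul_continuous f1 cNs.
rewrite /g /h (RintegralD mB (integrableRD mB j0 j1) (integrableRD mB j2 j3)).
rewrite (RintegralD mB j0 j1) (RintegralD mB j2 j3) (e0 Az) (e1 Az).
by ring.
Qed.

Lemma lam_cst_field k (sg : R) G : weak_grad (cst_field 0 0 sg) G ->
  ae2 (fun z t => [/\ G.1 z t = zero_field z t, G.2 z t = zero_field z t & lam k (cst_field 0 0 sg) G z t = 0]).
Proof.
move=> wG; have aeF2 := ae_filter_ringOfSetsType (mu \x mu)%E.
apply: filterS (cst_field_grad wG) => p + Dp => /(_ Dp)[E1 E2]; split => //.
by rewrite /lam /gradsq E1 E2 !dotE /zero_field /cst_field /cyl_nfield /vec3/=; ring.
Qed.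

Lemma cst_field_critical k (sg : R) : sg ^+ 2 = 1 -> cyl_critical k (cst_field 0 0 sg).
Proof.
move=> sg1; split; first exact: cst_field_H1S2.
move=> G wG phi Gphi [wp _].
have aeF2 := ae_filter_ringOfSetsType (mu \x mu)%E.
transitivity (I2 (fun _ _ : R => 0 : R)); last first.
  by rewrite /I2 Rintegral_cst ?mul0r//; exact: measurable_Dom.
apply: ae_eq_I2; [exact: measurable2_critical|exact: measurable2_cst|].
apply: filterS (lam_cst_field k wG) => p + Dp => /(_ Dp)[E1 E2 El].
by rewrite El /gradprod E1 E2 !dotE /zero_field /cst_field /cyl_nfield /vec3/=; ring.
Qed.

Lemma nfield_stable k (sg : R) : 1 <= k -> sg ^+ 2 = 1 -> cyl_stable k (scaled_nfield sg).
Proof.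
move=> k1 sg1; split; first exact: nfield_critical.
move=> G wG phi Gphi [wp _] tan; have aeF2 := ae_filter_ringOfSetsType (mu \x mu)%E.
have {}tan := proj2 (@ae2_negligible R (fun z t => dot (phi z t) (scaled_nfield sg z t) == 0)) tan.
apply: I2_ge0; first exact: measurable2_second_var.
apply: filterS2 (lam_nfield k sg1 wG) tan => p + + Dp.
move=> /(_ Dp)[_ _ ->] /(_ Dp)/eqP tan0.
have -> : dot (phi p.1 p.2) (cyl_nfield p.1 p.2) = 0.
  transitivity (sg * dot (phi p.1 p.2) (scaled_nfield sg p.1 p.2)); last by rewrite tan0 mulr0.
  rewrite !dotE /scaled_nfield /cyl_nfield /vec3/=.
  transitivity (sg ^+ 2 * (phi p.1 p.2 i0 * cos p.2 + phi p.1 p.2 i1 * sin p.2)); last by ring.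
  by rewrite sg1; ring.
have dge0 (v : vec R) : 0 <= dot v v by rewrite dotE -!expr2 !addr_ge0 ?sqr_ge0.
rewrite expr0n/= mulr0 subr0 subr_ge0; apply: (@le_trans _ _ 0).
  by apply: mulr_le0_ge0 => //; rewrite subr_le0.
by rewrite addr_ge0.
Qed.

Lemma cst_field_H1Linf (a b c : R) : H1Linf (cst_field a b c) (zero_field (R := R), zero_field (R := R)).
Proof.
split; first exact: weak_grad_cst_field.
move=> i; exists `|cst_field a b c 0 0 i|.
rewrite (_ : _ `&` _ = set0); first exact: negligible_set0.
by apply/seteqP; split => // p [_] /=; rewrite ltxx.
Qed.

(** The constant direction e3 has no Dirichlet energy and is orthogonal to n, so only - [lam] = k -
    1 is integrated. *)
Lemma nfield_unstable k (sg : R) : k < 1 -> sg ^+ 2 = 1 -> cyl_unstable k (scaled_nfield sg).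
Proof.
move=> k1 sg1; split; first exact: nfield_critical.
exists (cst_field 0 0 1), (zero_field (R := R), zero_field (R := R)); split; first exact: cst_field_H1Linf.
split.
  apply/(@ae2_negligible R (fun z t => dot (cst_field 0 0 1 z t) (scaled_nfield sg z t) == 0)).
  by apply: aeW => p _; apply/eqP; rewrite dotE /cst_field /scaled_nfield /vec3/=; ring.
move=> G wG; have aeF2 := ae_filter_ringOfSetsType (mu \x mu)%E.
have := measurable2_second_var k wG (weak_grad_cst_field 0 0 1) => mS.
rewrite /second_var (ae_eq_I2 mS (measurable2_cst ((k - 1) * 1))).
  rewrite (I2Z (k - 1) (integrable2_cst 1)) I2_cst1 pmulr_llt0 ?subr_lt0//.
  by rewrite mulr_gt0// pi_gt0.
apply: filterS (lam_nfield k sg1 wG) => p + Dp => /(_ Dp)[_ _ ->].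
by rewrite /gradsq !dotE /zero_field /cst_field /cyl_nfield /vec3/=; ring.
Qed.

(** The integrals of cos^2 and sin^2 add up to the area, and they are equal because cos^2 - sin^2 is
    the derivative of the periodic function sin cos. *)
Lemma I2_cos2 : I2 (fun _ t : R => cos t * cos t) = 2 * pi.
Proof.
have cs := @continuous_sin R; have cc := @continuous_cos R; have cNs := @continuous_Nsin R.
have Lc : L2 (fun _ t : R => cos t).
  by apply: bounded_L2; [exact: measurable2_t (continuous_measurable_fun cc)|exact: bounded2_t].
have Ls : L2 (fun _ t : R => sin t).
  by apply: bounded_L2; [exact: measurable2_t (continuous_measurable_fun cs)|exact: bounded2_t].
have sum : I2 (fun _ t : R => cos t * cos t) + I2 (fun _ t : R => sin t * sin t) = 4 * pi.
  rewrite -(I2D (L2M Lc Lc) (L2M Ls Ls)) -I2_cst1.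
  by apply: eq_I2 => z t _ _; rewrite -!expr2 cos2Dsin2.
have diff : I2 (fun _ t : R => cos t * cos t) - I2 (fun _ t : R => sin t * sin t) = 0.
  rewrite -(I2B (L2M Lc Lc) (L2M Ls Ls)) I2_iterated; last exact: integrable2B (L2M Lc Lc) (L2M Ls Ls).
  transitivity (\int[mu]_(z in A) (0 : R)); last by rewrite Rintegral_cst// mul0r.
  apply: eq_Rintegral => z _.
  have pcos := primitive_derive (- pi) pi (@is_derive_cos R) cNs.
  have psin := primitive_derive (- pi) pi (@is_derive_sin R) cc.
  have := primitive_total Npipi (primitiveM Npipi psin pcos).
  rewrite cosN sinN sinpi oppr0 subrr => <-.
  by apply: eq_Rintegral => t _; rewrite mulrN.
by lra.
Qed.

(** At e3 and - e3 the function [lam] vanishes, so the constant direction e1 leaves only - k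
    cos^2. *)
Lemma cst_field_unstable k (sg : R) : 0 < k -> sg ^+ 2 = 1 -> cyl_unstable k (cst_field 0 0 sg).
Proof.
move=> k0 sg1; split; first exact: cst_field_critical.
exists (cst_field 1 0 0), (zero_field (R := R), zero_field (R := R)); split; first exact: cst_field_H1Linf.
split.
  apply/(@ae2_negligible R (fun z t => dot (cst_field 1 0 0 z t) (cst_field 0 0 sg z t) == 0)).
  by apply: aeW => p _; apply/eqP; rewrite dotE /cst_field /vec3/=; ring.
move=> G wG; have aeF2 := ae_filter_ringOfSetsType (mu \x mu)%E.
have := measurable2_second_var k wG (weak_grad_cst_field 1 0 0) => mS.
have cc := @continuous_cos R.
have Lc : L2 (fun _ t : R => cos t).
  by apply: bounded_L2; [exact: measurable2_t (continuous_measurable_fun cc)|exact: bounded2_t].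
have iN := L2M Lc Lc.
rewrite /second_var (ae_eq_I2 mS (_ : measurable2 (fun z t => - k * (cos t * cos t)))).
- rewrite (I2Z (- k) iN) I2_cos2 nmulr_rlt0 ?oppr_lt0//.
  by rewrite mulr_gt0// pi_gt0.
- by apply: measurable2M; [exact: measurable2_cst|exact: measurable2M Lc.1 Lc.1].
apply: filterS (lam_cst_field k wG) => p + Dp => /(_ Dp)[_ _ ->].
by rewrite /gradsq !dotE /zero_field /cst_field /cyl_nfield /vec3/=; ring.
Qed.

End critical_points.

Theorem mainTheorem5 (R : realType) (k2 : R) (hk2 : 0 < k2) :
  cyl_critical k2 (@cyl_nfield R) /\ cyl_critical k2 (cyl_oppf (@cyl_nfield R)) /\
  cyl_critical k2 (@cyl_e3field R) /\ cyl_critical k2 (cyl_oppf (@cyl_e3field R)) /\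
  (3 <= k2 ->
     cyl_global_minimizer k2 (@cyl_nfield R) /\ cyl_global_minimizer k2 (cyl_oppf (@cyl_nfield R)) /\
     (forall m, cyl_global_minimizer k2 m -> cyl_ae_eq m (@cyl_nfield R) \/ cyl_ae_eq m (cyl_oppf (@cyl_nfield R)))) /\
  (1 <= k2 -> cyl_stable k2 (@cyl_nfield R) /\ cyl_stable k2 (cyl_oppf (@cyl_nfield R))) /\
  (k2 < 1 -> cyl_unstable k2 (@cyl_nfield R) /\ cyl_unstable k2 (cyl_oppf (@cyl_nfield R))) /\
  (1 < k2 -> cyl_local_minimizer k2 (@cyl_nfield R) /\ cyl_local_minimizer k2 (cyl_oppf (@cyl_nfield R))) /\
  cyl_unstable k2 (@cyl_e3field R) /\ cyl_unstable k2 (cyl_oppf (@cyl_e3field R)).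
Proof.
have s1 : (1 : R) ^+ 2 = 1 by rewrite expr1n.
have sN : (- 1 : R) ^+ 2 = 1 by rewrite sqrrN expr1n.
rewrite oppnfieldE nfieldE oppe3fieldE e3fieldE.
split; first exact: nfield_critical.
split; first exact: nfield_critical.
split; first exact: cst_field_critical.
split; first exact: cst_field_critical.
split.
  move=> k3; split; first exact: nfield_global_minimizer.
  split; first exact: nfield_global_minimizer.
  by move=> m; exact: global_minimizer_unique.
split; first by move=> k1; split; exact: nfield_stable.
split; first by move=> k1; split; exact: nfield_unstable.
split; first by move=> k1; split; exact: nfield_local_minimizer.
by split; exact: cst_field_unstable.
Qed.
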